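(* Let $X=\mathbb{H}^n/\Gamma$ be a classical non-compact arithmetic hyperbolic orbifold of the first type of odd dimension $n>4$. Then there is a positive constant $c$ such that, as $\ell\to\infty$, \[ G(\ell)\ge c\cdot\frac{e^{\frac{(n-1)\ell}{2}}}{\ell^2}. \]
   Context: $X$ is classical arithmetic of the first type (necessarily over $\mathbb{Q}$ since non-compact): $\Gamma$ is a lattice in $\mathrm{Isom}(\mathbb{H}^n)$ commensurable with $\mathrm{SO}(q,\mathbb{Z})$ and contained in $\mathrm{SO}(q,\mathbb{Q})$ for a rational quadratic form $q$ of signature $(n,1)$. Let $L(X)=\{\ell_1<\ell_2<\cdots\}$ be the primitive length spectrum of $X$ without multiplicities, and for $\ell_k\in L(X)$ let $g(\ell_k)$ be the number of homotopy classes of primitive closed geodesics in $X$ of length $\ell_k$. Define $N(\ell)=\sum_{\ell_k\le\ell}g(\ell_k)$, $\widehat N(\ell)=\sum_{\ell_k\le\ell}1$, and the multiplicity average $G(\ell)=N(\ell)/\widehat N(\ell)$. *)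

(* Defs.v *)
From mathcomp Require Import all_boot all_order all_algebra finmap.
From mathcomp Require Import all_classical all_reals all_analysis.

Set Implicit Arguments.
Unset Strict Implicit.
Unset Printing Implicit Defensive.

Import Order.TTheory GRing.Theory Num.Theory.
Import numFieldNormedType.Exports.

Local Open Scope classical_set_scope.
Local Open Scope ring_scope.

Section HyperbolicSpace.
Context {R : realType} (n : nat).
Implicit Types (x y : 'cV[R]_n.+1) (A B : 'M[R]_n.+1).

(* Gram matrix of x_0^2 + ... + x_(n-1)^2 - x_n^2. *)
Definition lorentz_mx : 'M[R]_n.+1 :=
  diag_mx (\row_i (if i == ord_max then -1 else 1)).

Definition lorentz x y : R := (x^T *m lorentz_mx *m y) 0 0.

(* Hyperboloid model of H^n: the upper sheet of <x, x> = -1. *)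
Definition hyp_space : set 'cV[R]_n.+1 :=
  [set x | lorentz x x = -1 /\ 0 < x ord_max 0].

Definition arcosh (t : R) : R := ln (t + Num.sqrt (t ^+ 2 - 1)).

Definition hyp_dist x y : R := arcosh (- lorentz x y).

(* Isom(H^n) = PO(n,1), realized as the group of Lorentz matrices preserving
   the upper sheet; orientation-reversing isometries are included. *)
Definition hyp_isom : set 'M[R]_n.+1 :=
  [set A | A^T *m lorentz_mx *m A = lorentz_mx /\
           forall x, hyp_space x -> hyp_space (A *m x)].

(* Unit speed, bi-infinite, globally minimizing. *)
Definition geodesic_line (c : R -> 'cV[R]_n.+1) : Prop :=
  (forall t, hyp_space (c t)) /\
  (forall s t, hyp_dist (c s) (c t) = `|s - t|).

End HyperbolicSpace.

Arguments hyp_space {R n}.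
Arguments hyp_isom {R n}.
Arguments lorentz_mx {R n}.

Section Lattices.
Context {R : realType} (n : nat).
Implicit Types (G H S : set 'M[R]_n.+1) (F K : set 'cV[R]_n.+1).

Definition is_matrix_group G : Prop :=
  [/\ G 1%:M,
      forall A B, G A -> G B -> G (A *m B) &
      forall A, G A -> A \in unitmx /\ G (invmx A)].

Definition box (ab : 'cV[R]_n.+1 * 'cV[R]_n.+1) : set 'cV[R]_n.+1 :=
  [set x | forall i, ab.1 i 0 <= x i 0 <= ab.2 i 0].

Definition box_volume (ab : 'cV[R]_n.+1 * 'cV[R]_n.+1) : R :=
  \prod_i Num.max 0 (ab.2 i 0 - ab.1 i 0).

(* Lebesgue outer measure on R^(n+1). *)
Definition lebesgue_outer F : \bar R :=
  ereal_inf [set (\sum_(0 <= k <oo) (box_volume (u k))%:E)%E |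
             u in [set u : nat -> 'cV[R]_n.+1 * 'cV[R]_n.+1 |
                   F `<=` \bigcup_k box (u k)]].

(* Lorentz matrices have determinant 1 or -1, hence preserve the Lebesgue
   measure of R^(n+1); so the Lebesgue measure of the cone over F with apex 0
   is an isometry-invariant measure of F, equal to vol(F) / (n+1) where vol is
   the Riemannian volume of H^n. *)
Definition hyp_cone F : set 'cV[R]_n.+1 :=
  [set t *: x | t in [set t : R | 0 < t <= 1] & x in F].

Definition translates G F : set 'cV[R]_n.+1 := [set A *m x | A in G & x in F].

(* Some set of finite volume meets every G-orbit of H^n.  No measurability of F
   is needed, since the outer volume of a set is that of a measurable hull. *)
Definition finite_covolume G : Prop :=
  exists F, [/\ F `<=` hyp_space, hyp_space `<=` translates G F &
                (lebesgue_outer (hyp_cone F) < +oo)%E].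

Definition is_discrete_group G : Prop :=
  \forall A \near (1%:M : 'M[R]_n.+1), G A -> A = 1%:M.

Definition hyp_lattice G : Prop :=
  [/\ is_matrix_group G, G `<=` hyp_isom, is_discrete_group G &
      finite_covolume G].

(* Compactness of H^n / G, for G acting properly discontinuously. *)
Definition cocompact G : Prop :=
  exists K, [/\ compact K, K `<=` hyp_space &
                hyp_space `<=` translates G K].

Definition finite_index H G : Prop :=
  finite_set [set [set A *m B | B in H] | A in G].

Definition commensurable G H : Prop :=
  finite_index (G `&` H) G /\ finite_index (G `&` H) H.

End Lattices.

Section Arithmetic.
Variable n : nat.

(* SO(q, Q) and SO(q, Z) for the rational quadratic form q(x) = x^T Q x. *)
Definition SO_rat (Q : 'M[rat]_n.+1) : set 'M[rat]_n.+1 :=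
  [set A | A^T *m Q *m A = Q /\ \det A = 1].

Definition SO_int (Q : 'M[rat]_n.+1) : set 'M[rat]_n.+1 :=
  SO_rat Q `&` [set A | A \is a mxOver Num.int].

Context {R : realType}.

(* P is a real change of coordinates from the standard Lorentz form to q; it
   exists iff q has signature (n, 1). *)
Definition lorentz_frame (Q : 'M[rat]_n.+1) (P : 'M[R]_n.+1) : Prop :=
  P \in unitmx /\ P^T *m map_mx ratr Q *m P = lorentz_mx.

(* The isometries of H^n given by a set S of rational matrices, through
   O(q, R) = P O(n,1) P^-1.  When n is odd, -1 has determinant 1, so
   this is the full image of SO(q, Q) (or SO(q, Z)) in PO(n,1): exactly one of
   A and -A preserves the upper sheet. *)
Definition isom_of_rat (P : 'M[R]_n.+1) (S : set 'M[rat]_n.+1) :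
    set 'M[R]_n.+1 :=
  [set A | hyp_isom A /\ exists2 B, S B & map_mx ratr B = P *m A *m invmx P].

Definition classical_arithmetic_first_type (G : set 'M[R]_n.+1) : Prop :=
  hyp_lattice G /\
  exists (Q : 'M[rat]_n.+1) (P : 'M[R]_n.+1),
    [/\ Q^T = Q, lorentz_frame Q P,
        commensurable G (isom_of_rat P (SO_int Q)) &
        G `<=` isom_of_rat P (SO_rat Q)].

End Arithmetic.

Section LengthSpectrum.
Context {R : realType} (n : nat) (G : set 'M[R]_n.+1).

(* An (oriented) closed geodesic of length l in the orbifold H^n / G: a geodesic
   line c of H^n together with the element A of G, the orbifold fundamental
   group, which closes it up by translating c by l. *)
Definition closed_geodesic (c : R -> 'cV[R]_n.+1) (A : 'M[R]_n.+1) (l : R) :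
    Prop :=
  [/\ geodesic_line c, G A, 0 < l & forall t, A *m c t = c (t + l)].

(* Not a proper iterate of another closed geodesic. *)
Definition primitive_closed_geodesic
    (c : R -> 'cV[R]_n.+1) (A : 'M[R]_n.+1) (l : R) : Prop :=
  closed_geodesic c A l /\
  ~ exists k B, [/\ (2 <= k)%N, closed_geodesic c B (l / k%:R) & A = B ^+ k].

(* Since H^n is simply connected, the free homotopy class, as a loop in the
   orbifold H^n / G, of a closed geodesic (c, A) is the conjugacy class of A
   in G. *)
Definition homotopy_class (A : 'M[R]_n.+1) : set 'M[R]_n.+1 :=
  [set D *m A *m invmx D | D in G].

Definition primitive_length_spectrum : set R :=
  [set l | exists c A, primitive_closed_geodesic c A l].

Definition primitive_classes (l : R) : set (set 'M[R]_n.+1) :=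
  [set homotopy_class A |
   A in [set A | exists c, primitive_closed_geodesic c A l]].

(* Here and below the sets involved are finite for a lattice G; the cardinal,
   resp. the sum, is 0 by convention for infinite sets. *)
Definition multiplicity (l : R) : nat := #|` fset_set (primitive_classes l)|.

Definition spectrum_upto (x : R) : set R :=
  primitive_length_spectrum `&` [set l | l <= x].

Definition geodesic_count (x : R) : R :=
  \sum_(l \in spectrum_upto x) ((multiplicity l)%:R : R).

Definition length_count (x : R) : R := \sum_(l \in spectrum_upto x) (1 : R).

Definition multiplicity_average (x : R) : R :=
  geodesic_count x / length_count x.

End LengthSpectrum.

(* Main.v *)
(* Classes of closed geodesics are conjugacy classes of hyperbolic elements A of G.
   If the axis of A passes near the base point o, then e^l is comparable with the
   entry A_nn = cosh d(o, A o).

   Many classes.  The point of height 1/K over a/K, for a in {0, ..., K-1}^(n-1),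
   lies for at least half of the a in the thick part, which is within bounded
   distance of the orbit of o by Mahler's criterion; so G has at least c K^(n-1)
   elements with A_nn <= C K.  Since H^n / G is not compact there are rational
   isotropic vectors, hence unipotents in G, and second differences of unipotents
   give a finite S in G such that |tr (A h)| >= c A_nn for some h in S: after
   multiplication by S a positive proportion of these elements is hyperbolic with
   axis near o.  A conjugacy class contains O(T) of them, and the proper powers
   are negligible, which leaves at least c e^((n-1)T) / T primitive classes.

   Few lengths.  The length is determined by the characteristic polynomial f of A,
   a reciprocal polynomial of even degree n + 1 whose coefficients are O(e^T) with
   bounded denominators.  It is determined by its coefficients of degree
   1, ..., (n-3)/2 and by f(1), f(-1); moreover det Q f(1) f(-1) is a rational
   square, being the determinant of the skew-symmetric matrix Q A - A^T Q, which
   leaves only O(T e^T) pairs (f(1), f(-1)).  So there are O(T e^((n-1)T/2))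
   lengths. *)
Require Import Defs.
From mathcomp Require Import all_boot all_order all_algebra finmap.
From mathcomp Require Import fingroup perm complex.
From mathcomp Require Import all_classical all_reals all_analysis.
From mathcomp Require Import ring lra zify.
Import Order.TTheory GRing.Theory Num.Theory.
Import numFieldNormedType.Exports.
Set Implicit Arguments.
Unset Strict Implicit.
Unset Printing Implicit Defensive.
Local Open Scope classical_set_scope.
Local Open Scope ring_scope.

(** * Cardinality bounds *)

Section AtMost.

(** One mechanism recurs. On the lattice the form has values in (1/N) Z, so lattice vectors that are
    short for the positive form attached to a point are isotropic and mutually orthogonal, hence
    proportional. This makes the axes of closed geodesics of bounded length thick, separates the
    horoballs that cover the thin part, and turns the absence of isotropic vectors into compactness.
    The trace ties an element to its axis: e^l differs from tr A by a bounded amount, while A_nn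
    measures how far o is moved. A bound |tr A| >= c A_nn therefore says that o is moved hardly
    farther than the points of the axis, so the axis is near o. Oddness of n acts through the even
    size n + 1: -1 has determinant 1, so an integral isometry can be corrected by a sign to preserve
    the upper sheet, and a reciprocal polynomial has a middle coefficient. The lower bound for
    lattice points is stated for every m that bounds the ball, so that all counting reduces to
    injections and finite-to-one maps. *)

Definition at_most {T : Type} (A : set T) (m : nat) :=
  exists f : T -> nat, (forall x, A x -> (f x < m)%N) /\
                       (forall x y, A x -> A y -> f x = f y -> x = y).

Lemma at_most_sub {T} (A B : set T) m : A `<=` B -> at_most B m -> at_most A m.
Proof.
by move=> AB [f [f1 f2]]; exists f; split=> [x /AB/f1//|x y /AB ? /AB ?]; exact: f2.
Qed.

Lemma at_most_le {T} (A : set T) m m' : (m <= m')%N -> at_most A m -> at_most A m'.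
Proof. by move=> mm [f [f1 f2]]; exists f; split=> // x /f1 h; exact: leq_trans h mm. Qed.

Lemma at_most_inj {T U} (f : T -> U) (A : set T) (B : set U) m :
  (forall x, A x -> B (f x)) -> (forall x y, A x -> A y -> f x = f y -> x = y) ->
  at_most B m -> at_most A m.
Proof.
move=> AB fi [g [g1 g2]]; exists (g \o f); split=> [x /AB/g1//|x y Ax Ay /= e].
by apply: fi => //; apply: g2 => //; exact: AB.
Qed.

(** Number the base by g and each fibre by k < m; both are read off g * m + k as quotient and
    remainder. Most counts below apply this to a finite-to-one map. *)
Lemma at_most_fibers {T U} (f : T -> U) (A : set T) (B : set U) m b :
  (forall x, A x -> B (f x)) -> at_most B b ->
  (forall u, B u -> at_most [set x | A x /\ f x = u] m) ->
  at_most A (b * m).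
Proof.
move=> AB [g [g1 g2]] h.
have /choice[k hk] : forall u, exists k : T -> nat, B u ->
    (forall x, A x -> f x = u -> (k x < m)%N) /\
    (forall x y, A x -> A y -> f x = u -> f y = u -> k x = k y -> x = y).
  move=> u; have [Bu|nBu] := pselect (B u); last by exists (fun=> 0%N).
  have [k [k1 k2]] := h u Bu; exists k => _; split=> [x Ax fx|x y Ax Ay fx fy]; first exact: k1.
  exact: k2.
exists (fun x => g (f x) * m + k (f x) x)%N; split=> [x Ax|x y Ax Ay].
  have := (hk _ (AB _ Ax)).1 x Ax erefl; have := g1 _ (AB _ Ax); nia.
have kx := (hk _ (AB _ Ax)).1 x Ax erefl; have ky := (hk _ (AB _ Ay)).1 y Ay erefl.
move=> e; have eg : g (f x) = g (f y).
  by move: (congr1 (divn^~ m) e); rewrite !divnMDl ?divn_small ?addn0 //; exact: leq_ltn_trans kx.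
have ef : f x = f y by apply: g2 => //; exact: AB.
move: e; rewrite eg => /addnI; rewrite ef.
by apply: (hk _ (AB _ Ay)).2.
Qed.

Lemma at_most_image {T U} (f : T -> U) (A : set T) m : at_most A m -> at_most (f @` A) m.
Proof.
move=> [k [k1 k2]].
have /choice[g hg] : forall u, exists i, (f @` A) u -> exists t, [/\ A t, f t = u & k t = i].
  move=> u; have [[t At e]|nu] := pselect ((f @` A) u); last by exists 0%N.
  by exists (k t) => _; exists t.
exists g; split=> [u fu|u v fu fv e].
  by have [t [At _ <-]] := hg u fu; exact: k1.
have [t [At eu et]] := hg u fu; have [t' [At' ev et']] := hg v fv.
by rewrite -eu -ev; congr (f _); apply: k2 => //; rewrite et et'.
Qed.

Lemma at_most_finType (I : finType) (A : set I) : at_most A #|I|.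
Proof.
exists (fun i => enum_rank i : nat); split=> [x _|x y _ _ /val_inj/enum_rank_inj//].
exact: ltn_ord.
Qed.

Lemma at_most_pred (I : finType) (A : {pred I}) m : at_most [set x | x \in A] m -> (#|A| <= m)%N.
Proof.
move=> [f [f1 f2]]; rewrite -[m]card_ord.
have g x : x \in A -> 'I_m by move=> h; exact: Ordinal (f1 _ h).
pose s := [seq f x | x <- enum A].
have us : uniq s.
  rewrite map_inj_in_uniq ?enum_uniq // => x y; rewrite !mem_enum => hx hy; exact: f2.
rewrite card_ord cardE -(size_map f) -/s -(size_iota 0 m).
apply: uniq_leq_size => // k /mapP[x]; rewrite mem_enum => /f1 h ->.
by rewrite mem_iota /= add0n.
Qed.

Lemma at_mostU {T} (A B : set T) a b : at_most A a -> at_most B b -> at_most (A `|` B) (a + b).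
Proof.
move=> [f [f1 f2]] [g [g1 g2]].
exists (fun x => if pselect (A x) is left _ then f x else (a + g x)%N); split=> [x|x y].
  by case: pselect => [/= /f1 h _|h [//|/g1]]; [lia|lia].
case: pselect => [/= Ax|nAx]; case: pselect => [/= Ay|nAy]; move=> hx hy.
- exact: f2.
- by move: (f1 _ Ax) => ? e; lia.
- by move: (f1 _ Ay) => ? e; lia.
- by move/addnI; apply: g2; [case: hx|case: hy].
Qed.

Lemma at_most0 {T} : at_most (set0 : set T) 0.
Proof. by exists (fun=> 0%N); split. Qed.

Lemma at_most1 {T} (x : T) : at_most [set x] 1.
Proof. by exists (fun=> 0%N); split=> // y z -> ->. Qed.

Lemma at_most_finite {T : choiceType} (A : set T) m :
  at_most A m -> finite_set A /\ (#|` fset_set A| <= m)%N.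
Proof.
move=> [f [f1 f2]].
have h : (A #<= `I_m)%card.
  have /card_eqPle[_ le] : (f @` A #= A)%card by apply: inj_card_eq => x y /set_mem Ax /set_mem Ay; exact: f2.
  apply: card_le_trans le _; apply: subset_card_le => _ [x Ax <-]; exact: f1.
split; last exact: geq_card_fset_set.
by apply/finite_set_leP; exists m.
Qed.

Lemma finite_at_most {T : choiceType} (A : set T) :
  finite_set A -> at_most A #|` fset_set A|.
Proof.
move=> fA; have mem x : A x -> x \in enum_fset (fset_set A).
  by move=> Ax; rewrite in_fset_set // inE.
exists (index^~ (enum_fset (fset_set A))); split=> [x Ax|x y Ax Ay e].
  by rewrite index_mem mem.
by rewrite -(nth_index x (mem _ Ax)) e nth_index // mem.
Qed.

Lemma at_most_bigcup {T} {U : choiceType} (s : seq U) (F : U -> set T) (m : U -> nat) :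
  (forall u, u \in s -> at_most (F u) (m u)) ->
  at_most [set x | exists2 u, u \in s & F u x] (\sum_(u <- s) m u).
Proof.
elim: s => [|v s IH] h.
  rewrite big_nil; apply: at_most_sub at_most0 => x [u]; by rewrite in_nil.
rewrite big_cons; apply: at_most_sub; last apply: at_mostU (h v (mem_head _ _)) (IH _).
  move=> x [u]; rewrite inE => /orP [/eqP ->|us] Fx; [by left|right; by exists u].
by move=> u us; apply: h; rewrite inE us orbT.
Qed.

Lemma at_most_seq {T : eqType} (s : seq T) : at_most [set x | x \in s] (size s).
Proof.
exists (index^~ s); split=> [x|x y xs ys e]; first by rewrite /= -index_mem.
by rewrite -(nth_index x xs) e nth_index.
Qed.

End AtMost.

Section Bounds.
Context {R : realType}.

Lemma at_most_bounded {T} (A : set T) m (f : T -> R) : at_most A m ->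
  exists C, 0 < C /\ forall x, A x -> f x <= C.
Proof.
elim: m A => [|m IH] A; first by case=> g [g1 _]; exists 1; split=> // x /g1.
move=> [g [g1 g2]].
have [C [C0 hC]] := IH [set x | A x /\ (g x < m)%N] (ex_intro _ g (conj (fun x h => proj2 h) (fun x y hx hy => g2 x y (proj1 hx) (proj1 hy)))).
have [[x0 [Ax0 gx0]]|nex] := pselect (exists x, A x /\ g x = m).
  exists (Num.max C (f x0)); split; first by rewrite lt_max C0.
  move=> x Ax; rewrite le_max; have := g1 _ Ax; rewrite ltnS leq_eqVlt => /orP [/eqP e|lt].
    by rewrite (g2 x x0) ?lexx ?orbT // gx0.
  by rewrite hC.
exists C; split=> // x Ax; apply: hC; split=> //; have := g1 _ Ax.
by rewrite ltnS leq_eqVlt => /orP [/eqP e|//]; case: nex; exists x.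
Qed.

Lemma at_most_int_fun (I : finType) (N : nat) :
  at_most [set f : I -> R | forall i, f i \is a Num.int /\ `|f i| <= N%:R] ((N.*2.+1) ^ #|I|).
Proof.
pose T := {ffun I -> 'I_(N.*2.+1)}.
have -> : (N.*2.+1 ^ #|I| = #|T|)%N by rewrite card_ffun card_ord.
pose g (f : I -> R) : T := [ffun i => inord (Num.truncn (f i + N%:R))].
apply: (@at_most_inj _ _ g _ [set: T]) => //; last exact: at_most_finType.
move=> x y hx hy /ffunP e; apply/funext => i.
have [ix nx] := hx i; have [iy ny] := hy i.
move: nx ny; rewrite !ler_norml => /andP [x1 x2] /andP [y1 y2].
have nx : x i + N%:R \is a Num.nat by rewrite natrEint rpredD ?natr_int //; lra.
have ny : y i + N%:R \is a Num.nat by rewrite natrEint rpredD ?natr_int //; lra.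
have bx : (Num.truncn (x i + N%:R) < N.*2.+1)%N.
  rewrite ltnS -(@ler_nat R) truncnK // -addnn natrD; lra.
have by_ : (Num.truncn (y i + N%:R) < N.*2.+1)%N.
  rewrite ltnS -(@ler_nat R) truncnK // -addnn natrD; lra.
have := e i; rewrite !ffunE => /(congr1 val) /=; rewrite !inordK // => /(congr1 (fun k => k%:R : R)).
by rewrite !truncnK // => /addIr.
Qed.

Lemma at_most_int_mx (a b : nat) (N : nat) :
  at_most [set M : 'M[R]_(a, b) | M \is a mxOver Num.int /\ forall i j, `|M i j| <= N%:R]
     ((N.*2.+1) ^ (a * b)).
Proof.
have := @at_most_int_fun ('I_a * 'I_b)%type N; rewrite card_prod !card_ord.
apply: (@at_most_inj _ _ (fun (M : 'M[R]_(a, b)) (p : 'I_a * 'I_b) => M p.1 p.2)).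
  by move=> M [/mxOverP M1 M2] [i j] /=.
by move=> M M' _ _ e; apply/matrixP => i j; exact: (congr1 (fun f => f (i, j)) e).
Qed.

End Bounds.

(** * Lorentzian geometry *)

Section CauchySchwarz.
Context {R : realFieldType}.

Lemma sum_CauchySchwarz (I : finType) (a b : I -> R) :
  (\sum_i a i * b i) ^+ 2 <= (\sum_i a i ^+ 2) * (\sum_i b i ^+ 2).
Proof.
set S := \sum_i a i ^+ 2; set T := \sum_i b i ^+ 2; set U := \sum_i a i * b i.
have S0 : 0 <= S by apply: sumr_ge0 => i _; exact: sqr_ge0.
have [Seq0|Sneq0] := eqVneq S 0.
  have a0 i : a i = 0.
    apply/eqP; rewrite -sqrf_eq0.
    move/eqP: Seq0; rewrite /S psumr_eq0; last by move=> j _; exact: sqr_ge0.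
    by move/allP => /(_ i); rewrite mem_index_enum => /(_ isT).
  rewrite Seq0 mul0r /U big1 ?expr0n //= => i _; by rewrite a0 mul0r.
have Spos : 0 < S by rewrite lt_def Sneq0.
have : 0 <= \sum_i (S * b i - U * a i) ^+ 2.
  by apply: sumr_ge0 => i _; exact: sqr_ge0.
have -> : \sum_i (S * b i - U * a i) ^+ 2 = S * (S * T - U ^+ 2).
  transitivity (\sum_i (S ^+ 2 * b i ^+ 2 - 2 * S * U * (a i * b i) + U ^+ 2 * a i ^+ 2)).
    by apply: eq_bigr => i _; ring.
  rewrite big_split /= sumrB -!mulr_sumr -/S -/T -/U; ring.
by rewrite pmulr_rge0 // subr_ge0.
Qed.

End CauchySchwarz.

Notation "''ht' x" := (x ord_max 0) (at level 9, x at level 2, format "''ht'  x").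

Section Lorentz.
Context {R : realType} {n : nat}.
Implicit Types (x y z : 'cV[R]_n.+1) (A B : 'M[R]_n.+1).
Local Notation J := (@lorentz_mx R n).

Definition sdot x y : R :=
  \sum_(i < n) x (widen_ord (leqnSn n) i) 0 * y (widen_ord (leqnSn n) i) 0.

Lemma lorentz_mxE : J = diag_mx (\row_i (if i == ord_max then -1 else 1)).
Proof. by []. Qed.

Lemma mul_lorentz_mx x i : (J *m x) i 0 = (if i == ord_max then -1 else 1) * x i 0.
Proof. by rewrite lorentz_mxE mul_diag_mx !mxE. Qed.

Lemma lorentzE x y : lorentz x y = sdot x y - 'ht x * 'ht y.
Proof.
rewrite /lorentz -mulmxA mxE big_ord_recr /=; congr (_ + _).
  rewrite /sdot; apply: eq_bigr => i _.
  rewrite mul_lorentz_mx mxE -val_eqE /= ltn_eqF ?mul1r //.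

by rewrite mul_lorentz_mx eqxx mxE mulN1r mulrN.
Qed.

Lemma sdotC x y : sdot x y = sdot y x.
Proof. by apply: eq_bigr => i _; rewrite mulrC. Qed.

Lemma sdot_ge0 x : 0 <= sdot x x.
Proof. by apply: sumr_ge0 => i _; rewrite -expr2 sqr_ge0. Qed.

Lemma sdot_CS x y : sdot x y ^+ 2 <= sdot x x * sdot y y.
Proof.
have := @sum_CauchySchwarz R 'I_n (fun i => x (widen_ord (leqnSn n) i) 0)
  (fun i => y (widen_ord (leqnSn n) i) 0).
by rewrite /sdot; under [X in _ -> _ <= X * _]eq_bigr do rewrite -expr2;
  under [X in _ -> _ <= _ * X]eq_bigr do rewrite -expr2.
Qed.

Lemma sdot_eq0 x : sdot x x = 0 -> 'ht x = 0 -> x = 0.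
Proof.
move=> s0 h0; apply/matrixP => i j; rewrite ord1 mxE.
have [lt|ge] := ltnP i n; last first.
  by rewrite (_ : i = ord_max) //; apply/val_inj => /=; apply/eqP; rewrite eqn_leq ge -ltnS ltn_ord.
move/eqP: s0; rewrite psumr_eq0; last by move=> k _; rewrite -expr2 sqr_ge0.
move/allP => /(_ (Ordinal lt)); rewrite mem_index_enum => /(_ isT) /=.
rewrite -expr2 expf_eq0 /= => /eqP; rewrite (_ : widen_ord _ _ = i) //; exact/val_inj.
Qed.

Lemma lorentzDl x y z : lorentz (x + y) z = lorentz x z + lorentz y z.
Proof. by rewrite /lorentz linearD /= !mulmxDl mxE. Qed.
Lemma lorentzDr x y z : lorentz z (x + y) = lorentz z x + lorentz z y.
Proof. by rewrite /lorentz !mulmxDr mxE. Qed.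
Lemma lorentzZl a x z : lorentz (a *: x) z = a * lorentz x z.
Proof. by rewrite /lorentz linearZ /= -!scalemxAl mxE. Qed.
Lemma lorentzZr a x z : lorentz z (a *: x) = a * lorentz z x.
Proof. by rewrite /lorentz -!scalemxAr mxE. Qed.
Lemma lorentzNl x z : lorentz (- x) z = - lorentz x z.
Proof. by rewrite -scaleN1r lorentzZl mulN1r. Qed.
Lemma lorentzNr x z : lorentz z (- x) = - lorentz z x.
Proof. by rewrite -scaleN1r lorentzZr mulN1r. Qed.
Lemma lorentz0l z : lorentz 0 z = 0.
Proof. by rewrite -(scale0r 0) lorentzZl mul0r. Qed.
Lemma lorentz0r z : lorentz z 0 = 0.
Proof. by rewrite -(scale0r 0) lorentzZr mul0r. Qed.
Lemma lorentzC x y : lorentz x y = lorentz y x.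
Proof. by rewrite !lorentzE sdotC (mulrC ('ht x)). Qed.

Definition lorentz_lin :=
  (lorentzDl, lorentzDr, lorentzZl, lorentzZr, lorentzNl, lorentzNr).

Lemma lorentz_suml (I : finType) (F : I -> 'cV[R]_n.+1) z :
  lorentz (\sum_i F i) z = \sum_i lorentz (F i) z.
Proof.
elim/big_ind2 : _ => [|x a y b <- <-|//]; [exact: lorentz0l|exact: lorentzDl].
Qed.

Definition origin : 'cV[R]_n.+1 := delta_mx ord_max 0.
Local Notation o := origin.

Lemma sdot_originl x : sdot o x = 0.
Proof.
apply: big1 => i _; rewrite mxE -val_eqE /= ltn_eqF ?mul0r //; exact: (ltn_ord i).
Qed.

Lemma ht_origin : 'ht o = 1.
Proof. by rewrite mxE !eqxx. Qed.

Lemma lorentz_origin x : lorentz o x = - 'ht x.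
Proof. by rewrite lorentzE sdot_originl ht_origin sub0r mul1r. Qed.

Lemma origin_hyp : hyp_space o.
Proof. by split; rewrite ?lorentz_origin ht_origin. Qed.

Lemma hyp_sdot x : hyp_space x -> sdot x x = 'ht x ^+ 2 - 1.
Proof. by case=> + _; rewrite lorentzE => e; lra. Qed.

Lemma hyp_ht_ge1 x : hyp_space x -> 1 <= 'ht x.
Proof.
move=> hx; have := sdot_ge0 x; rewrite hyp_sdot // subr_ge0.
by rewrite -[X in X <= _](expr1n _ 2) ler_sqr ?nnegrE // ltW; case: hx.
Qed.

Lemma causal_lt x y : hyp_space x -> lorentz y y <= 0 -> 0 < 'ht y ->
  lorentz x y < 0.
Proof.
move=> hx; rewrite !lorentzE => cy hy; rewrite subr_lt0.
apply: le_lt_trans (ler_norm _) _.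
have x0 : 0 < 'ht x by case: hx.
suff : `|sdot x y| ^+ 2 < ('ht x * 'ht y) ^+ 2.
  by rewrite ltr_pXn2r // nnegrE // mulr_ge0 // ltW.
rewrite real_normK ?num_real //.
apply: le_lt_trans (sdot_CS x y) _; rewrite hyp_sdot // exprMn.
have y2 : 0 < 'ht y ^+ 2 by rewrite exprn_gt0.
have : sdot y y <= 'ht y ^+ 2 by rewrite expr2; lra.
have := sdot_ge0 y; have : 0 <= 'ht x ^+ 2 - 1 by rewrite -hyp_sdot // sdot_ge0.
nra.
Qed.

Lemma hyp_lorentz_lt0 x y : hyp_space x -> hyp_space y -> lorentz x y < 0.
Proof. by move=> hx [y1 y2]; apply: causal_lt => //; rewrite y1 lerN10. Qed.

(** In signature (n, 1) a totally isotropic space has dimension at most 1: the combination z has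
    height 0, where the form is positive definite, and <z, z> = 0. *)
Lemma isotropic_orth x y : lorentz x x = 0 -> lorentz y y = 0 -> lorentz x y = 0 ->
  'ht y *: x = 'ht x *: y.
Proof.
move=> xx yy xy; apply/eqP; rewrite -subr_eq0; apply/eqP.
set z := _ - _; have hz : 'ht z = 0 by rewrite !mxE; ring.
have : lorentz z z = 0 by rewrite !lorentz_lin (lorentzC y x) xx yy xy; ring.
by rewrite lorentzE hz mulr0 subr0 => s0; exact: sdot_eq0.
Qed.

Lemma isotropic_ht0 x : lorentz x x = 0 -> 'ht x = 0 -> x = 0.
Proof. by move=> + h0; rewrite lorentzE h0 mulr0 subr0 => /sdot_eq0; apply. Qed.

Definition Lor A := A^T *m J *m A = J.

Lemma lorentz_mx_sq : J *m J = 1%:M.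
Proof.
rewrite lorentz_mxE mulmx_diag; apply/matrixP => i j; rewrite !mxE.
by case: ifP; rewrite ?mulrNN mulr1.
Qed.

Lemma lorentz_mx_tr : J^T = J.
Proof. by rewrite lorentz_mxE tr_diag_mx. Qed.

Lemma Lor_mulV A : Lor A -> (J *m A^T *m J) *m A = 1%:M.
Proof. by move=> h; rewrite -!mulmxA (mulmxA A^T) h lorentz_mx_sq. Qed.

Lemma Lor_unit A : Lor A -> A \in unitmx.
Proof. by move/Lor_mulV/mulmx1_unit => []. Qed.

Lemma Lor_inv A : Lor A -> invmx A = J *m A^T *m J.
Proof.
move=> h; rewrite -[RHS]mulmx1 -(mulmxV (Lor_unit h)) mulmxA Lor_mulV //.
by rewrite mul1mx.
Qed.

Lemma Lor_lorentz A x y : Lor A -> lorentz (A *m x) (A *m y) = lorentz x y.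
Proof. by move=> h; rewrite /lorentz trmx_mul !mulmxA -(mulmxA _ A^T) -(mulmxA _ (A^T *m _)) h. Qed.

Lemma Lor_tr A : Lor A -> Lor A^T.
Proof.
move=> h; have := mulmx1C (Lor_mulV h); rewrite /Lor trmxK => e.
have : A *m (J *m A^T *m J) *m J = J by rewrite e mul1mx.
by rewrite -!mulmxA lorentz_mx_sq mulmx1 mulmxA.
Qed.

Lemma Lor_mul A B : Lor A -> Lor B -> Lor (A *m B).
Proof.
move=> hA hB; rewrite /Lor trmx_mul !mulmxA -(mulmxA _ A^T) -(mulmxA _ (A^T *m _)) hA.
exact: hB.
Qed.

Lemma Lor1 : Lor 1%:M.
Proof. by rewrite /Lor trmx1 mul1mx mulmx1. Qed.

Lemma LorN A : Lor A -> Lor (- A).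
Proof. by rewrite /Lor [(- A)^T]linearN /= !mulNmx mulmxN opprK. Qed.

Lemma Lor_invP A : Lor A -> Lor (invmx A).
Proof.
move=> h; rewrite Lor_inv //; apply: Lor_mul; first apply: Lor_mul; try exact: Lor_tr.
all: by rewrite /Lor lorentz_mx_tr lorentz_mx_sq mul1mx.
Qed.

Lemma Lor_adj A x y : Lor A -> lorentz (A *m x) y = lorentz x (invmx A *m y).
Proof.
by move=> h; rewrite -[y in LHS](mulKVmx (Lor_unit h)) Lor_lorentz.
Qed.

Lemma mulmx_origin A : A *m o = col ord_max A.
Proof. by rewrite colE. Qed.

Lemma ht_mul_origin A : 'ht (A *m o) = A ord_max ord_max.
Proof. by rewrite mulmx_origin mxE. Qed.

Lemma Lor_hyp_isom A : Lor A -> 0 < A ord_max ord_max -> hyp_isom A.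
Proof.
move=> h A0; split=> // x [x1 x2]; split; first by rewrite Lor_lorentz.
have ho : hyp_space (invmx A *m o).
  split; first by rewrite (Lor_lorentz _ _ (Lor_invP h)) (proj1 origin_hyp).
  rewrite Lor_inv // -!mulmxA.
  have -> : J *m o = - o.
    apply/matrixP => i j; rewrite ord1 mul_lorentz_mx !mxE; case: eqP => //=; by rewrite ?mulr0 ?oppr0 ?mulr1.
  by rewrite !mulmxN mxE mul_lorentz_mx eqxx ht_mul_origin mxE mulN1r opprK.
rewrite -oppr_lt0 -lorentz_origin lorentzC Lor_adj // lorentzC.
by apply: hyp_lorentz_lt0.
Qed.

Lemma hyp_isom_Lor A : hyp_isom A -> Lor A. Proof. by case. Qed.

Lemma hyp_isomP A : hyp_isom A <-> Lor A /\ 0 < A ord_max ord_max.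
Proof.
split=> [[h1 h2]|[]]; last exact: Lor_hyp_isom.
split=> //; rewrite -ht_mul_origin; exact: (proj2 (h2 _ origin_hyp)).
Qed.

Lemma hyp_isom_nn A : hyp_isom A -> 1 <= A ord_max ord_max.
Proof. by case=> _ h; rewrite -ht_mul_origin; apply/hyp_ht_ge1/h/origin_hyp. Qed.

Lemma Lor_sign A : Lor A -> hyp_isom A \/ hyp_isom (- A).
Proof.
move=> h; have h1 : lorentz (A *m o) (A *m o) = -1.
  by rewrite Lor_lorentz // (proj1 origin_hyp).
have : A ord_max ord_max != 0.
  apply/eqP => h0; move: h1; rewrite lorentzE ht_mul_origin h0 mulr0 subr0.
  by have := sdot_ge0 (A *m o); lra.
rewrite neq_lt => /orP [l0|g0]; [right|left]; apply: Lor_hyp_isom => //.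
  exact: LorN.
by rewrite mxE oppr_gt0.
Qed.

Lemma hyp_isom_mul A B : hyp_isom A -> hyp_isom B -> hyp_isom (A *m B).
Proof.
case=> a1 a2 [b1 b2]; split; first exact: Lor_mul.
by move=> x hx; rewrite -mulmxA; apply/a2/b2.
Qed.

Lemma hyp_isom1 : hyp_isom (1%:M : 'M[R]_n.+1).
Proof. by split; [exact: Lor1|move=> x; rewrite mul1mx]. Qed.

Lemma hyp_isom_inv A : hyp_isom A -> hyp_isom (invmx A).
Proof.
move=> /hyp_isomP [h h0]; apply/hyp_isomP; split; first exact: Lor_invP.
rewrite Lor_inv // -ht_mul_origin -!mulmxA mul_lorentz_mx eqxx mulN1r.
have -> : J *m o = - o.
  apply/matrixP => i j; rewrite ord1 mul_lorentz_mx !mxE; case: eqP => //=; by rewrite ?mulr0 ?oppr0 ?mulr1.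
by rewrite !mulmxN mxE ht_mul_origin mxE opprK.
Qed.

Lemma hyp_isom_unit A : hyp_isom A -> A \in unitmx.
Proof. by move/hyp_isom_Lor/Lor_unit. Qed.

Lemma hyp_isom_causal A x : hyp_isom A -> lorentz x x <= 0 -> 0 < 'ht x -> 0 < 'ht (A *m x).
Proof.
move=> h c x0; rewrite -oppr_lt0 -lorentz_origin lorentzC Lor_adj; last exact: hyp_isom_Lor.
rewrite lorentzC; apply: causal_lt => //.
exact: (proj2 (hyp_isom_inv h) _ origin_hyp).
Qed.

Definition reflection (r : 'cV[R]_n.+1) : 'M[R]_n.+1 :=
  1%:M - (2 / lorentz r r) *: (r *m (r^T *m J)).

Lemma reflectionE r x : reflection r *m x = x - (2 * lorentz r x / lorentz r r) *: r.
Proof.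
rewrite /reflection mulmxBl mul1mx -scalemxAl -mulmxA.
rewrite [r^T *m J *m x]mx11_scalar -/(lorentz r x) mul_mx_scalar scalerA.
by congr (_ - _ *: _); ring.
Qed.

Lemma mulmx_inj_col (A B : 'M[R]_n.+1) : (forall x : 'cV[R]_n.+1, A *m x = B *m x) -> A = B.
Proof.
move=> h; apply/matrixP => i j; have := h (delta_mx j 0).
by rewrite -!colE => /matrixP /(_ i 0); rewrite !mxE.
Qed.

Lemma LorP A : (forall x y, lorentz (A *m x) (A *m y) = lorentz x y) -> Lor A.
Proof.
move=> h; apply/matrixP => i j; have := h (delta_mx i 0) (delta_mx j 0).
by rewrite /lorentz trmx_mul !mulmxA -(mulmxA _ A^T) -(mulmxA _ (A^T *m _)) !trmx_delta -!rowE -!colE !mxE.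
Qed.

Lemma reflection_Lor r : lorentz r r != 0 -> Lor (reflection r).
Proof.
move=> r0; apply: LorP => x y; rewrite !reflectionE !lorentz_lin (lorentzC x r).
by field.
Qed.

Lemma reflection_sq r : lorentz r r != 0 -> reflection r *m reflection r = 1%:M.
Proof.
move=> r0; apply: mulmx_inj_col => x; rewrite -mulmxA mul1mx !reflectionE !lorentz_lin.
rewrite -addrA -opprD -scalerDl.
rewrite [X in X *: r](_ : _ = 0) ?scale0r ?subr0 //; by field.
Qed.

Lemma reflection_swap x y : lorentz x x = lorentz y y -> lorentz (x - y) (x - y) != 0 ->
  reflection (x - y) *m y = x.
Proof.
move=> e r0; rewrite reflectionE.
have -> : 2 * lorentz (x - y) y / lorentz (x - y) (x - y) = -1.
  apply: (mulIf r0); rewrite mulfVK // !lorentz_lin (lorentzC y x) e; ring.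
by rewrite scaleN1r opprK subrKC.
Qed.

(** Reversed Cauchy-Schwarz. The vector z has height 0, so <z, z> >= 0, which reads -2 <x, y> >= a /
    b + b / a for the heights a and b of x and y. The right side is at least 2, and equality
    throughout forces x = y. *)
Lemma hyp_sub_gt0 x y : hyp_space x -> hyp_space y -> x != y -> 0 < lorentz (x - y) (x - y).
Proof.
move=> hx hy xy; have := hx; have := hy; case=> yy _ [xx _].
rewrite !lorentz_lin xx yy (lorentzC y x).
have x1 := hyp_ht_ge1 hx; have y1 := hyp_ht_ge1 hy.
set z := 'ht y *: x - 'ht x *: y.
have hz : 'ht z = 0 by rewrite !mxE; ring.
have : 0 <= lorentz z z by rewrite lorentzE hz mulr0 subr0 sdot_ge0.
have zz : lorentz z z = - 'ht y ^+ 2 - 'ht x ^+ 2 - 2 * 'ht x * 'ht y * lorentz x y.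
  by rewrite !lorentz_lin xx yy (lorentzC y x); ring.
rewrite zz => le0.
have [e|ne] := eqVneq ('ht x) ('ht y).
  have : lorentz z z != 0.
    apply: contra xy => /eqP; rewrite lorentzE hz mulr0 subr0 => /sdot_eq0 /(_ hz).
    rewrite /z e -scalerBr => /eqP; rewrite scaler_eq0 subr_eq0 => /orP [/eqP e0|//].
    by move: y1; rewrite e0 ler10.
  rewrite zz => ne0; have : 0 < - 'ht y ^+ 2 - 'ht x ^+ 2 - 2 * 'ht x * 'ht y * lorentz x y.
    by rewrite lt_def ne0.
  rewrite e => h; have : 0 < 'ht y ^+ 2 * (- 2 - 2 * lorentz x y) by lra.
  by rewrite pmulr_rgt0 ?exprn_gt0 //; [lra|lra].
have : 0 < ('ht x - 'ht y) ^+ 2 by rewrite exprn_even_gt0 //= subr_eq0.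
move=> h; have : 0 < 'ht x * 'ht y * (- 2 - 2 * lorentz x y) by lra.
rewrite pmulr_rgt0; first by lra.
by rewrite mulr_gt0 //; lra.
Qed.

Lemma hyp_lorentz_le x y : hyp_space x -> hyp_space y -> lorentz x y <= -1.
Proof.
move=> hx hy; have [<-|ne] := eqVneq x y; first by case: hx => ->.
have := hyp_sub_gt0 hx hy ne; case: hx => xx _; case: hy => yy _.
rewrite !lorentz_lin xx yy (lorentzC y x); lra.
Qed.

(** The involution exchanging [origin] and x, namely the reflection in their perpendicular bisector.
    It carries statements at x to the origin, where coordinates are available. For x = o the vector
    x - o is 0, whence the separate case. *)
Definition Tx (x : 'cV[R]_n.+1) : 'M[R]_n.+1 :=
  if x == o then 1%:M else reflection (x - o).

Lemma Tx_Lor x : hyp_space x -> Lor (Tx x).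
Proof.
move=> hx; rewrite /Tx; case: eqP => [_|/eqP ne]; first exact: Lor1.
by apply: reflection_Lor; rewrite gt_eqF // hyp_sub_gt0 //; exact: origin_hyp.
Qed.

Lemma Tx_sq x : hyp_space x -> Tx x *m Tx x = 1%:M.
Proof.
move=> hx; rewrite /Tx; case: eqP => [_|/eqP ne]; first exact: mulmx1.
by apply: reflection_sq; rewrite gt_eqF // hyp_sub_gt0 //; exact: origin_hyp.
Qed.

Lemma Tx_origin x : hyp_space x -> Tx x *m o = x.
Proof.
move=> hx; rewrite /Tx; case: eqP => [->|/eqP ne]; first exact: mul1mx.
apply: reflection_swap; first by rewrite (proj1 hx) (proj1 origin_hyp).
by rewrite gt_eqF // hyp_sub_gt0 //; exact: origin_hyp.
Qed.

Lemma Tx_self x : hyp_space x -> Tx x *m x = o.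
Proof. by move=> hx; rewrite -{2}(Tx_origin hx) mulmxA Tx_sq // mul1mx. Qed.

Lemma Tx_isom x : hyp_space x -> hyp_isom (Tx x).
Proof.
move=> hx; apply: Lor_hyp_isom; first exact: Tx_Lor.
by rewrite -ht_mul_origin Tx_origin //; case: hx.
Qed.

(* cosh (s + t) <= 2 cosh s cosh t *)
Lemma hyp_triangle x y z : hyp_space x -> hyp_space y -> hyp_space z ->
  - lorentz x z <= 2 * lorentz x y * lorentz y z.
Proof.
move=> hx hy hz; have T := Tx_Lor hy.
rewrite -(Lor_lorentz x z T) -(Lor_lorentz x y T) -(Lor_lorentz y z T) Tx_self //.
have [_ h] := Tx_isom hy.
move: {hx}(h _ hx) {hz}(h _ hz); move: (Tx y *m x) (Tx y *m z) => {}x {}z hx hz.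
rewrite lorentz_origin (lorentzC x o) lorentz_origin lorentzE.
have x1 := hyp_ht_ge1 hx; have z1 := hyp_ht_ge1 hz.
suff : `|sdot x z| <= 'ht x * 'ht z by rewrite ler_norml => /andP [+ _]; lra.
suff : `|sdot x z| ^+ 2 <= ('ht x * 'ht z) ^+ 2.
  by rewrite ler_pXn2r // nnegrE // mulr_ge0 //; lra.
rewrite real_normK ?num_real //.
apply: le_trans (sdot_CS _ _) _; rewrite exprMn !hyp_sdot //.
apply: ler_pM; rewrite ?subr_ge0 ?exprn_ege1 //; lra.
Qed.

Definition nrm2 x : R := \sum_i x i 0 ^+ 2.

Lemma nrm2E x : nrm2 x = lorentz x x + 2 * 'ht x ^+ 2.
Proof.
rewrite /nrm2 big_ord_recr /= lorentzE /sdot.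
under [X in _ = X - _ + _]eq_bigr do rewrite -expr2.
ring.
Qed.

Lemma nrm2_ge0 x : 0 <= nrm2 x.
Proof. by apply: sumr_ge0 => i _; rewrite sqr_ge0. Qed.

Lemma nrm2_eq0 x : nrm2 x = 0 -> x = 0.
Proof.
move=> /eqP; rewrite psumr_eq0; last by move=> k _; rewrite sqr_ge0.
move/allP => h; apply/matrixP => i j; rewrite ord1 mxE; apply/eqP.
by have := h i; rewrite mem_index_enum => /(_ isT); rewrite /= expf_eq0.
Qed.

Lemma nrm2_coord x i : x i 0 ^+ 2 <= nrm2 x.
Proof. by rewrite /nrm2 (bigD1 i) //= lerDl sumr_ge0 // => j _; rewrite sqr_ge0. Qed.

(** The majorant of the Lorentz form at x: the positive definite form <y, y> + 2 <x, y>^2, which is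
    the Euclidean one transported from the origin. It is how a point of H^n measures lattice
    vectors. *)
Definition qx (x y : 'cV[R]_n.+1) : R := nrm2 (Tx x *m y).

Lemma qxE x y : hyp_space x -> qx x y = lorentz y y + 2 * lorentz x y ^+ 2.
Proof.
move=> hx; rewrite /qx nrm2E; have T := Tx_Lor hx; rewrite (Lor_lorentz _ _ T).
by rewrite -[lorentz x y](Lor_lorentz _ _ T) Tx_self // lorentz_origin sqrrN.
Qed.

Lemma qx_ge0 x y : 0 <= qx x y. Proof. exact: nrm2_ge0. Qed.

Lemma qx_origin y : qx o y = nrm2 y.
Proof. by rewrite /qx /Tx eqxx mul1mx. Qed.

Lemma qx_isom A x y : hyp_isom A -> hyp_space x -> qx (A *m x) (A *m y) = qx x y.
Proof.
move=> hA hx; rewrite !qxE //; last exact: (proj2 hA).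
by rewrite !Lor_lorentz //; exact: hyp_isom_Lor.
Qed.

Lemma lorentz_le_nrm2 x y : lorentz x y ^+ 2 <= nrm2 x * nrm2 y.
Proof.
have -> : lorentz x y = \sum_i (if i == ord_max then -1 else 1) * x i 0 * y i 0.
  rewrite /lorentz -mulmxA mxE; apply: eq_bigr => i _.
  by rewrite mul_lorentz_mx mxE; case: ifP => _; ring.
apply: le_trans (sum_CauchySchwarz _ _) _.
rewrite ler_wpM2r ?nrm2_ge0 // ler_sum // => i _.
by rewrite exprMn; case: ifP => _; rewrite ?sqrrN expr1n mul1r.
Qed.

Lemma lorentz_le_qx z x y : hyp_space z -> lorentz x y ^+ 2 <= qx z x * qx z y.
Proof.
by move=> hz; rewrite -(Lor_lorentz x y (Tx_Lor hz)); exact: lorentz_le_nrm2.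
Qed.

(** Moving the base point by a distance d changes the majorant by a factor of at most 4 cosh(d)^2.
    Once y is at the origin, this is Cauchy-Schwarz for <x, v>. *)
Lemma qx_change x y v : hyp_space x -> hyp_space y ->
  qx x v <= 4 * lorentz x y ^+ 2 * qx y v.
Proof.
move=> hx hy; have T := Tx_Lor hy.
rewrite [qx y v]qxE // (qxE v hx) -(Lor_lorentz v v T) -(Lor_lorentz x v T) -(Lor_lorentz y v T) -(Lor_lorentz x y T) Tx_self //.
move: (proj2 (Tx_isom hy) _ hx); move: (Tx y *m x) (Tx y *m v) => {hx T}{}x {}v hx.
rewrite (lorentzC x o) !lorentz_origin !sqrrN -nrm2E.
have h := hyp_sdot hx.
have : lorentz x v ^+ 2 <= nrm2 x * nrm2 v := lorentz_le_nrm2 x v.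
have -> : nrm2 x = 2 * 'ht x ^+ 2 - 1 by rewrite nrm2E (proj1 hx); ring.
have := sqr_ge0 ('ht v); have : lorentz v v = nrm2 v - 2 * 'ht v ^+ 2 by rewrite nrm2E; ring.
have := nrm2_ge0 v.
nra.
Qed.

End Lorentz.

(** * Hyperbolic isometries and closed geodesics *)

Section HyperbolicCosine.
Context {R : realType}.
Implicit Types r t : R.

Definition ch r : R := (expR r + expR (- r)) / 2.

Lemma chN r : ch (- r) = ch r.
Proof. by rewrite /ch opprK addrC. Qed.

Lemma ch_norm r : ch `|r| = ch r.
Proof. by case: (ger0P r) => _; rewrite ?chN. Qed.

Lemma expRVN r : expR r * expR (- r) = 1.
Proof. by rewrite -expRD subrr expR0. Qed.

Lemma ch_arcosh t : 1 <= t -> ch (arcosh t) = t.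
Proof.
move=> t1; set s := Num.sqrt (t ^+ 2 - 1).
have s2 : s ^+ 2 = t ^+ 2 - 1 by rewrite sqr_sqrtr // subr_ge0 exprn_ege1.
have s0 : 0 <= s by exact: sqrtr_ge0.
have p : 0 < t + s by lra.
rewrite /ch expRN /arcosh -/s lnK ?posrE //.
have -> : (t + s)^-1 = t - s.
  by apply: (mulfI (lt0r_neq0 p)); rewrite divff ?lt0r_neq0 //; move: s2; rewrite !expr2 => s2; lra.
by field.
Qed.

Lemma arcosh_ch r : 0 <= r -> arcosh (ch r) = r.
Proof.
move=> r0; rewrite /arcosh.
have -> : ch r ^+ 2 - 1 = ((expR r - expR (- r)) / 2) ^+ 2.
  rewrite /ch; have := expRVN r; set a := expR r; set b := expR (- r) => ab.
  have -> : ((a + b) / 2) ^+ 2 - 1 = ((a - b) / 2) ^+ 2 + (a * b - 1) by field.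
  by rewrite ab subrr addr0.
rewrite sqrtr_sqr ger0_norm; last first.
  by rewrite divr_ge0 // subr_ge0 ler_expR; lra.
rewrite /ch (_ : _ + _ = expR r) ?expRK //; by field.
Qed.

Lemma ch_ge1 r : 1 <= ch r.
Proof.
rewrite /ch; have := expRVN r; have := expR_gt0 r; have := expR_gt0 (- r).
set a := expR r; set b := expR (- r) => b0 a0 ab.
have := sqr_ge0 (a - b); nra.
Qed.

Lemma ch_double r : ch (2 * r) = 2 * ch r ^+ 2 - 1.
Proof.
have -> : 2 * r = r + r by ring.
rewrite /ch opprD !expRD; have := expRVN r.
set a := expR r; set b := expR (- r) => ab.
have -> : 2 * ((a + b) / 2) ^+ 2 - 1 = (a * a + b * b) / 2 + (a * b - 1) by field.
by rewrite ab subrr addr0.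
Qed.

Lemma ch_le_expR r : 0 <= r -> ch r <= expR r.
Proof.
move=> r0; rewrite /ch; have : expR (- r) <= expR r by rewrite ler_expR; lra.
lra.
Qed.

End HyperbolicCosine.

Section Hyperbolic.
Context {R : realType} {n : nat}.
Implicit Types (x y z u v w : 'cV[R]_n.+1) (A B : 'M[R]_n.+1).

Lemma geodesic_lorentz (c : R -> 'cV[R]_n.+1) s t : geodesic_line c ->
  lorentz (c s) (c t) = - ch (s - t).
Proof.
move=> [h1 h2]; have := h2 s t; rewrite /hyp_dist => /(congr1 ch).
rewrite ch_norm ch_arcosh; last by rewrite lerNr; exact: hyp_lorentz_le.
by move=> <-; rewrite opprK.
Qed.

(** A translates by l along the geodesic with ends u and w. The normalization <u, w> = -1/2 puts e^t
    u + e^(-t) w on the hyperboloid; the remaining freedom u -> s u, w -> w / s is the choice of the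
    point with parameter 0. *)
Record hyperbolic A (l : R) u w : Prop := Hyperbolic {
  hyperb_gt0 : 0 < l;
  hyperb_u : A *m u = expR l *: u;
  hyperb_w : A *m w = expR (- l) *: w;
  hyperb_uu : lorentz u u = 0;
  hyperb_ww : lorentz w w = 0;
  hyperb_uw : lorentz u w = - 2^-1;
  hyperb_u0 : 0 < 'ht u;
  hyperb_w0 : 0 < 'ht w }.

Lemma future_sign x u : hyp_space x -> lorentz u u <= 0 -> lorentz x u < 0 -> 0 < 'ht u.
Proof.
move=> hx uu xu; rewrite ltNge; apply/negP; rewrite le_eqVlt => /orP [/eqP u0|u0].
  have : u = 0.
    apply: sdot_eq0 => //; move: uu; rewrite lorentzE u0 mulr0 subr0 => h.
    by apply/eqP; rewrite eq_le h sdot_ge0.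
  by move=> e; move: xu; rewrite e lorentz0r ltxx.
have : lorentz x (- u) < 0.
  by apply: causal_lt => //; rewrite ?lorentzNl ?lorentzNr ?opprK // mxE oppr_gt0.
by rewrite lorentzNr; lra.
Qed.

Lemma orth_hyp_null x z : hyp_space x -> lorentz x z = 0 -> lorentz z z = 0 -> z = 0.
Proof.
move=> hx xz zz; have : qx x z = 0 by rewrite qxE // xz zz; ring.
move/nrm2_eq0 => e; have := Tx_sq hx => h.
by rewrite -[z]mul1mx -h -mulmxA e mulmx0.
Qed.

Lemma closed_geodesic_hyperbolic (G : set 'M[R]_n.+1) c A l :
  hyp_isom A -> closed_geodesic G c A l -> exists u w, hyperbolic A l u w /\ c 0 = u + w.
Proof.
move=> hA [gc _ l0 cl].
have hc t : hyp_space (c t) by case: gc.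
set x0 := c 0; set x1 := c l; set x2 := c (2 * l).
have A0 : A *m x0 = x1 by rewrite cl add0r.
have A1 : A *m x1 = x2 by rewrite cl /x2 mulrDl mul1r.
have e00 : lorentz x0 x0 = -1 by case: (hc 0).
have e11 : lorentz x1 x1 = -1 by case: (hc l).
have e22 : lorentz x2 x2 = -1 by case: (hc (2 * l)).
have e01 : lorentz x0 x1 = - ch l by rewrite geodesic_lorentz // sub0r chN.
have e10 : lorentz x1 x0 = - ch l by rewrite lorentzC.
have e12 : lorentz x1 x2 = - ch l by rewrite geodesic_lorentz // -chN; congr (- ch _); ring.
have e21 : lorentz x2 x1 = - ch l by rewrite lorentzC.
have e02 : lorentz x0 x2 = 1 - 2 * ch l ^+ 2.
  by rewrite geodesic_lorentz // sub0r chN ch_double; ring.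
have e20 : lorentz x2 x0 = 1 - 2 * ch l ^+ 2 by rewrite lorentzC.
(* The difference is null and orthogonal to the timelike x1, hence 0. So A acts on the span of x0
   and x1 by a recurrence with characteristic roots e^l and e^(-l); u and w are its eigenvectors,
   scaled so that u + w = x0. *)
have rel : x2 = (2 * ch l) *: x1 - x0.
  apply/eqP; rewrite -subr_eq0; apply/eqP; apply: (@orth_hyp_null x1); first exact: hc.
    by rewrite !lorentz_lin e11 e12 e10; ring.
  by rewrite !lorentz_lin e11 e12 e10 e00 e01 e02 e20 e21 e22; ring.
set a := expR l; set b := expR (- l).
have ab : a * b = 1 by exact: expRVN.
have b0 : 0 < b by exact: expR_gt0.
have ba : b < a by rewrite ltr_expR; lra.
have ech : 2 * ch l = a + b by rewrite /ch -/a -/b; field.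
have chE : ch l = (a + b) / 2 by [].
pose k := (a - b)^-1; have k0 : 0 < k by rewrite invr_gt0 subr_gt0.
have kab : k * (a - b) = 1 by rewrite mulVf // subr_eq0 gt_eqF.
pose u := k *: (x1 - b *: x0); pose w := k *: (a *: x0 - x1).
have uu : lorentz u u = 0.
  rewrite /u !lorentz_lin e00 e11 e01 e10 chE.
  match goal with |- ?X = _ => have -> : X = k * k * (a * b - 1) by field end.
  by rewrite ab subrr mulr0.
have ww : lorentz w w = 0.
  rewrite /w !lorentz_lin e00 e11 e01 e10 chE.
  match goal with |- ?X = _ => have -> : X = k * k * (a * b - 1) by field end.
  by rewrite ab subrr mulr0.
have uw : lorentz u w = - 2^-1.
  rewrite /u /w !lorentz_lin e00 e11 e01 e10 chE.
  match goal with |- ?X = _ => have -> : X = - ((k * (a - b)) ^+ 2) / 2 + k ^+ 2 * (1 - (a * b)) by field end.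
  by rewrite kab ab; field.
exists u, w; split; last first.
  apply/matrixP => i j; rewrite !mxE.
  transitivity ((k * (a - b)) * x0 i j); first by rewrite kab mul1r.
  ring.
split=> //.
- rewrite /u -!scalemxAr mulmxBr -scalemxAr A0 A1 rel ech.
  apply/matrixP => i j; rewrite !mxE.
  match goal with |- ?X = _ => have -> : X = a * (k * (x1 i j - b * x0 i j)) + k * x0 i j * (a * b - 1) by ring end.
  by rewrite ab subrr mulr0 addr0.
- rewrite /w -!scalemxAr mulmxBr -scalemxAr A0 A1 rel ech.
  apply/matrixP => i j; rewrite !mxE.
  match goal with |- ?X = _ => have -> : X = b * (k * (a * x0 i j - x1 i j)) + k * x0 i j * (1 - a * b) by ring end.
  by rewrite ab subrr mulr0 addr0.
- apply: (@future_sign x0); rewrite ?uu //; first exact: hc.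
  rewrite /u !lorentz_lin e01 e00 chE.
  match goal with |- is_true (?X < _) => have -> : X = - (k * (a - b)) / 2 by field end.
  rewrite kab; lra.
- apply: (@future_sign x0); rewrite ?ww //; first exact: hc.
  rewrite /w !lorentz_lin e01 e00 chE.
  match goal with |- is_true (?X < _) => have -> : X = - (k * (a - b)) / 2 by field end.
  rewrite kab; lra.
Qed.

Definition axis u w (t : R) := expR t *: u + expR (- t) *: w.

Lemma axis_hyp u w t : lorentz u u = 0 -> lorentz w w = 0 -> lorentz u w = - 2^-1 ->
  0 < 'ht u -> 0 < 'ht w -> hyp_space (axis u w t).
Proof.
move=> uu ww uw u0 w0; split.
  rewrite /axis !lorentz_lin uu ww uw (lorentzC w u) uw.
  match goal with |- ?X = _ => have -> : X = - (expR t * expR (- t)) by field end.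
  by rewrite expRVN.
by rewrite !mxE addr_gt0 // mulr_gt0 // expR_gt0.
Qed.

Lemma hyperbolic_closed (G : set 'M[R]_n.+1) A l u w : G A -> hyperbolic A l u w ->
  closed_geodesic G (axis u w) A l.
Proof.
move=> GA [l0 Au Aw uu ww uw u0 w0]; split=> //.
  split=> [t|s t]; first exact: axis_hyp.
  rewrite /hyp_dist /axis !lorentz_lin uu ww uw (lorentzC w u) uw.
  rewrite -[RHS]arcosh_ch // ch_norm; congr arcosh.
  by rewrite /ch expRD opprB expRD; field.
move=> t; rewrite /axis mulmxDr -!scalemxAr Au Aw !scalerA -!expRD opprD.
by [].
Qed.

(** A fixes only two null directions. Invariance of the form gives (e^l mu - 1) <u, v> = 0 and
    (e^(-l) mu - 1) <w, v> = 0; the first factors cannot both vanish, and a null vector orthogonal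
    to u or w is parallel to it. *)
Lemma hyperbolic_eigen A l u w v (mu : R) : Lor A -> hyperbolic A l u w ->
  A *m v = mu *: v -> lorentz v v = 0 -> v != 0 ->
  (mu = expR l /\ exists s, v = s *: u) \/ (mu = expR (- l) /\ exists s, v = s *: w).
Proof.
move=> LA [l0 Au Aw uu ww uw u0 w0] Av vv v0.
have E : expR l * expR (- l) = 1 by exact: expRVN.
have hu : (expR l * mu - 1) * lorentz u v = 0.
  have := Lor_lorentz u v LA; rewrite Au Av !lorentz_lin => h.
  by rewrite mulrBl mul1r -mulrA h subrr.
have hw : (expR (- l) * mu - 1) * lorentz w v = 0.
  have := Lor_lorentz w v LA; rewrite Aw Av !lorentz_lin => h.
  by rewrite mulrBl mul1r -mulrA h subrr.
have par x : 0 < 'ht x -> lorentz x x = 0 -> lorentz x v = 0 -> exists s, v = s *: x.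
  move=> x0 xx xv; exists ('ht v / 'ht x).
  have e := isotropic_orth xx vv xv.
  by rewrite mulrC -scalerA e scalerA mulVf ?scale1r // gt_eqF.
have eig x (mx : R) : A *m x = mx *: x -> (exists s, v = s *: x) -> mu = mx.
  move=> Ax [s e]; have s0 : v != 0 := v0.
  have : A *m v = mx *: v by rewrite e -scalemxAr Ax !scalerA mulrC.
  rewrite Av => /eqP; rewrite -subr_eq0 -scalerBl scaler_eq0 (negbTE v0) orbF subr_eq0.
  by move/eqP.
have [uv0|uv] := eqVneq (lorentz u v) 0.
  by left; have p := par u u0 uu uv0; split=> //; exact: eig Au p.
have [wv0|wv] := eqVneq (lorentz w v) 0.
  by right; have p := par w w0 ww wv0; split=> //; exact: eig Aw p.
exfalso; move/eqP: hu; rewrite mulf_eq0 (negbTE uv) orbF subr_eq0 => /eqP h1.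
move/eqP: hw; rewrite mulf_eq0 (negbTE wv) orbF subr_eq0 => /eqP h2.
have lt : expR (- l) < expR l by rewrite ltr_expR; lra.
have mu0 : 0 < mu by have := expR_gt0 l; have := expR_gt0 (-l); nra.
nra.
Qed.

Lemma hyperbolic_length_unique A l u w l' u' w' : Lor A ->
  hyperbolic A l u w -> hyperbolic A l' u' w' -> l = l'.
Proof.
move=> LA h [l0' Au' _ uu' _ _ u0' _].
have u'n : u' != 0 by apply/eqP => e; move: u0'; rewrite e mxE ltxx.
have l0 := hyperb_gt0 h.
case: (hyperbolic_eigen LA h Au' uu' u'n) => -[/expR_inj e _]; lra.
Qed.

Lemma hyperbolic_axis_unique A l u w l' u' w' : Lor A ->
  hyperbolic A l u w -> hyperbolic A l' u' w' ->
  exists t, forall s, axis u' w' s = axis u w (s + t).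
Proof.
move=> LA h h'; have [l0' Au' Aw' uu' ww' uw' u0' w0'] := h'.
have [l0 Au Aw uu ww uw u0 w0] := h.
have u'n : u' != 0 by apply/eqP => e; move: u0'; rewrite e mxE ltxx.
have w'n : w' != 0 by apply/eqP => e; move: w0'; rewrite e mxE ltxx.
have [s es] : exists s, u' = s *: u.
  by case: (hyperbolic_eigen LA h Au' uu' u'n) => -[/expR_inj e //]; lra.
have [r er] : exists s, w' = s *: w.
  by case: (hyperbolic_eigen LA h Aw' ww' w'n) => -[/expR_inj e //]; lra.
have s0 : 0 < s by move: u0'; rewrite es mxE pmulr_lgt0.
have sr : s * r = 1.
  move: uw'; rewrite es er !lorentz_lin uw => e; lra.
exists (ln s) => t; rewrite /axis es er opprD !expRD expRN lnK ?posrE //.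
have -> : r = s^-1 by apply: (mulfI (lt0r_neq0 s0)); rewrite sr divff // gt_eqF.
by rewrite expRN lnK ?posrE // !scalerA.
Qed.

End Hyperbolic.

(** * A trace criterion for hyperbolic elements *)

Section Spectrum.
Context {R : realType}.

Section Trace.
Context {n : nat}.
Implicit Types (x y z u v w : 'cV[R]_n.+1) (A B : 'M[R]_n.+1).

Lemma Re_sum (I : finType) (F : I -> R[i]) : complex.Re (\sum_i F i) = \sum_i complex.Re (F i).
Proof. by apply: (big_morph (@complex.Re R)) => // -[a b] [c d]. Qed.

Lemma Im_sum (I : finType) (F : I -> R[i]) : complex.Im (\sum_i F i) = \sum_i complex.Im (F i).
Proof. by apply: (big_morph (@complex.Im R)) => // -[a b] [c d]. Qed.

Lemma complex_eigenvector A : (n.+1)%:R < `|\tr A| ->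
  exists (s t : R) (a b : 'cV[R]_n.+1),
    [/\ 1 < s ^+ 2 + t ^+ 2, A *m a = s *: a - t *: b, A *m b = t *: a + s *: b &
       a != 0 \/ b != 0].
Proof.
(* The transpose turns row eigenvectors of [AC] into column eigenvectors of A. If all n + 1 complex
   roots had modulus at most 1, so would be the trace by n + 1. *)
move=> tr; pose AC := map_mx (real_complex R) A^T.
have [r er] := closed_field_poly_normal (char_poly AC).
rewrite (monicP (char_poly_monic AC)) scale1r in er.
have sr : size r = n.+1.
  by apply: succn_inj; rewrite -(size_prod_XsubC r id) -er size_char_poly.
have trE : \sum_(z <- r) z = real_complex R (\tr A).
  have := coefPn_prod_XsubC (ps := r); rewrite sr => /(_ isT).
  rewrite -er /= (char_poly_trace AC) //= => /eqP; rewrite eqr_opp => /eqP <-.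
  by rewrite /mxtrace rmorph_sum; apply: eq_bigr => i _; rewrite !mxE.
have [/hasP[z zr z1]|] := boolP (has (fun z : R[i] => 1 < `|z|) r); last first.
  rewrite -all_predC => /allP h.
  have : `|\sum_(z <- r) z| <= (n.+1)%:R :> R[i].
    apply: le_trans (ler_norm_sum _ _ _) _; rewrite -sr.
    rewrite -sum1_size natr_sum big_seq [X in _ <= X]big_seq; apply: ler_sum => z zr.
    have /= := h _ zr; rewrite real_ltNge ?real1 ?normr_real // negbK => l; exact: l.
  rewrite trE normc_def /= expr0n /= addr0 sqrtr_sqr.
  have -> : (n.+1)%:R = real_complex R (n.+1)%:R by rewrite rmorph_nat.
  by rewrite lecR leNgt tr.
have : eigenvalue AC z.
  rewrite eigenvalue_root_char er; apply/rootP; rewrite horner_prod.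
  apply/eqP; rewrite prodf_seq_eq0; apply/hasP; exists z => //=.
  by rewrite hornerXsubC subrr.
move/eigenvalueP => [v ev v0].
exists (complex.Re z), (complex.Im z), (\col_i complex.Re (v 0 i)), (\col_i complex.Im (v 0 i)).
have E i : \sum_j real_complex R (A i j) * v 0 j = z * v 0 i.
  move/matrixP: ev => /(_ 0 i); rewrite !mxE => <-; apply: eq_bigr => j _.
  by rewrite !mxE mulrC.
split.
- move: z1; rewrite normc_def.
  have -> : (1 : R[i]) = real_complex R 1 by [].
  rewrite ltcR => h; have := sqrtr_ge0 (complex.Re z ^+ 2 + complex.Im z ^+ 2) => h0.
  have <- : Num.sqrt (complex.Re z ^+ 2 + complex.Im z ^+ 2) ^+ 2 = complex.Re z ^+ 2 + complex.Im z ^+ 2.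
    by rewrite sqr_sqrtr // addr_ge0 // sqr_ge0.
  by rewrite exprn_egt1.
- apply/matrixP => i j; rewrite ord1 !mxE; have := congr1 (@complex.Re R) (E i).
  rewrite Re_sum; case: z {zr z1 ev E} => s t /=; case: (v 0 i) => p q /= <-.
  by apply: eq_bigr => k _; rewrite !mxE; case: (v 0 k) => ? ? /=; ring.
- apply/matrixP => i j; rewrite ord1 !mxE; have := congr1 (@complex.Im R) (E i).
  rewrite Im_sum; case: z {zr z1 ev E} => s t /=; case: (v 0 i) => p q /= h.
  rewrite addrC -h.
  by apply: eq_bigr => k _; rewrite !mxE; case: (v 0 k) => ? ? /=; ring.
- case: (eqVneq (\col_i complex.Re (v 0 i)) 0) => [e1|]; last by left.
  case: (eqVneq (\col_i complex.Im (v 0 i)) 0) => [e2|]; last by right.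
  exfalso; move/eqP: v0; apply; apply/matrixP => i j; rewrite ord1 mxE.
  move/matrixP: e1 => /(_ j 0); move/matrixP: e2 => /(_ j 0); rewrite !mxE.
  by case: (v 0 j) => ? ? /= -> ->.
Qed.

(** The eigenvalue z = s + it has modulus > 1. On a + ib the bilinear form is multiplied by z^2, and
    between a + ib and its conjugate by |z|^2; neither is 1, so a and b span a totally isotropic
    space. In signature (n, 1) this is a line, so z is real, and it is positive because A preserves
    the future cone. *)
Lemma trace_real_eigen A : hyp_isom A -> (n.+1)%:R < `|\tr A| ->
  exists s u, [/\ 1 < s, A *m u = s *: u, lorentz u u = 0 & 0 < 'ht u].
Proof.
move=> hA tr; have LA := hyp_isom_Lor hA.
have [s [t [a [b [st Aa Ab ab]]]]] := complex_eigenvector tr.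
have eaa := Lor_lorentz a a LA; have eab := Lor_lorentz a b LA; have ebb := Lor_lorentz b b LA.
move: eaa eab ebb; rewrite Aa Ab !lorentz_lin (lorentzC b a).
set al := lorentz a a; set be := lorentz b b; set ga := lorentz a b => eaa eab ebb.
have s1 : al + be = 0.
  have : (s ^+ 2 + t ^+ 2 - 1) * (al + be) = 0 by rewrite !expr2; lra.
  move/eqP; rewrite mulf_eq0 => /orP [/eqP|/eqP //]; lra.
have beE : be = - al by lra.
have q1 : al * (1 - s ^+ 2 + t ^+ 2) = - 2 * s * t * ga.
  move: eaa; rewrite beE !expr2 => e; nra.
have q2 : ga * (1 - s ^+ 2 + t ^+ 2) = 2 * s * t * al.
  move: eab; rewrite beE !expr2 => e; nra.
have q3 : (al ^+ 2 + ga ^+ 2) * (1 - s ^+ 2 + t ^+ 2) = 0.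
  have -> : (al ^+ 2 + ga ^+ 2) * (1 - s ^+ 2 + t ^+ 2) =
    al * (al * (1 - s ^+ 2 + t ^+ 2)) + ga * (ga * (1 - s ^+ 2 + t ^+ 2)) by ring.
  by rewrite q1 q2; ring.
have q4 : (al ^+ 2 + ga ^+ 2) * (s * t) = 0.
  have : ga * (al * (1 - s ^+ 2 + t ^+ 2)) - al * (ga * (1 - s ^+ 2 + t ^+ 2)) = 0 by ring.
  by rewrite q1 q2 !expr2 => h; lra.
have null : al ^+ 2 + ga ^+ 2 = 0.
  apply/eqP; apply: contraT => ne.
  move/eqP: q4; rewrite mulf_eq0 (negbTE ne) /= mulf_eq0.
  move/eqP: q3; rewrite mulf_eq0 (negbTE ne) /= => /eqP q3.
  case/orP => /eqP z0; rewrite z0 expr0n /= in q3 st.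
    by have := sqr_ge0 t; lra.
  lra.
have al0 : al = 0.
  by apply/eqP; rewrite -sqrf_eq0 eq_le sqr_ge0 andbT; have := sqr_ge0 ga; lra.
have ga0 : ga = 0.
  by apply/eqP; rewrite -sqrf_eq0 eq_le sqr_ge0 andbT; have := sqr_ge0 al; lra.
have be0 : be = 0 by lra.
have par : 'ht b *: a = 'ht a *: b := isotropic_orth al0 be0 ga0.
have [v [vv v0 [m [Av m1]]]] : exists v, [/\ lorentz v v = 0, v != 0 & exists m : R, A *m v = m *: v /\ 1 < m ^+ 2].
  have key (p q : 'cV[R]_n.+1) (m r : R) : lorentz p p = 0 -> p != 0 -> 'ht q *: p = 'ht p *: q ->
     1 < m ^+ 2 + r ^+ 2 ->
     A *m p = m *: p - r *: q -> A *m q = r *: p + m *: q ->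
     exists v, [/\ lorentz v v = 0, v != 0 & exists m : R, A *m v = m *: v /\ 1 < m ^+ 2].
    move=> pp p0 pq mr Ap Aq.
    have hp : 'ht p != 0 by apply: contra p0 => /eqP h; apply/eqP; exact: isotropic_ht0.
    pose k := 'ht q / 'ht p.
    have qE : q = k *: p by rewrite /k mulrC -scalerA pq scalerA mulVf ?scale1r.
    have Ap' : A *m p = (m - r * k) *: p by rewrite Ap qE scalerA scalerBl.
    have : A *m q = (k * (m - r * k)) *: p by rewrite qE -scalemxAr Ap' scalerA.
    rewrite Aq qE scalerA -scalerDl => /eqP; rewrite -subr_eq0 -scalerBl scaler_eq0 (negbTE p0) orbF.
    have -> : r + m * k - k * (m - r * k) = r * (1 + k ^+ 2) by ring.
    rewrite mulf_eq0 => /orP [/eqP r0|/eqP]; last by have := sqr_ge0 k; lra.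
    exists p; split=> //; exists m; rewrite r0 expr0n /= addr0 in mr.
    by rewrite Ap r0 scale0r subr0.
  case: ab => [a0|b0]; first exact: (key a b s t).
  apply: (key b a s (- t)) => //; first by rewrite sqrrN.
    by rewrite Ab scaleNr opprK addrC.
  by rewrite Aa scaleNr addrC.
have hv : 'ht v != 0 by apply: contra v0 => /eqP h; apply/eqP; exact: isotropic_ht0.
have [u [uu u0 Au]] : exists u, [/\ lorentz u u = 0, 0 < 'ht u & A *m u = m *: u].
  move: hv; rewrite neq_lt => /orP [l|g]; last by exists v.
  exists (- v); rewrite lorentzNl lorentzNr opprK mxE oppr_gt0; split=> //.
  by rewrite mulmxN Av scalerN.
exists m, u; split=> //.
have : 0 < 'ht (A *m u) by apply: hyp_isom_causal => //; rewrite uu.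
rewrite Au mxE pmulr_lgt0 // => m0.
by move: m1; rewrite -[X in X < _](expr1n _ 2) ltr_pXn2r // nnegrE // ltW.
Qed.

Lemma Lor_tr_inv A : Lor A -> \tr (invmx A) = \tr A.
Proof.
move=> h; rewrite Lor_inv // mxtrace_mulC mulmxA lorentz_mx_sq mul1mx mxtrace_tr //.
Qed.

(** The inverse is conjugate to the transpose, so it has the same trace and also an expanded null
    vector w. This is the second end of the axis; since <u, w> is invariant and not 0, the two
    eigenvalues are inverse to each other. *)
Lemma trace_hyperbolic A : hyp_isom A -> (n.+1)%:R < `|\tr A| ->
  exists l u w, hyperbolic A l u w.
Proof.
move=> hA tr; have LA := hyp_isom_Lor hA.
have [s [u [s1 Au uu u0]]] := trace_real_eigen hA tr.
have tr' : (n.+1)%:R < `|\tr (invmx A)| by rewrite Lor_tr_inv.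
have [r [w [r1 Aw ww w0]]] := trace_real_eigen (hyp_isom_inv hA) tr'.
have Aw' : A *m w = r^-1 *: w.
  have e : w = r *: (A *m w) by rewrite scalemxAr -Aw mulKVmx // Lor_unit.
  by rewrite {2}e scalerA mulVf ?scale1r // gt_eqF //; lra.
have uw : lorentz u w < 0.
  rewrite lt_neqAle; apply/andP; split; last first.
    rewrite leNgt; apply/negP => h.
    have : lorentz u w <= 0; last by rewrite leNgt h.
    rewrite lorentzE subr_le0; apply: le_trans (ler_norm _) _.
    suff : `|sdot u w| ^+ 2 <= ('ht u * 'ht w) ^+ 2.
      by rewrite ler_pXn2r // nnegrE // mulr_ge0 // ltW.
    rewrite real_normK ?num_real //; apply: le_trans (sdot_CS _ _) _.
    have -> : sdot u u = 'ht u * 'ht u by move: uu; rewrite lorentzE; lra.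
    have -> : sdot w w = 'ht w * 'ht w by move: ww; rewrite lorentzE; lra.
    by rewrite exprMn !expr2.
  apply/eqP => h0; have e := isotropic_orth uu ww h0.
  have : A *m ('ht w *: u) = A *m ('ht u *: w) by rewrite e.
  rewrite -!scalemxAr Au Aw' scalerA mulrC -scalerA e !scalerA => /eqP.
  rewrite -subr_eq0 -scalerBl scaler_eq0; case/orP => [|/eqP w00]; last first.
    by move: w0; rewrite w00 mxE ltxx.
  rewrite (mulrC s) -mulrBr mulf_eq0 gt_eqF //= subr_eq0 => /eqP sr.
  have : r^-1 < 1 by rewrite invf_lt1 //; lra.
  rewrite -sr; lra.
have sr : s = r.
  have := Lor_lorentz u w LA; rewrite Au Aw' !lorentz_lin mulrA => /eqP.
  rewrite -[X in _ == X]mul1r -subr_eq0 -mulrBl mulf_eq0 (lt_eqF uw) orbF subr_eq0 => /eqP e.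
  by rewrite -[r]mul1r -e mulfVK // gt_eqF //; lra.
pose k := - 2 * lorentz u w; have k0 : 0 < k by rewrite /k; lra.
have s0 : 0 < s by lra.
exists (ln s), u, (k^-1 *: w); split=> //.
- exact: ln_gt0.
- by rewrite lnK.
- by rewrite expRN lnK ?posrE // -scalemxAr Aw' -sr !scalerA mulrC.
- by rewrite !lorentz_lin ww !mulr0.
- rewrite !lorentz_lin.
  have -> : lorentz u w = - 2^-1 * k by rewrite /k; field.
  by rewrite mulrCA mulVf ?mulr1 // gt_eqF.
- by rewrite mxE mulr_gt0 // invr_gt0.
Qed.

End Trace.

End Spectrum.

(** * Characteristic polynomials of hyperbolic isometries *)

Section CharPoly.
Context {R : realType} {k : nat}.
Local Notation n := k.+1.
Local Notation J := (@lorentz_mx R n).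
Implicit Types (u w : 'cV[R]_n.+1) (A : 'M[R]_n.+1).

Definition frontS : 'M[R]_(k.+2, k) := \matrix_(i, j) ((i : nat) == j)%:R.

Lemma lorentz_frontS : J *m frontS = frontS.
Proof.
apply/matrixP => i j; rewrite lorentz_mxE mul_diag_mx !mxE.
case: eqP => [->|_]; last by rewrite mul1r.
by rewrite /= gtn_eqF ?mulr0 //; apply: leq_trans (ltn_ord j) _.
Qed.

Lemma frontS_orth : frontS^T *m frontS = 1%:M.
Proof.
apply/matrixP => i j; rewrite !mxE.
have hi : (i < k.+2)%N by apply: leq_trans (ltn_ord i) _; lia.
rewrite (bigD1 (Ordinal hi)) //= !mxE /= eqxx mul1r big1 ?addr0.
  by rewrite -val_eqE.
move=> l ne; rewrite !mxE; case: eqP => [e|_]; last by rewrite mul0r.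
by move/eqP: ne; case; apply/val_inj.
Qed.

Lemma frontS_delta (i : 'I_k.+2) : (k <= i)%N -> frontS^T *m delta_mx i (0 : 'I_1) = 0.
Proof.
move=> hi; rewrite -colE; apply/matrixP => j j'; rewrite !mxE.
by rewrite gtn_eqF //; apply: leq_trans (ltn_ord j) hi.
Qed.

(** F is an orthonormal basis of the complement of the plane of u and w, on which the form is
    positive definite. It is the image of the first k basis vectors under a Lorentz matrix that
    takes o to u + w and the remaining spatial basis vector e to u - w. *)
Lemma axis_frame u w : lorentz u u = 0 -> lorentz w w = 0 -> lorentz u w = - 2^-1 ->
  0 < 'ht u -> 0 < 'ht w ->
  exists F : 'M[R]_(k.+2, k), [/\ F^T *m J *m F = 1%:M, F^T *m J *m u = 0 & F^T *m J *m w = 0].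
Proof.
move=> uu ww uw u0 w0.
have hx : hyp_space (u + w).
  by have := axis_hyp 0 uu ww uw u0 w0; rewrite /axis oppr0 expR0 !scale1r.
set x0 := u + w in hx; pose y0 := u - w.
have LT := Tx_Lor hx; have T2 := Tx_sq hx.
pose e : 'cV[R]_k.+2 := delta_mx (inord k) 0.
have ek : (inord k : 'I_k.+2) = k :> nat by rewrite inordK.
have he : 'ht e = 0 by rewrite mxE -val_eqE /= ek gtn_eqF.
have ee : lorentz e e = 1.
  rewrite lorentzE he mulr0 subr0.
  have : nrm2 e = 1.
    rewrite /nrm2 (bigD1 (inord k)) //= mxE !eqxx big1 ?expr1n ?addr0 //.
    by move=> i ne; rewrite mxE (negbTE ne) expr0n.
  by rewrite nrm2E lorentzE he !expr2 !mulr0 subr0 addr0.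
have yy : lorentz y0 y0 = 1 by rewrite !lorentz_lin uu ww uw (lorentzC w) uw; field.
have xy : lorentz x0 y0 = 0 by rewrite !lorentz_lin uu ww uw (lorentzC w) uw; ring.
pose y1 := Tx x0 *m y0.
have y11 : lorentz y1 y1 = 1 by rewrite (Lor_lorentz _ _ LT).
have hy1 : 'ht y1 = 0.
  by apply/eqP; rewrite -oppr_eq0 -lorentz_origin -[origin](Tx_self hx) (Lor_lorentz _ _ LT) xy.
have [T1 [LT1 T1o T1e]] : exists T1 : 'M[R]_k.+2, [/\ Lor T1, T1 *m origin = origin & T1 *m e = y1].
  have [<-|ne] := eqVneq y1 e; first by exists 1%:M; rewrite !mul1mx; split=> //; exact: Lor1.
  (* Both vectors have height 0, so their difference is spacelike and the reflection in it fixes the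
     origin. *)
  have r0 : lorentz (y1 - e) (y1 - e) != 0.
    apply: contra ne => /eqP h; rewrite -subr_eq0; apply/eqP.
    by apply: isotropic_ht0 => //; rewrite mxE [(- e) _ _]mxE hy1 he subr0.
  exists (reflection (y1 - e)); split; first exact: reflection_Lor.
    rewrite reflectionE lorentzC lorentz_origin mxE [(- e) _ _]mxE he hy1 subr0 oppr0 mulr0 mul0r.
    by rewrite scale0r subr0.
  by apply: reflection_swap; rewrite ?y11.
have [T [LTT To Te]] : exists T : 'M[R]_k.+2, [/\ Lor T, T *m origin = x0 & T *m e = y0].
  exists (Tx x0 *m T1); split; first exact: Lor_mul.
    by rewrite -mulmxA T1o Tx_origin.
  by rewrite -mulmxA T1e mulmxA T2 mul1mx.
have key (p : nat) (z : 'M[R]_(k.+2, p)) : (T *m frontS)^T *m J *m (T *m z) = frontS^T *m (J *m z).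
  by rewrite trmx_mul -!mulmxA; congr (_ *m _); rewrite !mulmxA LTT.
have SJ : frontS^T *m J = frontS^T by rewrite -[in RHS]lorentz_frontS trmx_mul lorentz_mx_tr.
have So : frontS^T *m (J *m origin) = 0 by rewrite mulmxA SJ frontS_delta.
have Se : frontS^T *m (J *m e) = 0 by rewrite mulmxA SJ frontS_delta // ek.
exists (T *m frontS); split.
- by rewrite -mulmxA mulmxA key lorentz_frontS frontS_orth.
- have -> : u = T *m (2^-1 *: (origin + e)).
    by rewrite -scalemxAr mulmxDr To Te /x0 /y0; apply/matrixP => i j; rewrite !mxE; field.
  by rewrite key -!scalemxAr !mulmxDr So Se addr0 scaler0.
- have -> : w = T *m (2^-1 *: (origin - e)).
    by rewrite -scalemxAr mulmxBr To Te /x0 /y0; apply/matrixP => i j; rewrite !mxE; field.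
  by rewrite key -!scalemxAr !mulmxBr So Se subr0 scaler0.
Qed.

Lemma char_poly_conj (m : nat) (A M T : 'M[R]_m) : T \in unitmx -> A *m T = T *m M ->
  char_poly A = char_poly M.
Proof.
move=> uT e; have eA : A = T *m M *m invmx T by rewrite -e mulmxK.
pose TP := map_mx (@polyC R) T; pose VP := map_mx (@polyC R) (invmx T).
have TV : TP *m VP = 1%:M by rewrite -map_mxM mulmxV // map_mx1.
have : char_poly_mx A = TP *m char_poly_mx M *m VP.
  rewrite /char_poly_mx eA !map_mxM mulmxBr mulmxBl; congr (_ - _).
  by rewrite -mulmxA -scalar_mxC mulmxA TV mul1mx.
rewrite /char_poly => ->; rewrite !det_mulmx mulrAC -det_mulmx TV det1 mul1r //.
Qed.

Lemma char_poly_block (p q : nat) (A : 'M[R]_p) (B : 'M[R]_q) :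
  char_poly (block_mx A 0 0 B) = char_poly A * char_poly B.
Proof. by rewrite /char_poly char_block_diag_mx det_ublock. Qed.

(** A preserves the plane of u and w and its orthogonal complement; the latter is definite, so A
    acts there by an orthogonal matrix. The bounds of the trace and of the coefficients in terms of
    e^l rest on this factorization. *)
Lemma hyperbolic_char_poly A l u w : Lor A -> hyperbolic A l u w ->
  exists R' : 'M[R]_k, [/\ R'^T *m R' = 1%:M,
    char_poly A = ('X - (expR l)%:P) * ('X - (expR (- l))%:P) * char_poly R' &
    \tr A = expR l + expR (- l) + \tr R'].
Proof.
move=> LA [l0 Au Aw uu ww uw u0 w0].
have [F [FF Fu Fw]] := axis_frame uu ww uw u0 w0.
pose U : 'M[R]_(k.+2, 1 + 1) := row_mx u w.
pose a := expR l; pose b := expR (- l).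
have ab : a * b = 1 by exact: expRVN.
pose D : 'M[R]_(1 + 1) := block_mx a%:M 0 0 b%:M.
pose D' : 'M[R]_(1 + 1) := block_mx b%:M 0 0 a%:M.
have AU : A *m U = U *m D.
  by rewrite mul_mx_row mul_row_block !mulmx0 addr0 add0r !mul_mx_scalar Au Aw.
have DD' : D *m D' = 1%:M.
  rewrite mulmx_block !mulmx0 !mul0mx !addr0 !add0r -!scalar_mxM ab mulrC ab.
  by rewrite -scalar_mx_block.
have FU : F^T *m J *m U = 0 by rewrite mul_mx_row Fu Fw row_mx0.
have UF : U^T *m J *m F = 0.
  by apply: trmx_inj; rewrite !trmx_mul trmxK lorentz_mx_tr mulmxA FU trmx0.
pose G2 := U^T *m J *m U.
have G2E : G2 = block_mx 0 (- 2^-1)%:M (- 2^-1)%:M 0.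
  rewrite /G2 tr_row_mx !mul_col_mx !mul_mx_row.
  have sc (x y : 'cV[R]_k.+2) : x^T *m J *m y = (lorentz x y)%:M.
    by rewrite [LHS]mx11_scalar.
  by rewrite !sc uu ww uw (lorentzC w) uw raddf0 block_mxEv.
have G2u : G2 *m (4 *: G2) = 1%:M.
  rewrite -scalemxAr G2E mulmx_block !mulmx0 !mul0mx !addr0 !add0r -!scalar_mxM.
  rewrite scale_block_mx !scaler0 !scale_scalar_mx.
  have -> : 4 * (- 2^-1 * - 2^-1) = 1 :> R by field.
  by rewrite -scalar_mx_block.
pose T : 'M[R]_(k.+2, (1 + 1) + k) := row_mx U F.
pose Gr : 'M[R]_((1 + 1) + k) := block_mx G2 0 0 1%:M.
have TJT : T^T *m J *m T = Gr.
  have -> : T^T = col_mx U^T F^T by exact: (@tr_row_mx _ _ _ _ U F).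
  rewrite mul_col_mx mul_col_row.
  by rewrite UF FU FF.
have GrU : Gr *m (block_mx (4 *: G2) 0 0 1%:M : 'M[R]_((1 + 1) + k)) = 1%:M.
  rewrite mulmx_block !mulmx0 !mul0mx !addr0 !add0r mulmx1 G2u.
  by rewrite -scalar_mx_block.
have TJu : (T^T *m J : 'M[R]_k.+2) \in unitmx.
  have : (T^T *m J) *m (T *m (block_mx (4 *: G2) 0 0 1%:M : 'M[R]_((1 + 1) + k))) = 1%:M.
    by rewrite mulmxA TJT.
  by move/mulmx1_unit => [].
have Tu : (T : 'M[R]_k.+2) \in unitmx by move: TJu; rewrite unitmx_mul unitmx_tr => /andP [].
pose R' := F^T *m J *m A *m F.
pose M : 'M[R]_((1 + 1) + k) := block_mx D 0 0 R'.
have AT : A *m T = T *m M.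
  suff : (T^T *m J) *m (A *m T) = (T^T *m J) *m (T *m M) by move/(can_inj (mulKmx TJu)).
  rewrite [in RHS]mulmxA TJT.
  have -> : T^T = col_mx U^T F^T by exact: (@tr_row_mx _ _ _ _ U F).
  have -> : A *m T = row_mx (A *m U) (A *m F) by exact: (@mul_mx_row _ _ _ _ _ A U F).
  rewrite mul_col_mx mul_col_row AU !mulmxA FU mul0mx.
  have -> : U^T *m J *m A *m F = 0.
    have h : D *m (U^T *m J *m A) = U^T *m J.
      have Dt : D^T = D by rewrite tr_block_mx !tr_scalar_mx !trmx0.
      by rewrite -{1}Dt !mulmxA -trmx_mul -AU trmx_mul -!mulmxA (mulmxA A^T) LA.
    have : D' *m (D *m (U^T *m J *m A)) *m F = 0 by rewrite h -mulmxA UF mulmx0.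
    by rewrite mulmxA (mulmx1C DD') mul1mx.
  by rewrite /Gr /M mulmx_block !mulmx0 !mul0mx !addr0 !add0r mul1mx.
have MG : M^T *m Gr *m M = Gr.
  rewrite -TJT !mulmxA -(mulmxA _ T M) -AT -trmx_mul -AT trmx_mul.
  by rewrite !mulmxA -(mulmxA _ A^T) -(mulmxA _ (A^T *m _)) LA.
exists R'; split.
- move: MG; rewrite /M /Gr tr_block_mx !mulmx_block => /eq_block_mx [_ _ _].
  by rewrite !trmx0 !mul0mx !mulmx0 !add0r mulmx1.
- rewrite (char_poly_conj Tu AT).
  have -> : char_poly (M : 'M[R]_k.+2) = char_poly D * char_poly R' by exact: (@char_poly_block _ _ D R').
  rewrite char_poly_block.
  congr (_ * _ * _); rewrite /char_poly /char_poly_mx det_mx11 !mxE eqxx //.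
- have -> : A = T *m M *m invmx T by rewrite -AT mulmxK.
  rewrite mxtrace_mulC mulmxA mulVmx // mul1mx.
  have -> : \tr M = \tr D + \tr R' by exact: (@mxtrace_block _ _ _ D 0 0 R').
  by rewrite /D mxtrace_block !mxtrace_scalar.
Qed.

Lemma orthogonal_entry (m : nat) (Q : 'M[R]_m) i j : Q^T *m Q = 1%:M -> `|Q i j| <= 1.
Proof.
move=> /matrixP /(_ j j); rewrite !mxE eqxx /= => h.
suff : `|Q i j| ^+ 2 <= 1 by rewrite expr_le1.
rewrite real_normK ?num_real //.
apply: (@le_trans _ _ (\sum_(l < m) Q^T j l * Q l j)); last by rewrite h.
rewrite (bigD1 i) //= !mxE -expr2 lerDl.
by apply: sumr_ge0 => l _; rewrite mxE -expr2 sqr_ge0.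
Qed.

Lemma orthogonal_trace (m : nat) (Q : 'M[R]_m) : Q^T *m Q = 1%:M -> `|\tr Q| <= m%:R.
Proof.
move=> h; apply: le_trans (ler_norm_sum _ _ _) _.
rewrite -[X in _ <= X]mulr1 -[X in X%:R](card_ord m) mulr_natl -sumr_const.
by apply: ler_sum => i _; exact: orthogonal_entry.
Qed.

Lemma orthogonal_root (m : nat) (Q : 'M[R]_m) x : Q^T *m Q = 1%:M -> root (char_poly Q) x -> x ^+ 2 = 1.
Proof.
move=> h; rewrite -eigenvalue_root_char => /eigenvalueP [v ev v0].
have QQ : Q *m Q^T = 1%:M by exact: mulmx1C.
have e : x ^+ 2 *: (v *m v^T) = v *m v^T.
  have eT : Q^T *m v^T = x *: v^T by rewrite -trmx_mul ev linearZ.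
  symmetry; transitivity ((v *m Q) *m (Q^T *m v^T)); first by rewrite mulmxA -(mulmxA v) QQ mulmx1.
  by rewrite ev eT -scalemxAl -scalemxAr scalerA.
have nz : v *m v^T != 0.
  apply: contra v0 => /eqP /matrixP /(_ 0 0); rewrite !mxE => /eqP s0.
  apply/eqP/matrixP => i j; rewrite ord1 mxE; move: s0; rewrite psumr_eq0; last first.
    by move=> l _; rewrite mxE -expr2 sqr_ge0.
  by move/allP => /(_ j); rewrite mem_index_enum mxE -expr2 sqrf_eq0 => /(_ isT) /eqP.
apply/eqP; rewrite -subr_eq0; move/eqP: e; rewrite -subr_eq0 -{2}[v *m v^T]scale1r -scalerBl scaler_eq0.
by rewrite (negbTE nz) orbF.
Qed.

(** e^l is the only real root larger than 1, since the orthogonal factor has no real roots except 1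
    and -1. *)
Lemma hyperbolic_char_poly_inj A B l l' u w u' w' : Lor A -> Lor B ->
  hyperbolic A l u w -> hyperbolic B l' u' w' -> char_poly A = char_poly B -> l = l'.
Proof.
move=> LA LB hA hB e.
have [Q [QQ eA _]] := hyperbolic_char_poly LA hA.
have [Q' [_ eB _]] := hyperbolic_char_poly LB hB.
have : root (char_poly A) (expR l') by rewrite e eB rootE !hornerM !hornerXsubC subrr !mul0r.
have l0 := hyperb_gt0 hA; have l'0 := hyperb_gt0 hB.
rewrite eA !rootM !root_XsubC => /orP [/orP [/eqP/expR_inj//|/eqP/expR_inj e']|].
  lra.
move/(orthogonal_root QQ) => /eqP; rewrite sqrf_eq1 => /orP [/eqP|/eqP] h.
  by have := pexpR_gt1 l'0; lra.
by have := expR_gt0 l'; lra.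
Qed.

Lemma hyperbolic_trace A l u w : Lor A -> hyperbolic A l u w ->
  `|\tr A - expR l| <= k.+1%:R.
Proof.
move=> LA hA; have [Q [QQ _ ->]] := hyperbolic_char_poly LA hA.
have l0 := hyperb_gt0 hA; have := orthogonal_trace QQ.
have : expR (- l) < 1 by rewrite expR_lt1; lra.
have := expR_gt0 (- l).
rewrite -addn1 natrD => h1 h2 h3.
have -> : expR l + expR (- l) + \tr Q - expR l = expR (- l) + \tr Q by ring.
move: h3; rewrite !ler_norml => /andP [h3 h4]; apply/andP; split; lra.
Qed.

End CharPoly.

(** * Integral matrices and Minkowski reduction *)

Section Lattice.
Context {R : realType}.

Definition intmx {a b} (M : 'M[R]_(a, b)) := forall i j, M i j \is a Num.int.

Lemma intmxM a b c (M : 'M[R]_(a, b)) (N : 'M[R]_(b, c)) : intmx M -> intmx N -> intmx (M *m N).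
Proof. by move=> hM hN i j; rewrite mxE rpred_sum // => l _; rewrite rpredM. Qed.

Lemma intmxD a b (M N : 'M[R]_(a, b)) : intmx M -> intmx N -> intmx (M + N).
Proof. by move=> hM hN i j; rewrite mxE rpredD. Qed.

Lemma intmxN a b (M : 'M[R]_(a, b)) : intmx M -> intmx (- M).
Proof. by move=> hM i j; rewrite mxE rpredN. Qed.

Lemma intmxZ a b (c : R) (M : 'M[R]_(a, b)) : c \is a Num.int -> intmx M -> intmx (c *: M).
Proof. by move=> hc hM i j; rewrite mxE rpredM. Qed.

Lemma intmx0 a b : intmx (0 : 'M[R]_(a, b)).
Proof. by move=> i j; rewrite mxE. Qed.

Lemma intmx1 a : intmx (1%:M : 'M[R]_a).
Proof. by move=> i j; rewrite mxE; case: eqP. Qed.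

Lemma intmx_tr a b (M : 'M[R]_(a, b)) : intmx M -> intmx M^T.
Proof. by move=> hM i j; rewrite mxE. Qed.

Lemma intmx_col a b (M : 'M[R]_(a, b)) j : intmx M -> intmx (col j M).
Proof. by move=> hM i j'; rewrite mxE. Qed.

Lemma intmx_row_mx a b c (M : 'M[R]_(a, b)) (N : 'M[R]_(a, c)) : intmx M -> intmx N -> intmx (row_mx M N).
Proof. by move=> hM hN i j; rewrite mxE; case: (fintype.split _). Qed.

Lemma intmx_col_mx a b c (M : 'M[R]_(b, a)) (N : 'M[R]_(c, a)) : intmx M -> intmx N -> intmx (col_mx M N).
Proof. by move=> hM hN i j; rewrite mxE; case: (fintype.split _). Qed.

Lemma intmx_block a b c d (M : 'M[R]_(a, c)) N O (P : 'M[R]_(b, d)) :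
  intmx M -> intmx N -> intmx O -> intmx P -> intmx (block_mx M N O P).
Proof. by move=> *; apply: intmx_col_mx; apply: intmx_row_mx. Qed.

Lemma intmx_det a (M : 'M[R]_a) : intmx M -> \det M \is a Num.int.
Proof.
move=> hM; rewrite /determinant rpred_sum // => s _; rewrite rpredM ?rpredX ?rpredN ?rpred1 //.
by rewrite rpred_prod.
Qed.

Lemma intmx_map a b (M : 'M[int]_(a, b)) : intmx (map_mx intr M : 'M[R]_(a, b)).
Proof. by move=> i j; rewrite mxE intr_int. Qed.

Definition GLZ {d} (b : 'M[R]_d) := intmx b /\ exists2 b', intmx b' & b *m b' = 1%:M.

Lemma GLZ1 d : GLZ (1%:M : 'M[R]_d).
Proof. by split; [exact: intmx1|exists 1%:M; [exact: intmx1|rewrite mulmx1]]. Qed.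

Lemma GLZ_mul d (b c : 'M[R]_d) : GLZ b -> GLZ c -> GLZ (b *m c).
Proof.
move=> [hb [b' hb' bb]] [hc [c' hc' cc]]; split; first exact: intmxM.
exists (c' *m b'); first exact: intmxM.
by rewrite mulmxA -(mulmxA b) cc mulmx1.
Qed.

Lemma GLZ_unit d (b : 'M[R]_d) : GLZ b -> b \in unitmx.
Proof. by case=> _ [b' _ /mulmx1_unit[]]. Qed.

Lemma GLZ_inv d (b : 'M[R]_d) : GLZ b -> GLZ (invmx b).
Proof.
move=> h; have u := GLZ_unit h; case: h => hb [b' hb' bb].
have <- : b' = invmx b by rewrite -[b']mul1mx -(mulVmx u) -mulmxA bb mulmx1.
by split=> //; exists b => //; apply: mulmx1C.
Qed.

Lemma int_unit_sign (x y : R) : x \is a Num.int -> y \is a Num.int -> x * y = 1 -> x = 1 \/ x = -1.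
Proof.
move=> /intrP [i ->] /intrP [j ->].
rewrite -intrM -[1 in RHS]/(1%:~R) => /intr_inj h.
have := congr1 absz h; rewrite abszM => /eqP; rewrite muln_eq1 => /andP [/eqP hi _].
have [->|->] : i = 1 \/ i = -1 by lia.
  by left.
by right.
Qed.

Lemma GLZ_det d (b : 'M[R]_d) : GLZ b -> \det b = 1 \/ \det b = -1.
Proof.
case=> /intmx_det hb [b' /intmx_det hb' /(congr1 determinant)]; rewrite det_mulmx det1.
exact: int_unit_sign.
Qed.

Lemma GLZ_det2 d (b : 'M[R]_d) : GLZ b -> \det b ^+ 2 = 1.
Proof. by case/GLZ_det => ->; rewrite ?sqrrN expr1n. Qed.

Lemma GLZ_block p q (b : 'M[R]_p) (c : 'M[R]_q) r : GLZ b -> GLZ c -> intmx r -> GLZ (block_mx b r 0 c).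
Proof.
move=> [hb [b' hb' bb]] [hc [c' hc' cc]] hr; split; first by apply: intmx_block => //; exact: intmx0.
exists (block_mx b' (- (b' *m r *m c')) 0 c').
  apply: intmx_block => //; try exact: intmx0.
  by apply/intmxN/intmxM => //; exact: intmxM.
rewrite mulmx_block !mul0mx !mulmx0 !addr0 !add0r bb cc.
by rewrite mulmxN !mulmxA bb mul1mx addNr -scalar_mx_block.
Qed.

(** The Smith normal form of a single column: v is a multiple of a primitive vector, and a primitive
    vector belongs to a basis of Z^(d+1). *)
Lemma extend_basis d (v : 'cV[R]_d.+1) : intmx v -> exists g c,
  [/\ GLZ g, c \is a Num.int & v = c *: col 0 g].
Proof.
move=> hv; pose M : 'M[int]_(d.+1, 1) := map_mx Num.floor v.
have vM : v = map_mx intr M.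
  by apply/matrixP => i j; rewrite !mxE floorK.
have [L uL [S uS [s _ e]]] := int_Smith_normal_form M.
exists (map_mx intr L), ((s`_0 * S 0 0)%:~R); split.
- split; first exact: intmx_map.
  exists (map_mx intr (invmx L)); first exact: intmx_map.
  by rewrite -map_mxM mulmxV // map_mx1.
- exact: intr_int.
- rewrite vM e; apply/matrixP => i j; rewrite ord1 !mxE big_ord1 !mxE (bigD1 0) //= !mxE mulr1n.
  rewrite big1 ?addr0; first by rewrite -intrM; congr (_%:~R); ring.
  by move=> l l0; rewrite !mxE /= (_ : (l : nat) == 0%N = false) ?mulr0n ?mulr0 //; exact/negbTE.
Qed.

Definition qf {d} (F : 'M[R]_d) (v : 'cV[R]_d) : R := (v^T *m F *m v) 0 0.

Lemma qfZ d (F : 'M[R]_d) c v : qf F (c *: v) = c ^+ 2 * qf F v.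
Proof. by rewrite /qf [(c *: v)^T]linearZ /= -!scalemxAl -scalemxAr !mxE; ring. Qed.

Lemma qf_conj d (F g : 'M[R]_d) v : qf (g^T *m F *m g) v = qf F (g *m v).
Proof. by rewrite /qf trmx_mul !mulmxA. Qed.

(** A nearly least element serves in place of a minimum. The loss 9/8 is harmless in the reduction
    below: c^2 <= 9/8 < 2 still makes the chosen vector primitive, and 8/9 - 1/4 > 1/2 still bounds
    the projected form from below. *)
Lemma near_min (S : set R) (e : R) : 0 < e -> (exists x, S x) -> (forall x, S x -> e <= x) ->
  exists2 x, S x & forall y, S y -> x <= 9 / 8 * y.
Proof.
move=> e0 ex lb; have hi : has_inf S by split=> //; exists e.
have i0 : e <= inf S by apply: lb_le_inf => //; exact: ex.
have d0 : 0 < inf S / 8 by rewrite divr_gt0 //; lra.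
have [x Sx xi] := inf_adherent d0 hi.
exists x => // y Sy; have : inf S <= y by apply: ge_inf => //; case: hi.
lra.
Qed.

Definition rnd (x : R) : R := - (Num.floor (x + 2^-1))%:~R.

Lemma rnd_int x : rnd x \is a Num.int.
Proof. by rewrite rpredN intr_int. Qed.

Lemma rnd_near x : (rnd x + x) ^+ 2 <= 4^-1.
Proof.
have /andP [h1 h2] := floor_itv (x + 2^-1); rewrite intrD in h2.
suff : `|rnd x + x| ^+ 2 <= 2^-1 ^+ 2 by rewrite real_normK ?num_real //; lra.
apply: lerXn2r; rewrite ?nnegrE //; rewrite ler_norml /rnd; apply/andP; split; lra.
Qed.

Lemma qf_delta d (F : 'M[R]_d) i : qf F (delta_mx i 0) = F i i.
Proof. by rewrite /qf trmx_delta -rowE -colE !mxE. Qed.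

Lemma schur d (m : R) (a : 'cV[R]_d) (F : 'M[R]_d) (s : R) (y : 'cV[R]_d) : m != 0 ->
  qf (block_mx m%:M a^T a F : 'M[R]_(1 + d)) (col_mx s%:M y) =
  m * (s + (a^T *m y) 0 0 / m) ^+ 2 + qf (F - m^-1 *: (a *m a^T)) y.
Proof.
move=> m0; rewrite /qf tr_col_mx mul_row_block mul_row_col tr_scalar_mx.
set t := (a^T *m y) 0 0.
have aty : a^T *m y = t%:M by rewrite [LHS]mx11_scalar.
have yta : y^T *m a = t%:M by apply: trmx_inj; rewrite trmx_mul trmxK aty tr_scalar_mx.
rewrite !mulmxDl yta -!scalar_mxM -(mulmxA _ a^T) aty -!scalar_mxM.
have -> : y^T *m (F - m^-1 *: (a *m a^T)) *m y = y^T *m F *m y - (m^-1 * (t * t))%:M.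
  rewrite mulmxBr mulmxBl -scalemxAr -scalemxAl; congr (_ - _).
  by rewrite mulmxA yta -mulmxA aty -scalar_mxM scale_scalar_mx.
by rewrite !mxE /= !mulr1n; field.
Qed.

(** Induction on the dimension. Split off a nearly shortest vector u, with value m, and pass to the
    form [Fb] on the quotient by u. Rounding the coefficient of u lifts any y at an extra cost of at
    most m / 4; so [Fb] has minimum at least m / 2, its determinant is det F / m, and a reduced
    basis for it lifts to one for F. *)
Lemma minkowski_reduction d (e D : R) : 0 < e -> exists C, 0 <= C /\
  forall F : 'M[R]_d, F^T = F -> (forall x, 0 <= qf F x) -> \det F <= D ->
    (forall v, intmx v -> v != 0 -> e <= qf F v) ->
    exists b, GLZ b /\ forall j, qf F (col j b) <= C.
Proof.
elim: d e D => [|d IH] e D e0.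
  by exists 0; split=> // F _ _ _ _; exists 1%:M; split; [exact: GLZ1|case].
have e20 : 0 < e / 2 by rewrite divr_gt0.
have [C' [C'0 hC']] := IH (e / 2) (Num.max 0 D / e) e20.
pose D0 := Num.max 0 D; have D00 : 0 <= D0 by rewrite /D0 le_max lexx.
exists (D0 + 3 * C'); split; first by lra.
move=> F Fs Fp Fd Fm.
have [_ [v [hv v0 <-]] vmin] : exists2 x, [set qf F v | v in [set v | intmx v /\ v != 0]] x &
    forall y, [set qf F v | v in [set v | intmx v /\ v != 0]] y -> x <= 9 / 8 * y.
  apply: (near_min e0).
    exists (qf F (delta_mx 0 0)); exists (delta_mx 0 0) => //; split.
      by move=> i j; rewrite mxE; case: andP.
    by apply/eqP => /matrixP /(_ 0 0); rewrite !mxE !eqxx => /eqP; rewrite oner_eq0.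
  by move=> _ [w [hw w0] <-]; exact: Fm.
have [g [c [hg hc vE]]] := extend_basis hv.
have gu := GLZ_unit hg.
set u := col 0 g in vE.
have hu : intmx u by apply: intmx_col; case: hg.
have u0 : u != 0 by apply: contra v0 => /eqP e1; rewrite vE e1 scaler0.
have c0 : c != 0 by apply: contra v0 => /eqP e1; rewrite vE e1 scale0r.
pose m := qf F u.
have em : e <= m by exact: Fm.
have m0 : 0 < m by lra.
have c2 : c ^+ 2 < 2.
  have := vmin m (ex_intro2 _ _ u (conj hu u0) erefl); rewrite vE qfZ -/m => h.
  rewrite -(ltr_pM2r m0); lra.
have c1 : 1 <= c ^+ 2.
  have : 1 <= `|c| by exact: norm_intr_ge1.
  by move=> h; rewrite -real_normK ?num_real // exprn_ege1.
have mmin w : intmx w -> w != 0 -> m <= 9 / 8 * qf F w.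
  move=> hw w0; have := vmin _ (ex_intro2 _ _ w (conj hw w0) erefl); rewrite vE qfZ -/m => h.
  nra.
have [F' F'def] : exists F' : 'M[R]_(1 + d), F' = g^T *m F *m g by exists (g^T *m F *m g).
have F's : F'^T = F' by rewrite F'def !trmx_mul trmxK Fs mulmxA.
pose a := dlsubmx F'; pose F22 := drsubmx F'.
have F'E : F' = block_mx m%:M a^T a F22.
  rewrite -[LHS]submxK; congr block_mx => //.
    rewrite [LHS]mx11_scalar; congr (_%:M).
    have -> : m = qf F' (delta_mx 0 0) by rewrite F'def qf_conj -colE.
    rewrite qf_delta !mxE; congr (F' _ _); exact/val_inj.
  by rewrite /a trmx_dlsub F's.
pose Fb := F22 - m^-1 *: (a *m a^T).
have F22s : F22^T = F22 by rewrite /F22 trmx_drsub F's.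
have Fbs : Fb^T = Fb by rewrite /Fb linearB linearZ /= trmx_mul trmxK F22s.
have m_n0 : m != 0 by rewrite gt_eqF.
have sch (s : R) (y : 'cV_d) : qf F (g *m (col_mx s%:M y : 'cV_(1 + d))) = m * (s + (a^T *m y) 0 0 / m) ^+ 2 + qf Fb y.
  by rewrite -qf_conj -F'def F'E schur.
have Fbp y : 0 <= qf Fb y.
  have := Fp (g *m (col_mx (- ((a^T *m y) 0 0 / m))%:M y : 'cV_(1 + d))).
  by rewrite sch addNr expr0n mulr0 add0r.
have dF' : \det F' = \det F.
  by rewrite F'def !det_mulmx det_tr mulrC mulrA -expr2 GLZ_det2 // mul1r.
have dFb : \det F = m * \det Fb.
  have e1 : F' = (block_mx 1%:M 0 (m^-1 *: a) 1%:M : 'M[R]_(1 + d)) *m block_mx m%:M a^T 0 Fb.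
    rewrite F'E mulmx_block !mul0mx !mul1mx !addr0 mul_mx_scalar scalerA divff // scale1r.
    by rewrite -scalemxAl /Fb addrC subrK.
  by rewrite -dF' e1 det_mulmx det_lblock det_ublock !det1 !mul1r det_scalar1.
have Fbd : \det Fb <= Num.max 0 D / e.
  have D0F : \det F <= D0 by rewrite /D0 le_max Fd orbT.
  rewrite ler_pdivlMr // -/D0; have [n0|p0] := leP (\det Fb) 0.
    by have := D00; nra.
  by apply: le_trans D0F; rewrite dFb mulrC ler_pM2r.
have shortb (y : 'cV_d) : exists2 s, s \is a Num.int & qf F (g *m (col_mx s%:M y : 'cV_(1 + d))) <= m / 4 + qf Fb y.
  exists (rnd ((a^T *m y) 0 0 / m)); first exact: rnd_int.
  rewrite sch lerD2r; have := rnd_near ((a^T *m y) 0 0 / m); nra.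
have Fbm y : intmx y -> y != 0 -> m / 2 <= qf Fb y.
  move=> hy y0; have [s hs] := shortb y.
  have w0 : g *m (col_mx s%:M y : 'cV_(1 + d)) != 0.
    apply: contra y0 => /eqP /(congr1 (mulmx (invmx g))); rewrite mulKmx // mulmx0 => e1.
    by have : dsubmx (col_mx s%:M y : 'cV_(1 + d)) = 0; [rewrite e1; apply/matrixP => ? ?; rewrite !mxE|rewrite col_mxKd => ->].
  have := mmin _ (intmxM (proj1 hg) _) w0.
  have hi : intmx (col_mx s%:M y : 'cV_(1 + d)).
    by apply: intmx_col_mx => // i j; rewrite !ord1 mxE mulr1n.
  move=> /(_ hi); lra.
have Fbm' y : intmx y -> y != 0 -> e / 2 <= qf Fb y by move=> hy y0; have := Fbm y hy y0; lra.
have [bb [hbb hb]] := hC' Fb Fbs Fbp Fbd Fbm'.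
(* For d = 0 the form is m and its determinant bounds it; otherwise m / 2 is at most the value of
   [Fb] on any vector of its reduced basis. *)
have mD : m <= D0 + 2 * C'.
  have [d0|d0] := posnP d.
    have : \det Fb = 1.
      by move: (Fb); rewrite d0 => M; rewrite det_mx00.
    by move=> e1; have : \det F <= D0; [rewrite /D0 le_max Fd orbT|rewrite dFb e1; lra].
  have nz : col (Ordinal d0) bb != 0.
    apply/eqP => e1; have := GLZ_unit hbb; rewrite unitmxE unitfE => /eqP; apply.
    rewrite -det_tr (expand_det_row _ (Ordinal d0)) big1 // => j _; rewrite mxE.
    by move/matrixP: e1 => /(_ j 0); rewrite !mxE => ->; rewrite mul0r.
  have := Fbm _ (intmx_col (Ordinal d0) (proj1 hbb)) nz.
  by have := hb (Ordinal d0); lra.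
pose r : 'rV[R]_d := \row_j rnd ((a^T *m col j bb) 0 0 / m).
exists (g *m (block_mx 1%:M r 0 bb : 'M[R]_(1 + d))); split.
  apply: GLZ_mul => //; apply: (@GLZ_block 1 d); first exact: GLZ1.
    exact: hbb.
  by move=> i j; rewrite mxE rnd_int.
move=> j; rewrite colE -mulmxA -colE.
case: (@split_ordP 1 d j) => j' ->.
  have -> : col (lshift d j') (block_mx 1%:M r 0 bb) = col_mx 1%:M 0.
    by rewrite block_mxEh colKl ord1 col_col_mx col0 -[col 0 _]mulmx1; congr (col_mx _ _); rewrite mulmx1; apply/matrixP => ? ?; rewrite !ord1 !mxE.
  rewrite sch mulmx0 mxE mul0r addr0 expr1n mulr1.
  have -> : qf Fb 0 = 0 by rewrite /qf mulmx0 mxE.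
  by lra.
have -> : col (rshift 1 j') (block_mx 1%:M r 0 bb) = col_mx (r 0 j')%:M (col j' bb).
  by rewrite block_mxEh colKr col_col_mx; congr (col_mx _ _); apply/matrixP => ? ?; rewrite !ord1 !mxE mulr1n.
rewrite sch [r 0 j']mxE; have := rnd_near ((a^T *m col j' bb) 0 0 / m); have := hb j'; nra.
Qed.

End Lattice.

(** * The arithmetic lattice and its thick part *)

Section ArithmeticGroups.
Context {R : realType} {n : nat}.
Implicit Types (G H K : set 'M[R]_n.+1) (P A B g : 'M[R]_n.+1).
Local Notation J := (@lorentz_mx R n).
Local Notation o := (@origin R n).

Lemma finite_index_reps K G : K 1%:M -> finite_index K G ->
  exists s : seq 'M[R]_n.+1, (forall r, r \in s -> G r) /\
    forall A, G A -> exists2 r, r \in s & exists2 B, K B & A = r *m B.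
Proof.
move=> K1 /finite_seqP [cs ecs].
pose cos A := [set A *m B | B in K].
have /choice[rep hrep] : forall c, exists r, (exists2 A, G A & cos A = c) -> G r /\ cos r = c.
  move=> c; have [[A GA e]|ne] := pselect (exists2 A, G A & cos A = c); last by exists 1%:M.
  by exists A.
exists [seq rep c | c <- cs]; split.
  move=> r /mapP [c cin ->]; have : [set` cs] c by [].
  by rewrite -ecs => /= -[A GA e]; case: (hrep c) => //; exists A.
move=> A GA; have ccs : cos A \in cs.
  by have : [set` cs] (cos A); [rewrite -ecs; exists A|].
exists (rep (cos A)); first exact: map_f.
have [Gr er] := hrep (cos A) (ex_intro2 _ _ A GA erefl).
have : cos (rep (cos A)) A by rewrite er; exists 1%:M => //; rewrite mulmx1.
by case=> B KB e; exists B.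
Qed.

Lemma rat_denominator a b (M : 'M[rat]_(a, b)) :
  exists2 D : nat, (0 < D)%N & intmx (D%:R *: map_mx ratr M : 'M[R]_(a, b)).
Proof.
exists (\prod_(p : 'I_a * 'I_b) `|denq (M p.1 p.2)|)%N.
  by apply: prodn_gt0 => p; rewrite absz_gt0 denq_eq0.
move=> i j; rewrite !mxE (bigD1 (i, j)) //= natrM mulrAC.
rewrite rpredM ?natr_int //.
have -> : (`|denq (M i j)|%N)%:R = (denq (M i j))%:~R :> R by rewrite pmulrn absz_denq.
by rewrite /ratr mulrC divfK ?intr_int // intr_eq0 denq_eq0.
Qed.

(* D bounds the denominators of G in the frame P, N those of the Lorentz form on
   the lattice Lat P below, and rs represents the cosets of G in SO(q, Z). *)
Record arith G P (D N : nat) (rs : seq 'M[R]_n.+1) : Prop := Arith {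
  ar_grp : is_matrix_group G;
  ar_isom : forall A, G A -> hyp_isom A;
  ar_unit : P \in unitmx;
  ar_D0 : (0 < D)%N;
  ar_N0 : (0 < N)%N;
  ar_int : forall A, G A -> intmx (D%:R *: (P *m A *m invmx P));
  ar_form : forall x y : 'cV[R]_n.+1, intmx (P *m x) -> intmx (P *m y) ->
     N%:R * lorentz x y \is a Num.int;
  ar_rs : forall r, r \in rs -> hyp_isom r;
  ar_red : forall g, hyp_isom g -> GLZ (P *m g *m invmx P) -> \det g = 1 ->
     exists2 r, r \in rs & exists2 h, G h & g = r *m h }.

Lemma frame_lorentz (Q : 'M[rat]_n.+1) P x y : lorentz_frame Q P ->
  lorentz x y = ((P *m x)^T *m map_mx ratr Q *m (P *m y)) 0 0.
Proof. by move=> [_ e]; rewrite /lorentz -e trmx_mul !mulmxA. Qed.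

Lemma integer_isom_of_rat (Q : 'M[rat]_n.+1) P g : lorentz_frame Q P -> hyp_isom g ->
  intmx (P *m g *m invmx P) -> \det g = 1 -> isom_of_rat P (SO_int Q) g.
Proof.
move=> [Pu PQ] hg ig dg; split=> //.
have [B eB iB] : exists2 B : 'M[rat]_n.+1, map_mx ratr B = P *m g *m invmx P & B \is a mxOver Num.int.
  exists (map_mx (fun x : R => (Num.floor x)%:~R) (P *m g *m invmx P)).
    by apply/matrixP => i j; rewrite [LHS]mxE [X in ratr X]mxE ratr_int floorK.
  by apply/mxOverP => i j; rewrite mxE intr_int.
exists B => //; split=> //.
have inj : injective (map_mx (@ratr R) : 'M[rat]_n.+1 -> _).
  by move=> M M' /matrixP e; apply/matrixP => i j; have := e i j; rewrite !mxE => /fmorph_inj.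
split.
  apply: inj; rewrite !map_mxM -map_trmx eB !trmx_mul.
  have -> : map_mx ratr Q = (invmx P)^T *m J *m invmx P.
    by rewrite -PQ !mulmxA -trmx_mul mulmxV // trmx1 mul1mx mulmxK.
  have eP : P^T *m (invmx P)^T = 1%:M by rewrite -trmx_mul mulVmx // trmx1.
  have := hyp_isom_Lor hg; rewrite /Lor => e.
  rewrite -!mulmxA (mulmxA P^T) eP mul1mx (mulmxA (invmx P) P) mulVmx // mul1mx.
  by congr (_ *m _); rewrite !mulmxA e.
apply: (@fmorph_inj _ _ (@ratr R)); rewrite -det_map_mx eB !det_mulmx dg mulr1 rmorph1.
by rewrite -det_mulmx mulmxV // det1.
Qed.

(** Denominators are bounded uniformly because each A in G is one of finitely many rational coset
    representatives times an integral matrix; D is a common denominator of the representatives. *)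
Lemma arith_of_first_type G : classical_arithmetic_first_type G ->
  exists (Q : 'M[rat]_n.+1) P D N rs, [/\ arith G P D N rs, Q^T = Q, lorentz_frame Q P &
    G `<=` isom_of_rat P (SO_rat Q)].
Proof.
case=> -[Ggrp Gisom _ _] [Q [P [Qs frame [fi1 fi2] Grat]]].
have [Pu PQ] := frame.
set H' := isom_of_rat P (SO_int Q) in fi1 fi2.
have H'1 : H' 1%:M.
  apply: integer_isom_of_rat => //; first exact: hyp_isom1.
    by rewrite mulmx1 mulmxV //; exact: intmx1.
  by rewrite det1.
have K1 : (G `&` H') 1%:M by split=> //; case: Ggrp.
have [s1 [s1G hs1]] := finite_index_reps K1 fi1.
have [s2 [s2H hs2]] := finite_index_reps K1 fi2.
have [D D0 hD] : exists2 D : nat, (0 < D)%N & forall r, r \in s1 -> intmx (D%:R *: (P *m r *m invmx P)).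
  elim: s1 s1G {hs1} => [_|r s IH hG]; first by exists 1%N.
  have [|D D0 hD] := IH; first by move=> q qs; apply: hG; rewrite inE qs orbT.
  have [_ [B _ eB]] := Grat _ (hG r (mem_head _ _)).
  have [D' D'0 hD'] := rat_denominator B.
  exists (D * D')%N; first by rewrite muln_gt0 D0.
  move=> q; rewrite inE natrM => /orP [/eqP ->|qs].
    by rewrite -scalerA -eB; apply: intmxZ => //; rewrite natr_int.
  by rewrite mulrC -scalerA; apply: intmxZ; [rewrite natr_int|exact: hD].
have [N N0 hN] := rat_denominator Q.
exists Q, P, D, N, s2; split=> //; split=> //.
- move=> A GA; have [r rs [B [GB [_ [B0 [_ B0i] eB]]] ->]] := hs1 _ GA.
  have -> : P *m (r *m B) *m invmx P = (P *m r *m invmx P) *m (P *m B *m invmx P).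
    by rewrite !mulmxA mulmxKV.
  rewrite scalemxAl; apply: intmxM; first exact: hD.
  rewrite -eB => i j; rewrite mxE.
  by move/mxOverP: B0i => /(_ i j) /intrP [z ->]; rewrite ratr_int intr_int.
- move=> x y hx hy; rewrite (frame_lorentz x y frame).
  have := intmxM (intmxM (intmx_tr hx) hN) hy => /(_ 0 0).
  by rewrite -scalemxAr -scalemxAl mxE.
- by move=> r /s2H [].
- move=> g hg [ig _] dg; have Hg : H' g by exact: integer_isom_of_rat.
  by have [r rs [B [GB _] e]] := hs2 _ Hg; exists r => //; exists B.
Qed.

Section Facts.
Context {G : set 'M[R]_n.+1} {P : 'M[R]_n.+1} {D N : nat} {rs : seq 'M[R]_n.+1}.
Hypothesis ar : arith G P D N rs.

Let Pu := ar_unit ar.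

Lemma ar_1 : G 1%:M. Proof. by case: (ar_grp ar). Qed.
Lemma ar_mul A B : G A -> G B -> G (A *m B). Proof. by case: (ar_grp ar) => _ h _; exact: h. Qed.
Lemma ar_inv A : G A -> G (invmx A). Proof. by case: (ar_grp ar) => _ _ h /h []. Qed.
Lemma ar_u A : G A -> A \in unitmx. Proof. by case: (ar_grp ar) => _ _ h /h []. Qed.
Lemma ar_conj A B : G A -> G B -> G (A *m B *m invmx A).
Proof. by move=> hA hB; apply/ar_mul/ar_inv => //; exact: ar_mul. Qed.
Lemma ar_exp A k : G A -> G (A ^+ k).
Proof. by move=> h; elim: k => [|k IH]; [exact: ar_1|rewrite exprS; exact: ar_mul]. Qed.

(** The j-th column is the image of a unit vector at o, hence of majorant 1 at A o; [qx_change] back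
    to o costs 4 A_nn^2. *)
Lemma isom_entry A i j : hyp_isom A -> `|A i j| <= 2 * A ord_max ord_max.
Proof.
move=> hA; have a1 := hyp_isom_nn hA; have LA := hyp_isom_Lor hA.
pose x := invmx A *m o; have hx : hyp_space x by apply: (proj2 (hyp_isom_inv hA)); exact: origin_hyp.
have h := qx_change (A *m delta_mx j 0) origin_hyp (proj2 hA _ origin_hyp).
rewrite qx_isom // in h; last exact: origin_hyp.
rewrite !qx_origin lorentz_origin ht_mul_origin sqrrN in h.
have e1 : nrm2 (delta_mx j 0 : 'cV[R]_n.+1) = 1.
  rewrite /nrm2 (bigD1 j) //= mxE !eqxx expr1n big1 ?addr0 // => l ne.
  by rewrite mxE (negbTE ne) expr0n.
rewrite e1 mulr1 in h.
have h2 : A i j ^+ 2 <= 4 * A ord_max ord_max ^+ 2.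
  by apply: le_trans h; have := nrm2_coord (A *m delta_mx j 0) i; rewrite -colE mxE.
suff : `|A i j| ^+ 2 <= (2 * A ord_max ord_max) ^+ 2.
  by rewrite ler_pXn2r // nnegrE // mulr_ge0 //; lra.
by rewrite real_normK ?num_real // exprMn expr2; lra.
Qed.

(** Discreteness in arithmetic form: D P A P^-1 is integral with bounded entries. *)
Lemma ball_finite (Y : R) : exists m, at_most [set A | G A /\ A ord_max ord_max <= Y] m.
Proof.
have bd (M : 'M[R]_n.+1) : exists C, forall i j, `|M i j| <= C.
  exists (\sum_i \sum_j `|M i j|) => i j.
  by rewrite (bigD1 i) //= (bigD1 j) //= -addrA lerDl addr_ge0 // sumr_ge0 // => *; exact: sumr_ge0.
have [C hC] := bd P; have [C' hC'] := bd (invmx P).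
pose B := D%:R * \sum_(j < n.+1) \sum_(l < n.+1) C * (2 * Y) * C'.
have [N' hN'] : exists N' : nat, B <= N'%:R.
  by exists (Num.truncn B).+1; apply/ltW/truncnS_gt.
exists ((N'.*2.+1) ^ (n.+1 * n.+1))%N.
have := @at_most_int_mx R n.+1 n.+1 N'.
apply: (@at_most_inj _ _ (fun A => D%:R *: (P *m A *m invmx P))).
  move=> A [GA AY]; split; first by apply/mxOverP; exact: (ar_int ar GA).
  move=> i j; apply: le_trans hN'; rewrite mxE normrM ger0_norm // /B ler_wpM2l //.
  rewrite mxE; apply: le_trans (ler_norm_sum _ _ _) _; apply: ler_sum => l _.
  rewrite normrM [(P *m A) i l]mxE.
  apply: le_trans (_ : (\sum_(l' < n.+1) `|P i l' * A l' l|) * `|invmx P l j| <= _).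
    by rewrite ler_wpM2r //; exact: ler_norm_sum.
  rewrite mulr_suml.
  apply: ler_sum => l' _; apply: ler_pM; [exact: normr_ge0|exact: normr_ge0| |exact: hC'].
  rewrite normrM; apply: ler_pM; [exact: normr_ge0|exact: normr_ge0|exact: hC|].
  by apply: le_trans (isom_entry _ _ (ar_isom ar GA)) _; rewrite ler_wpM2l.
move=> A A' _ _ /(scalerI _) e.
have : P *m A *m invmx P = P *m A' *m invmx P by apply: e; rewrite pnatr_eq0 -lt0n (ar_D0 ar).
by move/(can_inj (mulmxK (_ : invmx P \in unitmx))); rewrite unitmx_inv => /(_ Pu) /(can_inj (mulKmx Pu)).
Qed.

Definition Lat (y : 'cV[R]_n.+1) := intmx (P *m y).

Definition thick (e : R) (x : 'cV[R]_n.+1) := forall y, Lat y -> y != 0 -> e <= qx x y.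

Lemma invmx_mulE A B : A \in unitmx -> B \in unitmx -> invmx (A *m B) = invmx B *m invmx A.
Proof.
move=> uA uB; have u : A *m B \in unitmx by rewrite unitmx_mul uA.
by apply: (can_inj (mulKmx u)); rewrite mulmxV // mulmxA mulmxK // mulmxV.
Qed.

Lemma gram_Lor A B : B \in unitmx -> A^T *m J *m A = B^T *m J *m B -> Lor (A *m invmx B).
Proof.
move=> uB e; rewrite /Lor trmx_mul -!mulmxA (mulmxA J) (mulmxA A^T) (mulmxA A^T) e.
by rewrite -!mulmxA mulmxV // mulmx1 mulmxA -trmx_mul mulmxV // trmx1 mul1mx.
Qed.

Lemma det_conj A B : B \in unitmx -> \det (B *m A *m invmx B) = \det A.
Proof. by move=> uB; rewrite !det_mulmx mulrAC -det_mulmx mulmxV // det1 mul1r. Qed.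

Lemma gram_entry (m : nat) (W : 'M[R]_(n.+1, m)) i j :
  (W^T *m J *m W) i j = lorentz (col i W) (col j W).
Proof.
rewrite /lorentz !colE trmx_mul trmx_delta -!mulmxA -rowE [RHS]mxE !mulmxA -colE.
by rewrite [RHS]mxE.
Qed.

Lemma nrm2_mul (m : nat) (M : 'M[R]_(n.+1, m)) (a : 'cV[R]_m) :
  nrm2 (M *m a) <= (\sum_j nrm2 (col j M)) * \sum_j a j 0 ^+ 2.
Proof.
rewrite /nrm2 exchange_big /= mulr_suml; apply: ler_sum => i _.
rewrite mxE; apply: le_trans (sum_CauchySchwarz _ _) _.
rewrite ler_wpM2r ?sumr_ge0 // => [j _|]; first by rewrite sqr_ge0.
by apply: ler_sum => j _; rewrite mxE.
Qed.

(* Mahler's criterion: in a Minkowski reduced basis for the form qx x, the Gram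
   matrix of N <., .> is integral and bounded, which leaves finitely many bases
   up to isometry. *)
Lemma thick_cocompact (e : R) : odd n -> 0 < e -> exists C, 0 < C /\
  forall x, hyp_space x -> thick e x -> exists2 h, G h & - lorentz o (h *m x) <= C.
Proof.
move=> odn e0.
pose Pi := invmx P.
have [C1 [C10 hC1]] := minkowski_reduction (n.+1) (\det Pi ^+ 2) e0.
pose Gm (b : 'M[R]_n.+1) := N%:R *: ((Pi *m b)^T *m J *m (Pi *m b)).
(* One reference basis for each pair of Gram matrix and determinant. A basis reduced at x is then
   isometric to its reference basis, and the isometry g comes from GL(Z). *)
have /choice[ref hr] : forall k : 'M[R]_n.+1 * R, exists b0, (exists b, [/\ GLZ b, Gm b = k.1 & \det b = k.2]) ->
    [/\ GLZ b0, Gm b0 = k.1 & \det b0 = k.2].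
  move=> k; have [[b hb]|nb] := pselect (exists b, [/\ GLZ b, Gm b = k.1 & \det b = k.2]); last by exists 1%:M.
  by exists b.
have [N' hN'] : exists N' : nat, N%:R * C1 <= N'%:R.
  by exists (Num.truncn (N%:R * C1)).+1; apply/ltW/truncnS_gt.
pose keys := [set k : 'M[R]_n.+1 * R | (k.1 \is a mxOver Num.int /\ forall i j, `|k.1 i j| <= N'%:R) /\ (k.2 = 1 \/ k.2 = -1)].
have [mk hk] : exists m, at_most keys m.
  exists ((N'.*2.+1 ^ (n.+1 * n.+1)) * 2)%N.
  apply: (@at_most_fibers _ _ (fun k => k.1) _ _ 2 _ _ (at_most_int_mx (n.+1) (n.+1) N')); first by move=> k [].
  move=> M _; apply: (@at_most_inj _ _ (fun k => k.2) _ ([set 1] `|` [set -1])).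
    by move=> k [[_ [->|->]] _]; [left|right].
  by move=> [k1 k2] [k1' k2'] [_ /= <-] [_ /= <-] /= ->.
  exact: at_mostU (at_most1 _) (at_most1 _).
have [B1 [B10 hB1]] := at_most_bounded (fun k => nrm2 (invmx (ref k) *m (P *m o))) hk.
have [B2 [B20 hB2]] : exists B2 : R, 0 < B2 /\ forall r, r \in rs -> r ord_max ord_max <= B2.
  by have [B2 [B20 h]] := at_most_bounded (fun r : 'M[R]_n.+1 => r ord_max ord_max) (at_most_seq rs); exists B2.
have d0 : (n.+1)%:R * C1 * B1 + 1 > 0 :> R by rewrite ltr_wpDl // !mulr_ge0 // ltW.
exists (2 * B2 * ((n.+1)%:R * C1 * B1 + 1)); split; first by rewrite !mulr_gt0.
move=> x hx thx.
have TT := Tx_sq hx; have LT := Tx_Lor hx.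
pose F := (Tx x *m Pi)^T *m (Tx x *m Pi).
have nE z : nrm2 z = (z^T *m z) 0 0 by rewrite mxE; apply: eq_bigr => i _; rewrite mxE expr2.
have qE v : qf F v = qx x (Pi *m v).
  by rewrite /qf /F /qx nE !trmx_mul !mulmxA.
have [b [hb bC1]] : exists b, GLZ b /\ forall j, qf F (col j b) <= C1.
  apply: hC1.
  - by rewrite /F trmx_mul trmxK.
  - by move=> v; rewrite qE qx_ge0.
  (* The determinant of the majorant does not depend on x, as [Tx x] is an involution. *)
  - rewrite /F det_mulmx det_tr !det_mulmx.
    have : \det (Tx x) * \det (Tx x) = 1 by rewrite -det_mulmx TT det1.
    by move=> e1; rewrite mulrACA e1 mul1r expr2.
  - move=> v hv v0; rewrite qE; apply: thx; first by rewrite /Lat mulKVmx.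
    by apply: contra v0 => /eqP /(congr1 (mulmx P)); rewrite mulKVmx // mulmx0 => ->.
have bu := GLZ_unit hb.
have Gk : keys (Gm b, \det b).
  split; last exact: GLZ_det.
  have ent i j : Gm b i j = N%:R * lorentz (Pi *m col i b) (Pi *m col j b).
    by rewrite mxE gram_entry !colE !mulmxA.
  split.
    apply/mxOverP => i j; rewrite ent; apply: (ar_form ar); rewrite mulKVmx //; apply: intmx_col; exact: (proj1 hb).
  move=> i j; apply: le_trans hN'; rewrite ent normrM ger0_norm // ler_wpM2l //.
  suff : `|lorentz (Pi *m col i b) (Pi *m col j b)| ^+ 2 <= C1 ^+ 2 by rewrite ler_pXn2r // nnegrE.
  rewrite real_normK ?num_real //; apply: le_trans (lorentz_le_qx _ _ hx) _.
  by rewrite expr2 -!qE; apply: ler_pM => //; rewrite qE qx_ge0.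
have [rb eG ed] : [/\ GLZ (ref (Gm b, \det b)), Gm (ref (Gm b, \det b)) = Gm b & \det (ref (Gm b, \det b)) = \det b].
  by apply: (hr (Gm b, \det b)); exists b.
have Bb := hB1 _ Gk; set b0 := ref _ in rb eG ed Bb.
have b0u := GLZ_unit rb.
pose W := Pi *m b; pose W0 := Pi *m b0.
have Piu : Pi \in unitmx by rewrite unitmx_inv.
have Wu : W \in unitmx by rewrite unitmx_mul Piu.
have W0u : W0 \in unitmx by rewrite unitmx_mul Piu.
pose g := W0 *m invmx W.
have Lg : Lor g.
  by apply: gram_Lor => //; apply: (scalerI _ eG); rewrite pnatr_eq0 -lt0n (ar_N0 ar).
have PgP : P *m g *m invmx P = b0 *m invmx b.
  rewrite /g /W0 /W invmx_mulE // invmxK !mulmxA mulmxV // mul1mx mulmxK //.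
have gGL : GLZ (P *m g *m invmx P) by rewrite PgP; apply: GLZ_mul => //; exact: GLZ_inv.
have dg : \det g = 1.
  rewrite -(det_conj g Pu) PgP det_mulmx ed -det_mulmx mulmxV // det1 //.
(* g or -g preserves the upper sheet. As n + 1 is even, the sign leaves the determinant 1, so g' is
   in SO(q, Z) and [ar_red] applies. *)
have [g' [g'h g'GL dg' g'x]] : exists g', [/\ hyp_isom g', GLZ (P *m g' *m invmx P), \det g' = 1 &
    forall y z, qx y (g' *m z) = qx y (g *m z)].
  case: (Lor_sign Lg) => hg; first by exists g.
  exists (- g); split=> //.
  - rewrite mulmxN mulNmx; case: gGL => h1 [h' h2 h3]; split; first exact: intmxN.
    by exists (- h'); [exact: intmxN|rewrite mulNmx mulmxN opprK].
  - by rewrite -scaleN1r detZ dg mulr1 -signr_odd /= odn.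
  - move=> y z; rewrite /qx mulNmx mulmxN /nrm2; apply: eq_bigr => i _; by rewrite mxE sqrrN.
have [r rr [h Gh eg']] := ar_red ar g'h g'GL dg'.
exists h => //.
have hr' := ar_rs ar rr.
pose X := g' *m x; have hX : hyp_space X by apply: (proj2 g'h).
have qX j : qx X (col j W0) <= C1.
  have -> : qx X (col j W0) = qx x (Pi *m col j b); last by rewrite -qE.
  rewrite -(qx_isom _ g'h hx) g'x; congr (qx _ _).
  rewrite [Pi *m col j b](_ : _ = W *m delta_mx j 0); last by rewrite colE mulmxA.
  by rewrite mulmxA mulmxKV // colE.
have oE : o = W0 *m (invmx b0 *m (P *m o)).
  by rewrite /W0 !mulmxA mulmxK // mulVmx // mul1mx.
have oX : lorentz o X <= -1 by apply: hyp_lorentz_le => //; exact: origin_hyp.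
(* The columns of W0 are short at X = g' x, and o is a combination of them with coefficients from a
   finite list. So the majorant 2 <X, o>^2 - 1 of o at X is bounded, which means that X is near
   o. *)
have q1 : qx X o <= (n.+1)%:R * C1 * B1.
  rewrite /qx {1}oE (mulmxA (Tx X)); apply: le_trans (nrm2_mul _ _) _.
  apply: ler_pM => //; try by apply: sumr_ge0 => *; rewrite ?nrm2_ge0 ?sqr_ge0.
  have -> : (n.+1)%:R * C1 = \sum_(j < n.+1) C1 by rewrite sumr_const card_ord mulr_natl.
  apply: ler_sum => j _.
  by have := qX j; rewrite /qx !colE mulmxA.
have q2 : lorentz o X ^+ 2 <= (n.+1)%:R * C1 * B1.
  apply: le_trans q1; rewrite qxE // (proj1 origin_hyp) (lorentzC X); nra.
have q3 : - lorentz o X <= (n.+1)%:R * C1 * B1 + 1.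
  have : 0 <= (n.+1)%:R * C1 * B1 by apply: le_trans q2; rewrite sqr_ge0.
  move: q2; set t := _ * B1 => q2 t0; nra.
have ehx : h *m x = invmx r *m X by rewrite /X eg' -mulmxA mulKmx // hyp_isom_unit.
rewrite ehx -(Lor_lorentz _ _ (hyp_isom_Lor hr')) mulKVmx ?hyp_isom_unit //.
have := hyp_triangle (proj2 hr' _ origin_hyp) origin_hyp hX.
rewrite (lorentzC _ o) lorentz_origin ht_mul_origin => tr.
have ge := hB2 _ rr; have r1 := hyp_isom_nn hr'.
apply: le_trans tr _; rewrite mulrN mulNr -mulrN.
by apply: ler_pM => //; lra.
Qed.

End Facts.
End ArithmeticGroups.
Arguments Lat {R n} P y.
Arguments thick {R n} P e x.

(** * Finiteness of the length spectrum *)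

Section Finiteness.
Context {R : realType} {n : nat}.
Implicit Types (A B g : 'M[R]_n.+1).
Local Notation o := (@origin R n).
Context {G : set 'M[R]_n.+1} {P : 'M[R]_n.+1} {D N : nat} {rs : seq 'M[R]_n.+1}.
Hypothesis ar : arith G P D N rs.

Let Pu := ar_unit ar.

Lemma int_small (x : R) : x \is a Num.int -> `|x| < 1 -> x = 0.
Proof.
move=> hx h; apply/eqP; apply: contraT => x0.
by have := norm_intr_ge1 hx x0; rewrite leNgt h.
Qed.

Lemma D_gt0 : 0 < D%:R :> R. Proof. by rewrite ltr0n (ar_D0 ar). Qed.
Lemma N_gt0 : 0 < N%:R :> R. Proof. by rewrite ltr0n (ar_N0 ar). Qed.

Lemma Lat_act A (y : 'cV[R]_n.+1) : G A -> Lat P y -> Lat P (D%:R *: (A *m y)).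
Proof.
move=> GA hy; rewrite /Lat.
have -> : P *m (D%:R *: (A *m y)) = (D%:R *: (P *m A *m invmx P)) *m (P *m y).
  by rewrite -scalemxAl -scalemxAr !mulmxA mulmxKV.
by apply: intmxM => //; exact: (ar_int ar GA).
Qed.

(* The orbit of y stays in the discrete set D^-1 Lat. *)
Lemma Lat_not_contracted A (y : 'cV[R]_n.+1) (l : R) : G A -> Lat P y -> y != 0 -> 0 < l ->
  A *m y <> expR (- l) *: y.
Proof.
move=> GA hy y0 l0 Ay.
have Aj j : A ^+ j *m y = expR (- (j%:R * l)) *: y.
  elim: j => [|j IH]; first by rewrite mul0r oppr0 expR0 scale1r expr0 mul1mx.
  rewrite exprS -mulmxA IH -scalemxAr Ay scalerA -expRD; congr (expR _ *: _).
  by rewrite -natr1; ring.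
have [i hi] : exists i, (P *m y) i 0 != 0.
  apply/existsP; apply: contraT; rewrite negb_exists => /forallP h.
  have : P *m y = 0 by apply/matrixP => i j; rewrite ord1 [RHS]mxE; have := h i; rewrite negbK => /eqP.
  by move/(congr1 (mulmx (invmx P))); rewrite mulKmx // mulmx0 => e; rewrite e eqxx in y0.
set c := (P *m y) i 0 in hi.
have key j : 1 <= D%:R * (expR (- (j%:R * l)) * `|c|).
  have := Lat_act (ar_exp ar j GA) hy => /(_ i 0).
  rewrite Aj -!scalemxAr 2!mxE -/c => hint.
  have nz : D%:R * (expR (- (j%:R * l)) * c) != 0.
    by rewrite !mulf_neq0 // gt_eqF ?D_gt0 ?expR_gt0.
  have := norm_intr_ge1 hint nz; rewrite !normrM ger0_norm ?ler0n //.
  by rewrite (ger0_norm (expR_ge0 _)).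
pose j := (Num.truncn (D%:R * `|c| / l)).+1.
have hj : D%:R * `|c| < j%:R * l by rewrite -ltr_pdivrMr //; exact: truncnS_gt.
have := key j; rewrite expRN mulrCA mulrC ler_pdivlMr ?expR_gt0 // mul1r.
rewrite leNgt => /negP; apply.
by apply: lt_trans hj _; apply: lt_le_trans (expR_ge1Dx _); lra.
Qed.

Lemma hyperbolic_inv A l u w : A \in unitmx -> hyperbolic A l u w ->
  (invmx A *m u = expR (- l) *: u) /\ (invmx A *m w = expR l *: w).
Proof.
move=> uA [_ Au Aw _ _ _ _ _]; split.
  by apply: (can_inj (mulKmx uA)); rewrite mulKVmx // -scalemxAr Au scalerA mulrC expRVN scale1r.
by apply: (can_inj (mulKmx uA)); rewrite mulKVmx // -scalemxAr Aw scalerA expRVN scale1r.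
Qed.

Lemma axis_shift A l u w t : hyperbolic A l u w -> A *m axis u w t = axis u w (t + l).
Proof.
move=> [l0 Au Aw _ _ _ _ _]; rewrite /axis mulmxDr -!scalemxAr Au Aw !scalerA -!expRD.
by rewrite opprD.
Qed.

Lemma hyperbolic_axis A l u w t : hyperbolic A l u w -> hyp_space (axis u w t).
Proof. by case=> *; exact: axis_hyp. Qed.

Lemma lorentz_axis A l u w s t : hyperbolic A l u w ->
  lorentz (axis u w s) (axis u w t) = - ch (s - t).
Proof.
case=> _ _ _ uu ww uw _ _.
rewrite /axis !lorentz_lin uu ww uw (lorentzC w) uw /ch opprB !expRD.
by field.
Qed.

(* A very short lattice vector at a point of the axis is isotropic and orthogonal
   to its image under A, hence an eigenvector of A. *)
Lemma hyperbolic_thick (L : R) : 0 <= L -> exists e, 0 < e /\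
  forall A l u w t, G A -> l <= L -> hyperbolic A l u w -> thick P e (axis u w t).
Proof.
(* For vectors below this e the integers N <y, y> and N D <y, A y> are smaller than 1 in absolute
   value, hence 0. The factor e^L arises because A moves x by l <= L, so the majorant of A y at x is
   at most 4 e^(2L) times that of y. *)
move=> L0; pose e := (4 * N%:R * D%:R * expR L)^-1.
have E1 : 1 <= expR L by rewrite -expR0 ler_expR.
have D1 : 1 <= D%:R :> R by rewrite ler1n (ar_D0 ar).
have N1 : 1 <= N%:R :> R by rewrite ler1n (ar_N0 ar).
have e0 : 0 < e by rewrite invr_gt0 !mulr_gt0 ?expR_gt0 //; lra.
have ee : 4 * N%:R * D%:R * expR L * e = 1.
  by rewrite mulfV // gt_eqF // -invr_gt0.
exists e; split=> // A l u w t GA lL hA y hy y0.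
rewrite leNgt; apply/negP => qlt.
set x := axis u w t in qlt; have hx : hyp_space x by exact: hyperbolic_axis hA.
have hAi := ar_isom ar GA; have LA := hyp_isom_Lor hAi.
have q0 := qx_ge0 x y.
have yy : lorentz y y = 0.
  have hint := ar_form ar hy hy.
  have small : `|N%:R * lorentz y y| < 1.
    have : `|lorentz y y| <= qx x y.
      suff : `|lorentz y y| ^+ 2 <= qx x y ^+ 2 by rewrite ler_pXn2r // nnegrE.
      by rewrite real_normK ?num_real // expr2; exact: lorentz_le_qx.
    rewrite normrM ger0_norm ?ler0n // => h.
    have h1 : 1 <= D%:R * expR L by nra.
    have : N%:R * e * 4 <= 1.
      have e1 : 4 * (N%:R * e) * (D%:R * expR L) = 1 by rewrite -[RHS]ee; ring.
      have : 0 < N%:R * e by rewrite mulr_gt0 // N_gt0.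
      by move: e1; move: (N%:R * e) (D%:R * expR L) h1 => p q; nra.
    have : N%:R * `|lorentz y y| <= N%:R * qx x y by rewrite ler_wpM2l.
    have : N%:R * qx x y < N%:R * e by rewrite ltr_pM2l //; lra.
    lra.
  by have /eqP := int_small hint small; rewrite mulf_eq0 gt_eqF ?N_gt0 //= => /eqP.
have yAy : lorentz y (A *m y) = 0.
  have hint := ar_form ar hy (Lat_act GA hy); rewrite lorentzZr in hint.
  have small : `|N%:R * (D%:R * lorentz y (A *m y))| < 1.
    have : `|lorentz y (A *m y)| <= 2 * expR L * qx x y.
      suff : `|lorentz y (A *m y)| ^+ 2 <= (2 * expR L * qx x y) ^+ 2.
        by rewrite ler_pXn2r // nnegrE // !mulr_ge0 // expR_ge0.
      rewrite real_normK ?num_real //; apply: le_trans (lorentz_le_qx _ _ hx) _.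
      have h1 := qx_change (A *m y) hx (proj2 hAi _ hx).
      rewrite qx_isom // (axis_shift _ hA) (lorentz_axis _ _ hA) sqrrN in h1.
      have h2 : ch (t - (t + l)) ^+ 2 <= expR L ^+ 2.
        have c1 := ch_ge1 (t - (t + l)).
        have c2 : ch (t - (t + l)) <= expR L.
          rewrite (_ : t - (t + l) = - l); last by ring.
          rewrite chN; have l0 := hyperb_gt0 hA.
          by apply: le_trans (ch_le_expR (ltW l0)) _; rewrite ler_expR.
        by rewrite ler_pXn2r // nnegrE; lra.
      apply: le_trans (_ : qx x y * (4 * expR L ^+ 2 * qx x y) <= _).
        rewrite ler_wpM2l //; apply: le_trans h1 _; rewrite ler_wpM2r //; lra.
      by rewrite !exprMn; nra.
    rewrite !normrM (ger0_norm (ler0n R N)) (ger0_norm (ler0n R D)) => h.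
    have : N%:R * (D%:R * `|lorentz y (A *m y)|) <= N%:R * (D%:R * (2 * expR L * qx x y)).
      by rewrite !ler_wpM2l.
    have : N%:R * (D%:R * (2 * expR L * qx x y)) <= N%:R * (D%:R * (2 * expR L * e)).
      do 2!apply: ler_wpM2l => //.
      by apply: ler_wpM2l; [rewrite mulr_ge0 // expR_ge0|exact: ltW].
    have : N%:R * (D%:R * (2 * expR L * e)) = (4 * N%:R * D%:R * expR L * e) / 2 by field.
    rewrite ee.
    lra.
  have /eqP := int_small hint small; rewrite !mulf_eq0 gt_eqF ?N_gt0 //= gt_eqF ?D_gt0 //=.
  by move/eqP.
have AA : lorentz (A *m y) (A *m y) = 0 by rewrite Lor_lorentz.
have hy0 : 'ht y != 0 by apply: contra y0 => /eqP h; apply/eqP; exact: isotropic_ht0.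
have Ay : A *m y = ('ht (A *m y) / 'ht y) *: y.
  by rewrite mulrC -scalerA (isotropic_orth yy AA yAy) scalerA mulVf ?scale1r.
have l0 := hyperb_gt0 hA; have uA := hyp_isom_unit hAi.
(* A lattice vector in the direction of an end of the axis is contracted by A or by its inverse,
   contrary to the discreteness of the lattice. *)
case: (hyperbolic_eigen LA hA Ay yy y0) => -[mu [s ys]].
  apply: (Lat_not_contracted (ar_inv ar GA) hy y0 l0).
  have [iu _] := hyperbolic_inv uA hA.
  by rewrite {1}ys -scalemxAr iu scalerA mulrC -scalerA -ys.
by apply: (Lat_not_contracted GA hy y0 l0); rewrite Ay mu.
Qed.

Lemma hyperbolic_conj h A l u w : hyp_isom h -> hyperbolic A l u w ->
  hyperbolic (h *m A *m invmx h) l (h *m u) (h *m w).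
Proof.
move=> hh [l0 Au Aw uu ww uw u0 w0]; have Lh := hyp_isom_Lor hh; have hu := hyp_isom_unit hh.
split=> //; rewrite ?(Lor_lorentz _ _ Lh) //.
- by rewrite -!mulmxA mulKmx // Au scalemxAr.
- by rewrite -!mulmxA mulKmx // Aw scalemxAr.
- by apply: hyp_isom_causal => //; rewrite uu.
- by apply: hyp_isom_causal => //; rewrite ww.
Qed.

(** Points of the axis are thick, so some h in G brings one of them within bounded distance of o.
    The conjugate moves that point by l, hence o by a bounded amount; each factor C comes from one
    leg of this path. *)
Lemma class_bounded (L : R) : odd n -> 0 <= L -> exists C,
  forall A l u w, G A -> l <= L -> hyperbolic A l u w ->
    exists2 h, G h & (h *m A *m invmx h) ord_max ord_max <= C.
Proof.
move=> odn L0; have [e [e0 he]] := hyperbolic_thick L0.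
have [C [C0 hC]] := thick_cocompact ar odn e0.
exists (4 * C * C * expR L) => A l u w GA lL hA.
pose x := axis u w 0; have hx : hyp_space x by exact: hyperbolic_axis hA.
have [h Gh hle] := hC x hx (he _ _ _ _ _ GA lL hA).
exists h => //; have hh := ar_isom ar Gh; have Lh := hyp_isom_Lor hh.
set A' := h *m A *m invmx h.
have hA' : hyp_isom A' by apply: (ar_isom ar); exact: (ar_conj ar).
have LA' := hyp_isom_Lor hA'.
pose y := h *m x; have hy : hyp_space y by exact: (proj2 hh).
have A'y : A' *m y = h *m (A *m x) by rewrite /A' /y -!mulmxA mulKmx // hyp_isom_unit.
have hA'y : hyp_space (A' *m y) by exact: (proj2 hA').
have hA'o : hyp_space (A' *m o) by apply: (proj2 hA'); exact: origin_hyp.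
have yA'y : lorentz y (A' *m y) = - ch l.
  rewrite A'y (Lor_lorentz _ _ Lh) (axis_shift _ hA) (lorentz_axis _ _ hA).
  by rewrite (_ : 0 - (0 + l) = - l) ?chN //; ring.
have t1 := hyp_triangle origin_hyp hy hA'o.
have t2 := hyp_triangle hy hA'y hA'o.
rewrite yA'y (Lor_lorentz _ _ LA') (lorentzC y o) in t2.
rewrite lorentz_origin opprK ht_mul_origin in t1.
have l0 := hyperb_gt0 hA.
have c1 : ch l <= expR L by apply: le_trans (ch_le_expR (ltW l0)) _; rewrite ler_expR.
have oy : lorentz o y <= -1 by apply: hyp_lorentz_le => //; exact: origin_hyp.
have oyC : - lorentz o y <= C by [].
move: oy oyC t1 t2; set a := lorentz o y; set b := lorentz y (A' *m o) => a1 aC t1 t2.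
have cl := ch_ge1 l.
have b2 : - b <= 2 * expR L * C by nra.
have -> : 4 * C * C * expR L = 2 * C * (2 * expR L * C) by ring.
apply: le_trans t1 _.
have -> : 2 * a * b = 2 * (- a) * (- b) by ring.
have b0 : 0 <= - b.
  have : b <= -1 by apply: hyp_lorentz_le.
  by lra.
by apply: ler_pM => //; lra.
Qed.

Lemma homotopy_class_conj h A : G h -> G A ->
  homotopy_class G (h *m A *m invmx h) = homotopy_class G A.
Proof.
move=> Gh GA; have hu := ar_u ar Gh; apply/seteqP; split=> B [g Gg <-].
  exists (g *m h); first exact: (ar_mul ar).
  by rewrite invmx_mulE ?(ar_u ar) // !mulmxA.
exists (g *m invmx h); first by apply: (ar_mul ar) => //; exact: (ar_inv ar).
rewrite invmx_mulE ?unitmx_inv ?(ar_u ar) // invmxK !mulmxA mulmxKV // mulmxKV //.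
Qed.

Lemma homotopy_class_self A : G A -> homotopy_class G A A.
Proof. by move=> _; exists 1%:M; [exact: (ar_1 ar)|rewrite mul1mx invmx1 mulmx1]. Qed.

Lemma classes_finite (L : R) : odd n -> 0 <= L -> exists m,
  at_most [set homotopy_class G A | A in [set A | G A /\ exists l u w, l <= L /\ hyperbolic A l u w]] m.
Proof.
move=> odn L0; have [C hC] := class_bounded odn L0.
have [m hm] := ball_finite ar C; exists m.
apply: at_most_sub (at_most_image (homotopy_class G) hm) => _ [A [GA [l [u [w [lL hA]]]]] <-].
have [h Gh le] := hC _ _ _ _ GA lL hA.
exists (h *m A *m invmx h); last exact: homotopy_class_conj.
by split=> //; exact: (ar_conj ar).
Qed.

Lemma lengths_finite (L : R) : odd n -> 0 <= L -> exists m,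
  at_most [set l : R | l <= L /\ exists A u w, G A /\ hyperbolic A l u w] m.
Proof.
move=> odn L0; have [C hC] := class_bounded odn L0.
have [m hm] := ball_finite ar C; exists m.
have /choice[f hf] : forall l : R, exists A, (l <= L /\ exists A u w, G A /\ hyperbolic A l u w) ->
   [/\ G A, A ord_max ord_max <= C & exists u w, hyperbolic A l u w].
  move=> l; have [[lL [A [u [w [GA hA]]]]]|nl] := pselect (l <= L /\ exists A u w, G A /\ hyperbolic A l u w);
    last by exists 1%:M.
  have [h Gh le] := hC _ _ _ _ GA lL hA.
  exists (h *m A *m invmx h) => _; split=> //; first exact: (ar_conj ar).
  by exists (h *m u), (h *m w); apply: hyperbolic_conj => //; exact: (ar_isom ar).
apply: (@at_most_inj _ _ f _ _ _ _ _ hm) => [l|l l'] /hf [GA le [u [w hA]]]; first by split.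
move=> /hf [GA' _ [u' [w' hA']]] e; rewrite -e in hA'.
exact: (hyperbolic_length_unique (hyp_isom_Lor (ar_isom ar GA)) hA hA').
Qed.

(** Only finitely many lengths are at most 1, so their inverses are bounded. The bound limits the
    exponent of a proper power of given length. *)
Lemma min_length : odd n -> exists lm, 0 < lm /\
  forall A l u w, G A -> hyperbolic A l u w -> lm <= l.
Proof.
move=> odn; have [m hm] := lengths_finite odn (ler01 : 0 <= 1 :> R).
have [C [C0 hC]] := at_most_bounded (fun l : R => l^-1) hm.
exists (Num.min 1 C^-1); split; first by rewrite lt_min ltr01 invr_gt0.
move=> A l u w GA hA; have l0 := hyperb_gt0 hA.
rewrite ge_min; case: (leP 1 l) => //= l1.
have := hC l; rewrite /= => /(_ (conj (ltW l1) _)) h.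
have /h : exists A u w, G A /\ hyperbolic A l u w by exists A, u, w.
by move=> h'; rewrite -[l]invrK lef_pV2 // posrE // invr_gt0.
Qed.

End Finiteness.

(** * Lower bound for the number of lattice points in balls *)

Section LightCone.
Context {R : realType} {k : nat}.
Local Notation n := k.+1.
Implicit Types (x y : 'cV[R]_n.+1).

Definition fr (j : 'I_k) : 'I_k.+2 := widen_ord (leqnSn _) (widen_ord (leqnSn _) j).
Definition pen : 'I_k.+2 := widen_ord (leqnSn _) ord_max.

(** Light-cone coordinates. A point x of the hyperboloid has height 1 / [lm] x in the upper half
    space, and a nonzero isotropic vector represents the boundary point at infinity when its [lm] is
    0. *)
Definition lp x : R := 'ht x + x pen 0.
Definition lm x : R := 'ht x - x pen 0.

Lemma lorentz_lc x y :
  lorentz x y = \sum_j x (fr j) 0 * y (fr j) 0 - (lp x * lm y + lm x * lp y) / 2.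
Proof.
rewrite lorentzE /sdot big_ord_recr /= -/pen /lp /lm.
by under eq_bigr do rewrite -/(fr _); field.
Qed.

Lemma lp_lm x : lp x + lm x = 2 * 'ht x. Proof. by rewrite /lp /lm; ring. Qed.

Lemma nrm2_lc x : nrm2 x = \sum_j x (fr j) 0 ^+ 2 + (lp x ^+ 2 + lm x ^+ 2) / 2.
Proof.
rewrite /nrm2 !big_ord_recr /= -/pen /lp /lm.
by under eq_bigr do rewrite -/(fr _); field.
Qed.

Lemma lorentz_lc_self x : lorentz x x = \sum_j x (fr j) 0 ^+ 2 - lp x * lm x.
Proof.
rewrite lorentz_lc; by under eq_bigr do rewrite -expr2; field.
Qed.

Lemma lmZ a x : lm (a *: x) = a * lm x. Proof. by rewrite /lm !mxE; ring. Qed.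

(* The point of height 1/K over a/K, in the upper half space model. *)
Definition gridpt (K : R) (a : 'I_k -> R) : 'cV[R]_n.+1 :=
  let p := (\sum_j a j ^+ 2 + 1) / K in
  \col_i (if (i < k)%N =P true is ReflectT h then a (Ordinal h)
          else if i == pen then (p - K) / 2 else (p + K) / 2).

Lemma gridpt_fr K a j : gridpt K a (fr j) 0 = a j.
Proof.
rewrite mxE; case: eqP => [h|]; last by rewrite (ltn_ord j).
by congr a; apply/val_inj.
Qed.

Lemma gridpt_pen K a : gridpt K a pen 0 = ((\sum_j a j ^+ 2 + 1) / K - K) / 2.
Proof. by rewrite mxE; case: eqP => [h|_]; [exfalso; move: h; rewrite /= ltnn|rewrite eqxx]. Qed.

Lemma gridpt_ht K a : 'ht (gridpt K a) = ((\sum_j a j ^+ 2 + 1) / K + K) / 2.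
Proof.
rewrite mxE; case: eqP => [h|_]; first by exfalso; move: h; rewrite /= ltnNge leqnSn.
by rewrite -val_eqE /= gtn_eqF.
Qed.

Lemma gridpt_lp K a : lp (gridpt K a) = (\sum_j a j ^+ 2 + 1) / K.
Proof. by rewrite /lp gridpt_ht gridpt_pen; move: (_ / K) => p; field. Qed.

Lemma gridpt_lm K a : lm (gridpt K a) = K.
Proof. by rewrite /lm gridpt_ht gridpt_pen; move: (_ / K) => p; field. Qed.

Lemma lorentz_gridpt K a b : K != 0 ->
  lorentz (gridpt K a) (gridpt K b) = - 1 - (\sum_j (a j - b j) ^+ 2) / 2.
Proof.
move=> K0; rewrite lorentz_lc !gridpt_lp !gridpt_lm.
under eq_bigr do rewrite !gridpt_fr.
have -> : \sum_j (a j - b j) ^+ 2 = \sum_j a j ^+ 2 - 2 * (\sum_j a j * b j) + \sum_j b j ^+ 2.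
  rewrite mulr_sumr -sumrB -big_split /=; apply: eq_bigr => j _; ring.
by field.
Qed.

Lemma gridpt_hyp K a : 0 < K -> hyp_space (gridpt K a).
Proof.
move=> K0; split.
  rewrite lorentz_gridpt ?gt_eqF // big1 ?mul0r ?subr0 // => j _; by rewrite subrr expr0n.
rewrite gridpt_ht divr_gt0 // addr_gt0 // divr_gt0 // ltr_wpDl // sumr_ge0 // => j _.
by rewrite sqr_ge0.
Qed.

(** An isotropic y represents the point with coordinates y_j / [lm] y of the boundary R^k; the
    factor K is the scale of the grid. *)
Definition ctr (K : R) y (j : 'I_k) : R := K * y (fr j) 0 / lm y.

(** The horofunction of a boundary point in the upper half space: at fixed height it depends only on
    the distance from the centre. *)
Lemma lorentz_gridpt_null K a y : K != 0 -> lorentz y y = 0 -> lm y != 0 ->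
  lorentz (gridpt K a) y = - (lm y / (2 * K)) * (\sum_j (a j - ctr K y j) ^+ 2 + 1).
Proof.
move=> K0 yy c0; rewrite lorentz_lc gridpt_lp gridpt_lm.
under eq_bigr do rewrite gridpt_fr.
have -> : \sum_j (a j - ctr K y j) ^+ 2 = \sum_j a j ^+ 2 - 2 * K / lm y * (\sum_j a j * y (fr j) 0) + (K / lm y) ^+ 2 * \sum_j y (fr j) 0 ^+ 2.
  rewrite !mulr_sumr -sumrB -big_split /=; apply: eq_bigr => j _; rewrite /ctr; field.
  exact: c0.
have -> : \sum_j y (fr j) 0 ^+ 2 = lp y * lm y by move: yy; rewrite lorentz_lc_self; lra.
by field; rewrite c0 K0.
Qed.

Lemma ctr_scale K y z : lm y != 0 -> lm z != 0 -> 'ht y != 0 -> 'ht z != 0 -> 'ht z *: y = 'ht y *: z -> ctr K y =1 ctr K z.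
Proof.
move=> y0 z0 hy hz e j; rewrite /ctr.
have e1 : 'ht z * lm y = 'ht y * lm z by rewrite -!lmZ e.
have e2 : 'ht z * y (fr j) 0 = 'ht y * z (fr j) 0.
  by move/matrixP: e => /(_ (fr j) 0); rewrite !mxE.
apply/eqP; rewrite eqr_div //; apply/eqP.
apply: (mulfI hz); apply: (mulfI hy).
transitivity (K * ('ht z * y (fr j) 0) * ('ht y * lm z)); first by ring.
by rewrite e2 -e1; ring.
Qed.

End LightCone.

(** * Thin grid points lie in disjoint horoballs *)

Section Grid.
Context {R : realType} {k : nat}.
Local Notation n := k.+1.
Local Notation o := (@origin R n).
Context {G : set 'M[R]_n.+1} {P : 'M[R]_n.+1} {D N : nat} {rs : seq 'M[R]_n.+1}.
Hypothesis ar : arith G P D N rs.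
Let Pu := ar_unit ar.

Lemma Lat_min : exists ka : R, 0 < ka /\ forall y, Lat P y -> y != 0 -> ka <= nrm2 y.
Proof.
pose S : R := \sum_j nrm2 (col j P); have S0 : 0 <= S by apply: sumr_ge0 => j _; exact: nrm2_ge0.
exists (S + 1)^-1; split; first by rewrite invr_gt0; lra.
move=> y hy y0.
have [i hi] : exists i, (P *m y) i 0 != 0.
  apply/existsP; apply: contraT; rewrite negb_exists => /forallP h.
  have : P *m y = 0 by apply/matrixP => i j; rewrite ord1 [RHS]mxE; have := h i; rewrite negbK => /eqP.
  by move/(congr1 (mulmx (invmx P))); rewrite mulKmx // mulmx0 => e; rewrite e eqxx in y0.
have h1 : 1 <= nrm2 (P *m y).
  apply: le_trans (nrm2_coord _ i); have := norm_intr_ge1 (hy i 0) hi => h.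
  by rewrite -real_normK ?num_real // exprn_ege1.
have h2 := nrm2_mul P y; rewrite -/S -/(nrm2 y) in h2.
rewrite -[X in X <= _]mul1r ler_pdivrMr; last by lra.
have := nrm2_ge0 y; nra.
Qed.

Definition gridR (K : nat) (a : {ffun 'I_k -> 'I_K}) : 'I_k -> R := fun j => (a j : nat)%:R.

Lemma null_cone (y : 'cV[R]_n.+1) : lorentz y y = 0 -> 0 < 'ht y -> 0 <= lm y /\ 0 <= lp y.
Proof.
move=> yy y0; have e : \sum_j y (fr j) 0 ^+ 2 = lp y * lm y by move: yy; rewrite lorentz_lc_self; lra.
have s0 : 0 <= lp y * lm y by rewrite -e; apply: sumr_ge0 => j _; rewrite sqr_ge0.
have := lp_lm y; nra.
Qed.

(** The short vector is isotropic by integrality, and a change of sign makes it future directed. It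
    does not lie over infinity: a vector with [lm] y = 0 is no shorter at a point of height 1 / K
    than at the origin, where its norm is at least ka. *)
Lemma thin_null (ka de : R) (K : nat) (a : {ffun 'I_k -> 'I_K}) :
  (forall y, Lat P y -> y != 0 -> ka <= nrm2 y) -> (0 < K)%N -> 0 < de ->
  2 * de ^+ 2 * N%:R < 1 -> 2 * de ^+ 2 < ka ->
  ~ thick P (2 * de ^+ 2) (gridpt K%:R (gridR a)) ->
  exists y, [/\ Lat P y, lorentz y y = 0, 0 < 'ht y, 0 < lm y &
    lm y / (2 * K%:R) * (\sum_j (gridR a j - ctr K%:R y j) ^+ 2 + 1) < de].
Proof.
move=> hka K0 de0 deN deka.
have KR : 1 <= K%:R :> R by rewrite ler1n.
have K00 : K%:R != 0 :> R by rewrite gt_eqF //; lra.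
set X := gridpt _ _; have hX : hyp_space X by apply: gridpt_hyp; lra.
move/existsNP => [y0 /not_implyP [hy0 /not_implyP [ny0 /negP]]]; rewrite -ltNge => q0.
have yy0 : lorentz y0 y0 = 0.
  have hint := ar_form ar hy0 hy0.
  have small : `|N%:R * lorentz y0 y0| < 1.
    have h : `|lorentz y0 y0| <= qx X y0.
      suff : `|lorentz y0 y0| ^+ 2 <= qx X y0 ^+ 2 by rewrite ler_pXn2r // nnegrE // qx_ge0.
      by rewrite real_normK ?num_real // expr2; exact: lorentz_le_qx.
    rewrite normrM ger0_norm ?ler0n //.
    have : N%:R * `|lorentz y0 y0| <= N%:R * (2 * de ^+ 2) by rewrite ler_wpM2l //; lra.
    lra.
  by have /eqP := int_small hint small; rewrite mulf_eq0 gt_eqF ?(N_gt0 ar) //= => /eqP.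
have [y [hy yy hty ny q]] : exists y, [/\ Lat P y, lorentz y y = 0, 0 < 'ht y, y != 0 & qx X y < 2 * de ^+ 2].
  have : 'ht y0 != 0 by apply: contra ny0 => /eqP h; apply/eqP; exact: isotropic_ht0.
  rewrite neq_lt => /orP [h|h]; last by exists y0.
  exists (- y0); split.
  - by rewrite /Lat mulmxN; exact: intmxN.
  - by rewrite lorentzNl lorentzNr opprK.
  - by rewrite mxE oppr_gt0.
  - by rewrite oppr_eq0.
  - by rewrite qxE // lorentzNl !lorentzNr opprK sqrrN -qxE.
have qE : qx X y = 2 * lorentz X y ^+ 2 by rewrite qxE // yy add0r.
have [lm0 lp0] := null_cone yy hty.
have es : \sum_j y (fr j) 0 ^+ 2 = lp y * lm y by move: yy; rewrite lorentz_lc_self; lra.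
have c0 : 0 < lm y.
  rewrite lt_def lm0 andbT; apply/eqP => c0.
  have z0 j : y (fr j) 0 = 0.
    move/eqP: es; rewrite c0 mulr0 psumr_eq0; last by move=> i _; rewrite sqr_ge0.
    by move/allP => /(_ j); rewrite mem_index_enum sqrf_eq0 => /(_ isT) /eqP.
  have := hka _ hy ny; rewrite nrm2_lc es c0 mulr0 expr0n /= addr0 add0r => h1.
  have : lorentz X y = - (K%:R * lp y / 2).
    rewrite lorentz_lc gridpt_lm c0 mulr0 add0r big1 ?sub0r // => j _.
    by rewrite z0 mulr0.
  move=> e; rewrite qE e sqrrN in q.
  have : lp y ^+ 2 <= (K%:R * lp y) ^+ 2 by rewrite exprMn ler_peMl ?sqr_ge0 // exprn_ege1.
  have : (K%:R * lp y / 2) ^+ 2 = (K%:R * lp y) ^+ 2 / 4 by field.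
  lra.
exists y; split=> //.
have := lorentz_gridpt_null (gridR a) K00 yy (lt0r_neq0 c0); rewrite -/X mulNr.
set s := _ * (_ + 1) => e.
have s0 : 0 < s.
  rewrite /s mulr_gt0 ?divr_gt0 //; first by lra.
  by rewrite ltr_wpDl // sumr_ge0 // => j _; rewrite sqr_ge0.
have : s ^+ 2 < de ^+ 2.
  have -> : s ^+ 2 = lorentz X y ^+ 2 by rewrite e sqrrN.
  by rewrite qE in q; lra.
by rewrite ltr_pXn2r // nnegrE ltW.
Qed.

(** A horoball that contains the grid point although its centre is farther than about K / M must be
    large, so large that its vector y is shorter than ka at the origin. The smallness of de excludes
    this. *)
Lemma horoball_size (ka de M : R) (K : nat) (a : {ffun 'I_k -> 'I_K}) y :
  (forall y, Lat P y -> y != 0 -> ka <= nrm2 y) -> (0 < K)%N -> 0 < de -> 1 <= M ->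
  (de * (4 * M ^+ 2 * k%:R + 4 + 2 * M ^+ 2)) ^+ 2 < ka ->
  Lat P y -> lorentz y y = 0 -> 0 < 'ht y -> 0 < lm y ->
  lm y / (2 * K%:R) * (\sum_j (gridR a j - ctr K%:R y j) ^+ 2 + 1) < de ->
  \sum_j (gridR a j - ctr K%:R y j) ^+ 2 + 1 <= (K%:R / M) ^+ 2.
Proof.
move=> hka K0 de0 M1 dka hy yy hty c0 sd.
have KR : 1 <= K%:R :> R by rewrite ler1n.
set S := \sum_j _ + 1 in sd *; rewrite leNgt; apply/negP => SK.
have M0 : 0 < M by lra.
have S1 : 1 <= S by rewrite /S lerDr sumr_ge0 // => j _; rewrite sqr_ge0.
have cS : lm y * S < 2 * K%:R * de.
  move: sd; rewrite mulrAC ltr_pdivrMr //; [lra|lra].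
have cM : lm y <= 2 * de * M ^+ 2.
  have h1 : lm y * (K%:R / M) ^+ 2 <= lm y * S by rewrite ler_pM2l // ltW.
  have h2 : lm y * K%:R ^+ 2 < 2 * K%:R * de * M ^+ 2.
    rewrite -ltr_pdivrMr ?exprn_gt0 //.
    by apply: le_lt_trans cS; rewrite expr_div_n mulrA in h1.
  have h3 : lm y * K%:R < 2 * de * M ^+ 2.
    rewrite -(@ltr_pM2r _ K%:R); [|lra]; move: h2; rewrite !expr2 => h2; lra.
  have : lm y <= lm y * K%:R by nra.
  lra.
have es : \sum_j y (fr j) 0 ^+ 2 = lp y * lm y by move: yy; rewrite lorentz_lc_self; lra.
have pk : lp y * lm y <= 2 * lm y ^+ 2 / K%:R ^+ 2 * (k%:R * K%:R ^+ 2 + S).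
  rewrite -es.
  have yE j : y (fr j) 0 = lm y / K%:R * ctr K%:R y j.
    by rewrite /ctr; field; rewrite !gt_eqF //; lra.
  have -> : \sum_j y (fr j) 0 ^+ 2 = (lm y / K%:R) ^+ 2 * \sum_j ctr K%:R y j ^+ 2.
    by rewrite mulr_sumr; apply: eq_bigr => j _; rewrite yE exprMn.
  have h1 : \sum_j ctr K%:R y j ^+ 2 <= 2 * (k%:R * K%:R ^+ 2 + S).
    have h2 : \sum_j gridR a j ^+ 2 <= k%:R * K%:R ^+ 2.
      have -> : k%:R * K%:R ^+ 2 = \sum_(j < k) (K%:R : R) ^+ 2 by rewrite sumr_const card_ord mulr_natl.
      by apply: ler_sum => j _; rewrite lerXn2r ?nnegrE ?ler0n // /gridR ler_nat ltnW.
    apply: le_trans (_ : \sum_j 2 * (gridR a j ^+ 2 + (gridR a j - ctr K%:R y j) ^+ 2) <= _).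
      apply: ler_sum => j _; have := sqr_ge0 (2 * gridR a j - ctr K%:R y j); rewrite !expr2; lra.
    by rewrite -mulr_sumr ler_wpM2l // big_split /= /S; lra.
  have -> : 2 * lm y ^+ 2 / K%:R ^+ 2 * (k%:R * K%:R ^+ 2 + S) = (lm y / K%:R) ^+ 2 * (2 * (k%:R * K%:R ^+ 2 + S)).
    by field; rewrite gt_eqF //; lra.
  by rewrite ler_wpM2l // sqr_ge0.
have lpb : lp y <= 4 * M ^+ 2 * k%:R * de + 4 * de.
  have h1 : lp y <= 2 * lm y / K%:R ^+ 2 * (k%:R * K%:R ^+ 2 + S).
    rewrite -(ler_pM2r c0); apply: le_trans pk _; rewrite le_eqVlt; apply/orP; left; apply/eqP.
    by field; rewrite gt_eqF //; lra.
  have h2 : 2 * lm y / K%:R ^+ 2 * (k%:R * K%:R ^+ 2 + S) = 2 * lm y * k%:R + 2 * (lm y * S) / K%:R ^+ 2.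
    by field; rewrite gt_eqF //; lra.
  have h3 : (lm y * S) / K%:R ^+ 2 <= 2 * de.
    rewrite ler_pdivrMr ?exprn_gt0 //; last by lra.
    apply: le_trans (ltW cS) _; rewrite expr2.
    have : 0 <= de * (K%:R * (K%:R - 1)) by rewrite !mulr_ge0 //; lra.
    lra.
  have k0 : 0 <= k%:R :> R by exact: ler0n.
  have : 2 * lm y * k%:R <= 2 * (2 * de * M ^+ 2) * k%:R by nra.
  rewrite h2 -mulrA in h1; lra.
have [_ lp0] := null_cone yy hty.
have ny : y != 0 by apply/eqP => e; move: hty; rewrite e mxE ltxx.
have := hka _ hy ny; rewrite nrm2_lc es => h.
have h1 : lp y + lm y <= de * (4 * M ^+ 2 * k%:R + 4 + 2 * M ^+ 2) by lra.
have h2 : (lp y + lm y) ^+ 2 <= (de * (4 * M ^+ 2 * k%:R + 4 + 2 * M ^+ 2)) ^+ 2.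
  by rewrite lerXn2r // nnegrE; lra.
have : 0 <= lp y ^+ 2 + lm y ^+ 2 by rewrite addr_ge0 ?sqr_ge0.
have : 0 <= lp y * lm y by rewrite mulr_ge0 // ltW.
have : (lp y + lm y) ^+ 2 = lp y ^+ 2 + lm y ^+ 2 + 2 * (lp y * lm y) by ring.
lra.
Qed.

(* A thin grid point lies in a horoball.  Blow it up by the factor 22 about the
   projection of the cusp and fill the gaps with the 22^k nearby grid points: the
   results stay in the horoball, and different horoballs are disjoint. *)
Lemma thin_few : exists e K0, 0 < e /\ forall K, (K0 <= K)%N ->
  forall T : {pred {ffun 'I_k -> 'I_K}},
    (forall a, a \in T -> ~ thick P e (gridpt K%:R (gridR a))) ->
    (#|T| * 22 ^ k <= (10 * K).+1 ^ k)%N.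
Proof.
have [ka [ka0 hka]] := Lat_min.
(* 22 = 2 * 11: the images below lie in a box with (10 K + 1)^k <= (11 K)^k integral points, so the
   thin points are at most the fraction 2^(-k) of the grid. *)
pose M : R := 22; have M1 : 1 <= M by rewrite /M; lra.
pose E : R := 8 * M ^+ 2 * k%:R + 2 * M ^+ 2 + 1.
pose E1 : R := 4 * M ^+ 2 * k%:R + 4 + 2 * M ^+ 2.
have k0 : 0 <= k%:R :> R by exact: ler0n.
have M2 : 0 <= M ^+ 2 by exact: sqr_ge0.
have N0 := N_gt0 ar.
have E0 : 1 <= E by rewrite /E; nra.
(* de is chosen with de^2 Z < min(1, ka); the four summands of Z yield the four smallness conditions
   [c1] to [c4]. *)
pose Z := 2 * N%:R + 2 + E1 ^+ 2 + 2 * N%:R * E ^+ 2.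
have Z0 : 0 < Z by rewrite /Z; have := sqr_ge0 E1; have := sqr_ge0 E; nra.
pose b := Num.min 1 ka; have b0 : 0 < b by rewrite lt_min ltr01.
have b1 : b <= 1 by rewrite ge_min lexx.
have bka : b <= ka by rewrite ge_min lexx orbT.
pose de := b / (Z + 1); have de0 : 0 < de by rewrite divr_gt0 //; lra.
have deZ : de ^+ 2 * Z < b.
  have h1 : de * (Z + 1) = b by rewrite /de divfK // gt_eqF //; lra.
  have de1 : de <= 1 by nra.
  have : de ^+ 2 <= de by rewrite expr2; nra.
  nra.
have sub c : 0 <= c -> c <= Z -> de ^+ 2 * c < b.
  by move=> c0 cZ; apply: le_lt_trans deZ; rewrite ler_wpM2l // sqr_ge0.
have E12 : 0 <= E1 ^+ 2 by exact: sqr_ge0.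
have E22 : 0 <= 2 * N%:R * E ^+ 2 by rewrite mulr_ge0 ?sqr_ge0 // mulr_ge0 // ltW.
have c1 : 2 * de ^+ 2 * N%:R < 1.
  by have := sub (2 * N%:R); rewrite /Z => h; have := h _ _; lra.
have c2 : 2 * de ^+ 2 < ka by have := sub 2; rewrite /Z => h; have := h _ _; lra.
have c3 : (de * E1) ^+ 2 < ka by rewrite exprMn; have := sub (E1 ^+ 2); rewrite /Z => h; have := h _ _; lra.
have c4 : N%:R * (2 * E ^+ 2 * de ^+ 2) < 1.
  by have := sub (2 * N%:R * E ^+ 2) E22; rewrite /Z => h; have := h _; lra.
exists (2 * de ^+ 2), 22; split; first by rewrite mulr_gt0 // exprn_gt0.
move=> K K22 T hT.
have K0 : (0 < K)%N by apply: leq_trans K22.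
have KM : M <= K%:R by rewrite /M ler_nat.
have K00 : K%:R != 0 :> R by rewrite pnatr_eq0 -lt0n.
have KR : 0 < K%:R :> R by rewrite ltr0n.
have M0 : 0 <= M := le_trans ler01 M1.
have E00 : 0 <= E := le_trans ler01 E0.
have /choice[Y hY] : forall a : {ffun 'I_k -> 'I_K}, exists y, a \in T ->
    [/\ Lat P y, lorentz y y = 0, 0 < 'ht y, 0 < lm y &
    lm y / (2 * K%:R) * (\sum_j (gridR a j - ctr K%:R y j) ^+ 2 + 1) < de].
  move=> a; have [aT|] := boolP (a \in T); last by exists 0.
  by have [y hy] := thin_null hka K0 de0 c1 c2 (hT a aT); exists y.
pose t a := ctr K%:R (Y a).
pose f a j : R := (Num.floor (t a j))%:~R.
(* The blow-up is about the integral point below the centre, which keeps the image integral; the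
   digits p.2 < 22 fill the gaps and can be recovered as remainders modulo 22. *)
pose g (p : {ffun 'I_k -> 'I_K} * {ffun 'I_k -> 'I_22}) : 'I_k -> R :=
  fun j => M * (gridR p.1 j - f p.1 j) + f p.1 j + (p.2 j : nat)%:R.
have fb a j : 0 <= t a j - f a j < 1.
  have /andP [h1 h2] := floor_itv (t a j); rewrite intrD in h2; rewrite /f; lra.
have gb p j : `|g p j - t p.1 j| <= M * `|gridR p.1 j - t p.1 j| + 2 * M.
  have -> : g p j - t p.1 j = M * (gridR p.1 j - t p.1 j) + ((M - 1) * (t p.1 j - f p.1 j) + (p.2 j : nat)%:R).
    by rewrite /g; ring.
  apply: le_trans (ler_normD _ _) _; rewrite normrM (ger0_norm (_ : 0 <= M)); last by lra.
  rewrite lerD2l; have /andP [h1 h2] := fb p.1 j.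
  have e22 : (p.2 j : nat)%:R <= M by rewrite /M ler_nat ltnW.
  have e0 : 0 <= (p.2 j : nat)%:R :> R by exact: ler0n.
  rewrite ger0_norm; first by nra.
  by rewrite addr_ge0 // mulr_ge0 //; lra.
have Sb a : a \in T -> \sum_j (gridR a j - t a j) ^+ 2 + 1 <= (K%:R / M) ^+ 2.
  move=> aT; have [y1 y2 y3 y4 y5] := hY a aT.
  exact: (horoball_size hka K0 de0 M1 c3 y1 y2 y3 y4 y5).
have S0 a : 0 <= \sum_j (gridR a j - t a j) ^+ 2 by apply: sumr_ge0 => j _; rewrite sqr_ge0.
have near a j : a \in T -> `|gridR a j - t a j| <= K%:R / M.
  move=> aT; have h := Sb a aT.
  have : (gridR a j - t a j) ^+ 2 <= (K%:R / M) ^+ 2.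
    apply: le_trans h; rewrite (bigD1 j) //= -addrA lerDl addr_ge0 // sumr_ge0 // => i _.
    by rewrite sqr_ge0.
  by rewrite -real_normK ?num_real // ler_pXn2r // nnegrE divr_ge0.
have gN p j : p.1 \in T -> g p j \is a Num.int /\ `|g p j| <= (5 * K)%:R.
  move=> aT; split.
    by rewrite /g /M /f /gridR !rpredD ?rpredM ?rpredB ?natr_int ?intr_int.
  have h1 := near _ j aT; have h2 := gb p j.
  have h3 : `|gridR p.1 j| <= K%:R by rewrite ger0_norm ?ler0n // /gridR ler_nat ltnW.
  have h4 : M * (K%:R / M) = K%:R by rewrite mulrC divfK // gt_eqF // (lt_le_trans ltr01).
  have h5 : K%:R / M <= K%:R by rewrite ler_pdivrMr ?(lt_le_trans ltr01) // ler_peMr // ltW.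
  have h6 : M * `|gridR p.1 j - t p.1 j| <= K%:R by rewrite -[X in _ <= X]h4 ler_wpM2l.
  rewrite natrM; move: h1 h2 h3 h6; rewrite !ler_norml => /andP [x1 x2] /andP [x3 x4] /andP [x5 x6] x7.
  clear -ar Pu KM h5 x1 x2 x3 x4 x5 x6 x7.
  by apply/andP; split; lra.
have horo p : p.1 \in T -> lorentz (gridpt K%:R (g p)) (Y p.1) ^+ 2 <= (E * de) ^+ 2.
  move=> aT; have [y1 y2 y3 y4 y5] := hY p.1 aT.
  rewrite lorentz_gridpt_null ?(gt_eqF y4) // -/(t p.1) mulNr sqrrN.
  set c := lm (Y p.1) / (2 * K%:R) in y5 *.
  have c0 : 0 < c by rewrite divr_gt0 // mulr_gt0.
  have sg : \sum_j (g p j - t p.1 j) ^+ 2 + 1 <= E * (\sum_j (gridR p.1 j - t p.1 j) ^+ 2 + 1).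
    have h1 : \sum_j (g p j - t p.1 j) ^+ 2 <= \sum_j (2 * M ^+ 2 * (gridR p.1 j - t p.1 j) ^+ 2 + 8 * M ^+ 2).
      apply: ler_sum => j _; have h := gb p j.
      have : `|g p j - t p.1 j| ^+ 2 <= (M * `|gridR p.1 j - t p.1 j| + 2 * M) ^+ 2.
        by rewrite lerXn2r ?nnegrE // addr_ge0 ?mulr_ge0.
      rewrite real_normK ?num_real // => h'; apply: le_trans h' _.
      rewrite -[(gridR _ _ - _) ^+ 2]real_normK ?num_real //.
      have h9 := sqr_ge0 (M * `|gridR p.1 j - t p.1 j| - 2 * M).
      by rewrite !expr2 in h9 *; clear -ar Pu h9; lra.
    rewrite big_split /= -mulr_sumr sumr_const card_ord -[_ *+ k]mulr_natr in h1.
    have := S0 p.1; rewrite /E; set s := \sum_j (gridR _ _ - _) ^+ 2 in h1 * => s0.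
    have mk0 : 0 <= M ^+ 2 * k%:R by rewrite mulr_ge0.
    have mk1 : 0 <= M ^+ 2 * k%:R * s by rewrite mulr_ge0.
    have mk2 : 0 <= M ^+ 2 * s by rewrite mulr_ge0.
    by clear -ar Pu h1 s0 mk0 mk1 mk2; lra.
  have s1 : 0 <= \sum_j (g p j - t p.1 j) ^+ 2 by apply: sumr_ge0 => j _; rewrite sqr_ge0.
  rewrite lerXn2r ?nnegrE //; first by rewrite mulr_ge0 // ?addr_ge0 // ltW.
    by rewrite mulr_ge0 // ltW.
  apply: le_trans (_ : c * (E * (\sum_j (gridR p.1 j - t p.1 j) ^+ 2 + 1)) <= _).
    by rewrite ler_pM2l.
  by rewrite mulrCA ler_wpM2l ?(ltW y5).
pose TT := [pred p : {ffun 'I_k -> 'I_K} * {ffun 'I_k -> 'I_22} | p.1 \in T].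
have cTT : (#|T| * 22 ^ k = #|TT|)%N.
  have <- : #|{ffun 'I_k -> 'I_22}| = (22 ^ k)%N by rewrite card_ffun !card_ord.
  by rewrite -cardX; apply: eq_card => -[a e]; rewrite !inE andbT.
have -> : ((10 * K).+1 ^ k = (5 * K).*2.+1 ^ #|'I_k|)%N by rewrite card_ord -muln2 mulnAC.
rewrite cTT; apply: at_most_pred.
apply: (@at_most_inj _ _ g _ _ _ _ _ (at_most_int_fun _ _)) => [p /= pT j|p q pT qT e]; first exact: gN.
have [y1 y2 y3 y4 _] := hY p.1 pT; have [z1 z2 z3 z4 _] := hY q.1 qT.
have hX : hyp_space (gridpt K%:R (g p)) by exact: gridpt_hyp.
(* Both horoball vectors are short at the common image point, so their product vanishes by
   integrality; being null and orthogonal they are proportional and have the same centre. Then p and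
   q agree by division with remainder by 22. *)
have yz : lorentz (Y p.1) (Y q.1) = 0.
  have hint := ar_form ar y1 z1.
  have small : `|N%:R * lorentz (Y p.1) (Y q.1)| < 1.
    have : `|lorentz (Y p.1) (Y q.1)| <= 2 * E ^+ 2 * de ^+ 2.
      suff : `|lorentz (Y p.1) (Y q.1)| ^+ 2 <= (2 * E ^+ 2 * de ^+ 2) ^+ 2.
        have Ed0 : 0 <= 2 * E ^+ 2 * de ^+ 2 by rewrite mulr_ge0 ?sqr_ge0 // mulr_ge0 ?sqr_ge0.
        by rewrite ler_pXn2r // nnegrE.
      rewrite real_normK ?num_real //; apply: le_trans (lorentz_le_qx _ _ hX) _.
      rewrite !qxE // y2 z2 !add0r; have h1 := horo p pT; have := horo q qT; rewrite -e => h2.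
      have -> : (2 * E ^+ 2 * de ^+ 2) ^+ 2 = (2 * (E * de) ^+ 2) * (2 * (E * de) ^+ 2) by ring.
      apply: ler_pM; [by rewrite mulr_ge0 ?sqr_ge0|by rewrite mulr_ge0 ?sqr_ge0| |].
        by rewrite ler_pM2l.
      by rewrite ler_pM2l.
    rewrite normrM ger0_norm ?ler0n // => h.
    by apply: le_lt_trans c4; rewrite ler_wpM2l // ltW.
  by have /eqP := int_small hint small; rewrite mulf_eq0 gt_eqF //= => /eqP.
have par := isotropic_orth y2 z2 yz.
have tt j : t p.1 j = t q.1 j.
  by rewrite /t (@ctr_scale _ _ K%:R _ (Y q.1)) // ?gt_eqF.
have ee j : (p.1 j = q.1 j) /\ (p.2 j = q.2 j).
  have := congr1 (fun h => h j) e; rewrite /g /f tt => h.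
  have /eqP : (M * gridR p.1 j + (p.2 j : nat)%:R) = (M * gridR q.1 j + (q.2 j : nat)%:R).
    by clear -ar Pu h; lra.
  rewrite /gridR /M -!natrM -!natrD eqr_nat => /eqP h'.
  have i1 := ltn_ord (p.2 j); have i2 := ltn_ord (q.2 j).
  have [a1 a2] : (p.1 j : nat) = q.1 j /\ (p.2 j : nat) = q.2 j by clear -h' i1 i2; lia.
  by split; apply: val_inj.
case: p q ee {tt par yz hX z4 z3 z2 z1 y4 y3 y2 y1 e pT qT} => a e [a' e'] /= ee.
by congr (_, _); apply/ffunP => j; case: (ee j).
Qed.

(* At least half of the K^k grid points are thick, hence close to the orbit G o. *)
Lemma ball_lower : (0 < k)%N -> odd n -> exists (C : R) (C0 K0 : nat), [/\ 0 < C, (0 < C0)%N &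
  forall K m, (K0 <= K)%N -> at_most [set A | G A /\ A ord_max ord_max <= C * K%:R] m ->
    (K ^ k <= C0 * m)%N].
Proof.
move=> k1 odn; have [e [K0 [e0 hthin]]] := thin_few.
have [C [C_0 hC]] := thick_cocompact ar odn e0.
(* Two grid points brought near o by the same element are at bounded distance from each other, and
   [lorentz_gridpt] turns this into coordinates differing by at most 2 C. So at most (2 W + 1)^k
   thick points share an element. *)
pose W := (Num.truncn (2 * C)).+1.
have hW : 2 * C < W%:R by exact: truncnS_gt.
exists (C * (k%:R + 2)), (2 * W.*2.+1 ^ k)%N, (maxn K0 1); split.
- by rewrite mulr_gt0 //; have := ler0n R k; lra.
- by rewrite muln_gt0 expn_gt0.
move=> K m; rewrite geq_max => /andP [KK0 K1] hm.
have KR : 1 <= K%:R :> R by rewrite ler1n.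
have K00 : K%:R != 0 :> R by rewrite pnatr_eq0 -lt0n.
pose T := [pred a : {ffun 'I_k -> 'I_K} | ~~ `[< thick P e (gridpt K%:R (gridR a)) >]].
have thinT : (#|T| * 22 ^ k <= (10 * K).+1 ^ k)%N.
  by apply: hthin => // a; rewrite inE => /asboolPn.
have thickT : (#|[predC T]| <= m * W.*2.+1 ^ k)%N.
  apply: at_most_pred.
  have /choice[h hh] : forall a : {ffun 'I_k -> 'I_K}, exists h, a \in [predC T] ->
     G h /\ - lorentz o (h *m gridpt K%:R (gridR a)) <= C.
    move=> a; have [aT|] := boolP (a \in [predC T]); last by exists 1%:M.
    have ath : thick P e (gridpt K%:R (gridR a)) by move: aT; rewrite !inE negbK => /asboolP.
    have K0R : 0 < K%:R :> R by lra.
    by have [h Gh hle] := hC _ (gridpt_hyp (gridR a) K0R) ath; exists h.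
  have hX (a : {ffun 'I_k -> 'I_K}) : hyp_space (gridpt K%:R (gridR a) : 'cV[R]_n.+1).
    by apply: gridpt_hyp; lra.
  apply: (@at_most_fibers _ _ h _ _ _ _ _ hm) => [a /hh [Gh hle]|g _]; last first.
    have [[a0 [a0T ea0]]|na] := pselect (exists a0, a0 \in [predC T] /\ h a0 = g); last first.
      by apply: at_most_le (leq0n _) (at_most_sub _ at_most0) => a [aT ea]; apply: na; exists a.
    have := @at_most_int_fun R 'I_k W; rewrite card_ord.
    apply: (@at_most_inj _ _ (fun a j => gridR a j - gridR a0 j)) => [a [aT ea] j|a b _ _ eab].
      split; first by rewrite rpredB ?natr_int.
      have [Gh hle] := hh _ aT; have [_ hle0] := hh _ a0T; rewrite ea0 -ea in hle0.
      have hg := ar_isom ar Gh.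
      have := hyp_triangle (proj2 hg _ (hX a)) origin_hyp (proj2 hg _ (hX a0)).
      rewrite (Lor_lorentz _ _ (hyp_isom_Lor hg)) lorentz_gridpt // => tr.
      have b1 : lorentz o (h a *m gridpt K%:R (gridR a)) <= -1.
        by apply: hyp_lorentz_le; [exact: origin_hyp|exact: (proj2 hg)].
      have b2 : lorentz o (h a *m gridpt K%:R (gridR a0)) <= -1.
        by apply: hyp_lorentz_le; [exact: origin_hyp|exact: (proj2 hg)].
      rewrite (lorentzC _ o) in tr.
      have s : (gridR a j - gridR a0 j) ^+ 2 <= \sum_j (gridR a j - gridR a0 j) ^+ 2.
        by rewrite [X in _ <= X](bigD1 j) //= lerDl sumr_ge0 // => i _; rewrite sqr_ge0.
      have : (gridR a j - gridR a0 j) ^+ 2 <= (2 * C) ^+ 2.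
        apply: le_trans s _; move: tr hle hle0 b1 b2.
        set p := lorentz o _; set q := lorentz o _; rewrite expr2 => *; nra.
      rewrite -real_normK ?num_real // ler_pXn2r // ?nnegrE //; last by lra.
      by move=> h1; apply: le_trans h1 (ltW hW).
    apply/ffunP => j; apply/val_inj => /=.
    have /addIr := congr1 (fun f => f j) eab; rewrite /gridR => /eqP; rewrite eqr_nat => /eqP //.
  split=> //; have hg := ar_isom ar Gh.
  have t1 := hyp_triangle origin_hyp (proj2 hg _ (hX a)) (proj2 hg _ origin_hyp).
  rewrite lorentz_origin opprK ht_mul_origin (Lor_lorentz _ _ (hyp_isom_Lor hg)) in t1.
  rewrite (lorentzC (gridpt _ _)) [lorentz o (gridpt _ _)]lorentz_origin gridpt_ht in t1.
  have s : \sum_j gridR a j ^+ 2 <= k%:R * K%:R ^+ 2.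
    have -> : k%:R * K%:R ^+ 2 = \sum_(j < k) (K%:R : R) ^+ 2 by rewrite sumr_const card_ord mulr_natl.
    by apply: ler_sum => j _; rewrite lerXn2r ?nnegrE ?ler0n // /gridR ler_nat ltnW.
  have s2 : (\sum_j gridR a j ^+ 2 + 1) / K%:R <= k%:R * K%:R + K%:R.
    rewrite ler_pdivrMr; last by lra.
    by apply: le_trans (_ : k%:R * K%:R ^+ 2 + 1 <= _); [rewrite lerD2r|rewrite expr2; nra].
  have s0 : 0 <= (\sum_j gridR a j ^+ 2 + 1) / K%:R.
    apply: divr_ge0; last by lra.
    by rewrite addr_ge0 // sumr_ge0 // => j _; rewrite sqr_ge0.
  move: t1 s2 s0; set p := _ / K%:R => t1 s2 s0.
  apply: le_trans t1 _.
  have h1 : - lorentz o (h a *m gridpt K%:R (gridR a)) * (p + K%:R) <= C * (k%:R * K%:R + 2 * K%:R).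
    apply: ler_pM => //; try lra.
    rewrite oppr_ge0; apply: ltW; apply: hyp_lorentz_lt0; [exact: origin_hyp|exact: (proj2 hg)].
  lra.
have tot : (#|T| + #|[predC T]| = K ^ k)%N.
  by rewrite cardC card_ffun !card_ord.
have : (2 * #|T| <= K ^ k)%N.
  have h1 : ((10 * K).+1 ^ k <= 11 ^ k * K ^ k)%N by rewrite -expnMn leq_exp2r //; lia.
  have h2 : (22 ^ k = 11 ^ k * 2 ^ k)%N by rewrite -expnMn.
  have h3 : (2 <= 2 ^ k)%N by rewrite -{1}(expn1 2) leq_exp2l.
  have h4 : (0 < 11 ^ k)%N by rewrite expn_gt0.
  move: thinT; rewrite h2 => h5.
  have h6 : (11 ^ k * (#|T| * 2 ^ k) <= 11 ^ k * K ^ k)%N by apply: leq_trans h1; rewrite mulnCA.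
  rewrite leq_pmul2l // in h6; nia.
nia.
Qed.

End Grid.

(** * Unipotent elements and traces *)

Section Eichler.
Context {R : realType} {n : nat}.
Local Notation J := (@lorentz_mx R n).
Implicit Types (e a x y : 'cV[R]_n.+1) (A : 'M[R]_n.+1).

Definition rk1 x y : 'M[R]_n.+1 := x *m (y^T *m J).

Lemma rk1E x y z : rk1 x y *m z = lorentz y z *: x.
Proof.
rewrite /rk1 -mulmxA [y^T *m J *m z]mx11_scalar -/(lorentz y z) mul_mx_scalar //.
Qed.

Lemma tr_mul_rk1 A x y : \tr (A *m rk1 x y) = lorentz y (A *m x).
Proof. by rewrite /rk1 mulmxA mxtrace_mulC /lorentz /mxtrace big_ord1. Qed.

(* Eichler transvection of the isotropic vector e along a, orthogonal to e *)
Definition eichler e a (s : R) : 'M[R]_n.+1 :=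
  1%:M + s *: (rk1 a e - rk1 e a) - (s ^+ 2 * (lorentz a a / 2)) *: rk1 e e.

Lemma eichlerE e a s z : eichler e a s *m z =
  z + s *: (lorentz e z *: a - lorentz a z *: e) - (s ^+ 2 * (lorentz a a / 2) * lorentz e z) *: e.
Proof.
rewrite /eichler mulmxBl mulmxDl mul1mx -!scalemxAl mulmxBl !rk1E.
by rewrite scalerA.
Qed.

Lemma eichler_Lor e a s : lorentz e e = 0 -> lorentz e a = 0 -> Lor (eichler e a s).
Proof.
move=> ee ea; apply: LorP => x y; rewrite !eichlerE !lorentz_lin ee ea (lorentzC a e) ea.
by rewrite (lorentzC x a) (lorentzC x e); field.
Qed.

Lemma eichlerD e a s t : lorentz e e = 0 -> lorentz e a = 0 ->
  eichler e a s *m eichler e a t = eichler e a (s + t).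
Proof.
move=> ee ea; apply: mulmx_inj_col => z; rewrite -mulmxA !eichlerE !lorentz_lin ee ea (lorentzC a e) ea.
by apply/matrixP => i j; rewrite !mxE; field.
Qed.

Lemma eichler0 e a : eichler e a 0 = 1%:M.
Proof. by rewrite /eichler scale0r addr0 expr0n /= mul0r scale0r subr0. Qed.

(** A transvection is the square of the one with half the parameter, which rules out the wrong sign.
    The determinant below is computed in the same way. *)
Lemma eichler_isom e a s : lorentz e e = 0 -> lorentz e a = 0 -> hyp_isom (eichler e a s).
Proof.
move=> ee ea; have -> : s = s / 2 + s / 2 by field.
rewrite -eichlerD //; case: (Lor_sign (eichler_Lor (s / 2) ee ea)) => h.
  exact: hyp_isom_mul.
by rewrite -[X in hyp_isom X]opprK -mulNmx -mulmxN; exact: hyp_isom_mul.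
Qed.

Lemma eichler_det e a s : lorentz e e = 0 -> lorentz e a = 0 -> \det (eichler e a s) = 1.
Proof.
move=> ee ea; have -> : s = s / 2 + s / 2 by field.
rewrite -eichlerD // det_mulmx.
have := congr1 determinant (eichler_Lor (s / 2) ee ea); rewrite !det_mulmx det_tr.
move=> h; have j0 : \det J != 0.
  by apply: contra_eq_neq (det1 R n.+1) => j0; rewrite -lorentz_mx_sq det_mulmx j0 mul0r eq_sym oner_neq0.
by apply: (mulfI j0); rewrite mulr1 -[RHS]h; ring.
Qed.

(** The transvection is quadratic in its parameter and its quadratic part has rank 1; the second
    difference isolates that part. *)
Lemma eichler_second e a s : lorentz e e = 0 -> lorentz e a = 0 ->
  eichler e a (2 * s) - 2 *: eichler e a s + 1%:M = (- (s ^+ 2 * lorentz a a)) *: rk1 e e.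
Proof.
move=> ee ea; apply/matrixP => i j; rewrite !mxE; by field.
Qed.

Lemma rk1M x y z w : rk1 x y *m rk1 z w = lorentz y z *: rk1 x w.
Proof. by apply: mulmx_inj_col => v; rewrite -mulmxA [rk1 z w *m v]rk1E -scalemxAr rk1E -scalemxAl rk1E !scalerA mulrC. Qed.

Lemma trace_second (S T U V A : 'M[R]_n.+1) :
  \tr (A *m ((S - 2 *: T + 1%:M) *m (U - 2 *: V + 1%:M))) =
  \tr (A *m (S *m U)) - 2 * \tr (A *m (S *m V)) + \tr (A *m S)
  - 2 * \tr (A *m (T *m U)) + 4 * \tr (A *m (T *m V)) - 2 * \tr (A *m T)
  + \tr (A *m U) - 2 * \tr (A *m V) + \tr (A *m 1%:M).
Proof.
rewrite !(mulmxDl, mulmxDr, mulmxBl, mulmxBr, mul1mx, mulmx1, mulNmx, mulmxN).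
rewrite -!scalemxAl.
rewrite -!scalemxAr.
have trN (X : 'M[R]_n.+1) : \tr (- X) = - \tr X by exact: raddfN.
by rewrite !(mxtraceD, mxtraceZ, trN); ring.
Qed.

End Eichler.

(** * Matrix coefficients bounded by finitely many traces *)

Section TraceNorm.
Context {R : realType} {n : nat}.
Local Notation J := (@lorentz_mx R n).
Local Notation o := (@origin R n).
Context {G : set 'M[R]_n.+1} {P : 'M[R]_n.+1} {D N : nat} {rs : seq 'M[R]_n.+1}.
Hypothesis ar : arith G P D N rs.
Let Pu := ar_unit ar.

(** The rational vectors of the quadratic space, described inside [R] by a common denominator c. *)
Definition ratvec (x : 'cV[R]_n.+1) := exists2 c : R, c != 0 & c \is a Num.int /\ Lat P (c *: x).

Lemma ratvecZ (c : R) x : (exists2 d : R, d != 0 & d \is a Num.int /\ d * c \is a Num.int) -> ratvec x -> ratvec (c *: x).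
Proof.
move=> [d d0 [hd hdc]] [b b0 [hb hx]]; exists (d * b); first by rewrite mulf_neq0.
split; first by rewrite rpredM.
rewrite scalerA (_ : d * b * c = d * c * b); last by ring.
by rewrite -scalerA /Lat -scalemxAr; apply: intmxZ.
Qed.

Lemma ratvecD x y : ratvec x -> ratvec y -> ratvec (x + y).
Proof.
move=> [b b0 [hb hx]] [c c0 [hc hy]]; exists (b * c); first by rewrite mulf_neq0.
split; first by rewrite rpredM.
rewrite scalerDr /Lat mulmxDr; apply: intmxD.
  by rewrite mulrC -scalerA -scalemxAr; apply: intmxZ.
by rewrite -scalerA -scalemxAr; apply: intmxZ.
Qed.

Lemma ratvec_Lat x : Lat P x -> ratvec x.
Proof. by move=> h; exists 1; [exact: oner_neq0|rewrite scale1r]. Qed.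

Lemma ratvec_lorentz x y : ratvec x -> ratvec y ->
  exists2 d : R, d != 0 & d \is a Num.int /\ d * lorentz x y \is a Num.int.
Proof.
move=> [b b0 [hb hx]] [c c0 [hc hy]]; exists (N%:R * (b * c)).
  by rewrite !mulf_neq0 // gt_eqF // (N_gt0 ar).
split; first by rewrite !rpredM // natr_int.
have := ar_form ar hx hy; rewrite !lorentz_lin => h.
by rewrite -mulrA; rewrite (_ : b * c * _ = b * (c * lorentz x y)) //; ring.
Qed.

Lemma ratfrac (p q : R) : q != 0 ->
  (exists2 d : R, d != 0 & d \is a Num.int /\ d * p \is a Num.int) ->
  (exists2 d : R, d != 0 & d \is a Num.int /\ d * q \is a Num.int) ->
  (exists2 d : R, d != 0 & d \is a Num.int /\ d * (p / q) \is a Num.int).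
Proof.
move=> q0 [d d0 [hd hdp]] [b b0 [hb hbq]]; exists (d * (b * q)); first by rewrite !mulf_neq0.
split; first by rewrite rpredM.
have -> : d * (b * q) * (p / q) = b * (d * p) by field.
by rewrite rpredM.
Qed.

Lemma ratnum_opp (p : R) :
  (exists2 d : R, d != 0 & d \is a Num.int /\ d * p \is a Num.int) ->
  (exists2 d : R, d != 0 & d \is a Num.int /\ d * (- p) \is a Num.int).
Proof. by move=> [d d0 [hd hdp]]; exists d => //; rewrite mulrN rpredN. Qed.

Lemma Lat_rk1 x y : ratvec x -> ratvec y -> exists2 c : nat, (0 < c)%N &
  forall z, Lat P z -> Lat P (c%:R *: (rk1 x y *m z)).
Proof.
move=> [b b0 [hb hx]] [c c0 [hc hy]].
pose d := `|N%:R * (b * c)|.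
have d0 : d != 0 by rewrite normr_eq0 !mulf_neq0 // gt_eqF // (N_gt0 ar).
have hd : d \is a Num.nat.
  have : N%:R * (b * c) \is a Num.int by rewrite !rpredM // natr_int.
  by rewrite /d => /intrP [m ->]; rewrite -intr_norm -natr_absz natr_nat.
exists (Num.truncn d).
  by rewrite lt0n -(@eqr_nat R) truncnK.
move=> z hz; rewrite truncnK // rk1E scalerA.
have : N%:R * lorentz (c *: y) z \is a Num.int by exact: (ar_form ar).
rewrite lorentzZl => h.
have -> : d * lorentz y z = (d / (N%:R * (b * c))) * (N%:R * (c * lorentz y z)) * b.
  by field; rewrite b0 c0 gt_eqF // (N_gt0 ar).
rewrite -scalerA -(scalerA (d / _)) /Lat -!scalemxAr; apply: intmxZ; last first.
  by rewrite /Lat -scalemxAr in hx; exact: intmxZ.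
have nz : N%:R * (b * c) != 0 by rewrite -normr_eq0.
rewrite /d; case: (lerP 0 (N%:R * (b * c))) => s.
  by rewrite ger0_norm // divff // rpred1.
by rewrite ltr0_norm // mulNr divff ?rpredN1.
Qed.

Lemma pigeon (f : nat -> 'M[R]_n.+1) (s : seq 'M[R]_n.+1) : (forall j, f j \in s) ->
  exists i j, (i < j)%N /\ f i = f j.
Proof.
move=> h; have [|ne] := pselect (exists i j, (i < j)%N /\ f i = f j); first by [].
have fi : injective f.
  move=> i j e; apply/eqP; apply: contraT; rewrite neq_ltn => /orP [l|l]; exfalso; apply: ne.
    by exists i, j.
  by exists j, i.
have : (size (map f (iota 0 (size s).+1)) <= size s)%N.
  by apply: uniq_leq_size; [rewrite map_inj_uniq // iota_uniq|move=> _ /mapP[j _ ->]].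
by rewrite size_map size_iota ltnn.
Qed.

Lemma GLZ_of_Lat A : hyp_isom A -> (forall z, Lat P z -> Lat P (A *m z)) ->
  (forall z, Lat P z -> Lat P (invmx A *m z)) -> GLZ (P *m A *m invmx P).
Proof.
move=> hA h1 h2; have uA := hyp_isom_unit hA.
have key (B : 'M[R]_n.+1) : (forall z, Lat P z -> Lat P (B *m z)) -> intmx (P *m B *m invmx P).
  move=> h i j; have := h (invmx P *m delta_mx j 0); rewrite /Lat mulKVmx // => hB.
  have /hB /(_ i 0) : intmx (delta_mx j 0 : 'cV[R]_n.+1) by move=> a b; rewrite mxE; case: andP.
  by rewrite !mulmxA -colE mxE.
split; first exact: key.
exists (P *m invmx A *m invmx P); first exact: key.
by rewrite !mulmxA mulmxKV // mulmxK // mulmxV.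
Qed.

Lemma ratvec_basis j : ratvec (invmx P *m delta_mx j 0).
Proof. by apply: ratvec_Lat; rewrite /Lat mulKVmx // => i l; rewrite mxE; case: andP. Qed.

Lemma lattice_dual e : e != 0 -> lorentz e e = 0 -> exists w, lorentz e (invmx P *m delta_mx w 0) != 0.
Proof.
move=> e0 ee; have he : 'ht e != 0 by apply: contra e0 => /eqP h; apply/eqP; exact: isotropic_ht0.
apply/existsP; apply: contraT; rewrite negb_exists => /forallP h.
exfalso; move/eqP: he; apply; apply: oppr_inj; rewrite oppr0 -lorentz_origin.
have -> : o = \sum_j (P *m o) j 0 *: (invmx P *m delta_mx j 0).
  rewrite -[LHS](mulKmx Pu) {1}(matrix_sum_delta (P *m o)) mulmx_sumr; apply: eq_bigr => j _.
  by rewrite big_ord1 -scalemxAr.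
rewrite (lorentz_suml (fun j => (P *m o) j 0 *: (invmx P *m delta_mx j 0))) big1 // => j _; rewrite lorentzZl lorentzC.
by have := h j; rewrite negbK => /eqP ->; rewrite mulr0.
Qed.

Lemma ratvec_dual e : e != 0 -> lorentz e e = 0 -> exists2 w, ratvec w & lorentz e w != 0.
Proof. by move=> e0 ee; have [w ew] := lattice_dual e0 ee; exists (invmx P *m delta_mx w 0) => //; exact: ratvec_basis. Qed.

(* By pigeonhole over rs, a power of an integral transvection lies in G. *)
Lemma eichler_in_group e : ratvec e -> lorentz e e = 0 -> e != 0 -> (1 < n)%N ->
  exists E ka, [/\ G E, G (E *m E), ka != 0 & E *m E - 2 *: E + 1%:M = ka *: rk1 e e].
Proof.
move=> re ee e0 n1.
have he : 'ht e != 0 by apply: contra e0 => /eqP h; apply/eqP; exact: isotropic_ht0.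
(* The g j are the basis vectors f j made orthogonal to e along f w. If all of them were null, they
   would be multiples of e, and the basis would lie in the span of f w and e, although n + 1 > 2. *)
have [a [ra ea aa]] : exists a, [/\ ratvec a, lorentz e a = 0 & lorentz a a != 0].
  pose f j : 'cV[R]_n.+1 := invmx P *m delta_mx j 0.
  have rf j : ratvec (f j) by exact: ratvec_basis.
  have [w ew] := lattice_dual e0 ee.
  pose g j := f j - (lorentz e (f j) / lorentz e (f w)) *: f w.
  have eg j : lorentz e (g j) = 0 by rewrite /g !lorentz_lin divfK // subrr.
  have rg j : ratvec (g j).
    apply: ratvecD => //; rewrite -scaleNr; apply: ratvecZ => //; apply: ratnum_opp; apply: ratfrac => //.
      exact: ratvec_lorentz.
    exact: ratvec_lorentz.
  have [[j gj]|ng] := pselect (exists j, lorentz (g j) (g j) != 0); first by exists (g j).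
  exfalso.
  have par j : exists s, f j = s *: f w + (lorentz e (f j) - s * lorentz e (f w)) *: (0 : 'cV_n.+1) + ('ht (g j) / 'ht e) *: e.
    exists (lorentz e (f j) / lorentz e (f w)); rewrite scaler0 addr0.
    have gg : lorentz (g j) (g j) = 0 by apply/eqP; apply: contraT => h; exfalso; apply: ng; exists j.
    have := isotropic_orth ee gg (eg j) => h.
    have -> : ('ht (g j) / 'ht e) *: e = g j.
      by rewrite mulrC -scalerA h scalerA mulVf // scale1r.
    by rewrite /g addrC subrK.
  pose U : 'M[R]_(n.+1, 2) := row_mx (f w) e : 'M[R]_(n.+1, 1 + 1).
  have : (\rank (invmx P) <= \rank U)%N.
    rewrite -mxrank_tr -[X in (_ <= X)%N]mxrank_tr; apply: mxrankS; apply/row_subP => j.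
    rewrite -tr_col; have -> : col j (invmx P) = f j by rewrite /f colE.
    have [s ->] := par j; rewrite scaler0 addr0 linearD /= !linearZ /=.
    have UT : U^T = col_mx (f w)^T e^T by exact: (@tr_row_mx _ _ 1 1 (f w) e).
    rewrite UT; apply: addmx_sub; apply: scalemx_sub; apply/submxP.
      exists (row_mx 1%:M 0 : 'rV[R]_(1 + 1)); by rewrite [RHS](@mul_row_col R 1 1 1 n.+1) mul1mx mul0mx addr0.
    exists (row_mx 0 1%:M : 'rV[R]_(1 + 1)); by rewrite [RHS](@mul_row_col R 1 1 1 n.+1) mul1mx mul0mx add0r.
  rewrite mxrank_unit ?unitmx_inv // => h.
  by have := leq_trans h (rank_leq_col U); rewrite ltnS leqNgt n1.
have [c1 c10 h1] := Lat_rk1 ra re; have [c2 c20 h2] := Lat_rk1 re ra.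
pose b := (lorentz a a / 2) *: e.
have rb : ratvec b.
  apply: ratvecZ => //; apply: ratfrac; first by rewrite pnatr_eq0.
    exact: ratvec_lorentz.
  by exists 1; [exact: oner_neq0|rewrite rpred1 mul1r natr_int].
have [c3 c30 h3] := Lat_rk1 rb re.
(* At integral multiples of t each term of the transvection maps the lattice to itself, and so does
   the inverse; thus [ar_red] applies. *)
pose t : R := (c1 * c2 * c3)%:R.
have tn0 : t != 0 by rewrite pnatr_eq0 !muln_eq0 !negb_or -!lt0n c10 c20.
have tint (z : int) y : Lat P y -> Lat P (eichler e a (z%:~R * t) *m y).
  move=> hy; rewrite /Lat eichlerE !mulmxBr mulmxDr; apply: intmxD; last apply: intmxN.
    apply: intmxD => //; rewrite -!rk1E -scalemxAr mulmxBr scalerBr; apply: intmxD; last apply: intmxN.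
      have -> : z%:~R * t = (z * (c2 * c3)%:Z)%:~R * c1%:R by rewrite /t intrM !natrM; ring.
      by rewrite -scalerA scalemxAr; apply: intmxZ; [rewrite intr_int|exact: h1].
    have -> : z%:~R * t = (z * (c1 * c3)%:Z)%:~R * c2%:R by rewrite /t intrM !natrM; ring.
    by rewrite -scalerA scalemxAr; apply: intmxZ; [rewrite intr_int|exact: h2].
  have -> : ((z%:~R * t) ^+ 2 * (lorentz a a / 2) * lorentz e y) *: e =
     (z * z * (c1 * c1 * c2 * c2 * c3)%:Z)%:~R *: (c3%:R *: (rk1 b e *m y)).
    by rewrite rk1E /b !scalerA; congr (_ *: _); rewrite /t !intrM !natrM; ring.
  by rewrite -scalemxAr; apply: intmxZ; [rewrite intr_int|exact: h3].
have Einv s : invmx (eichler e a s) = eichler e a (- s).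
  have u : eichler e a s \in unitmx by apply: Lor_unit; exact: eichler_Lor.
  by apply: (can_inj (mulKmx u)); rewrite mulmxV // eichlerD // subrr eichler0.
have red j : exists r, r \in rs /\ exists2 h, G h & eichler e a (j%:R * t) = r *m h.
  have hi : hyp_isom (eichler e a (j%:R * t)) by exact: eichler_isom.
  have gl : GLZ (P *m eichler e a (j%:R * t) *m invmx P).
    apply: GLZ_of_Lat => // z hz; first exact: (tint j%:Z).
    by rewrite Einv -mulNr; have := tint (- j%:Z) z hz; rewrite mulrNz.
  have [r rr [h Gh eh]] := ar_red ar hi gl (eichler_det _ ee ea).
  by exists r; split=> //; exists h.
have /choice[f hf] := red.
have [i [j [ij eij]]] := pigeon (fun j => (hf j).1).
have [h1' Gh1 e1] := (hf i).2; have [h2' Gh2 e2] := (hf j).2.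
have GE : G (eichler e a ((j - i)%:R * t)).
  have -> : (j - i)%:R * t = - (i%:R * t) + j%:R * t by rewrite natrB ?(ltnW ij) //; ring.
  rewrite -eichlerD // -Einv e1 e2 eij.
  have fu : f j \in unitmx by apply: hyp_isom_unit; apply: (ar_rs ar); exact: (hf j).1.
  have uh1 := ar_u ar Gh1.
  rewrite invmx_mulE //.
  rewrite mulmxA.
  rewrite mulmxKV //.
  by apply: (ar_mul ar) => //; exact: (ar_inv ar).
set s := (j - i)%:R * t in GE.
have s0 : s != 0 by rewrite mulf_neq0 // pnatr_eq0 subn_eq0 -ltnNge.
exists (eichler e a s), (- (s ^+ 2 * lorentz a a)); split=> //.
- exact: (ar_mul ar).
- by rewrite oppr_eq0 mulf_neq0 // expf_neq0.
- by rewrite eichlerD // -eichler_second // mulrDl mul1r.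
Qed.

Lemma trmx_continuous : continuous (@trmx R 1 n.+1).
Proof.
move=> x B [Q hQ sub]; exists (fun i j => Q j i); first by move=> i j; have := hQ j i; rewrite mxE.
by move=> y hy; apply: sub => i j; rewrite mxE; exact: hy.
Qed.

Lemma ht_ball_compact (C : R) : compact [set x : 'cV[R]_n.+1 | hyp_space x /\ 'ht x <= C].
Proof.
have cE (i : 'I_n.+1) : continuous (fun v : 'rV[R]_n.+1 => v 0 i) by exact: coord_continuous.
pose K' := [set v : 'rV[R]_n.+1 | [/\ lorentz v^T v^T = -1, 1 <= v 0 ord_max & v 0 ord_max <= C]].
have -> : [set x : 'cV[R]_n.+1 | hyp_space x /\ 'ht x <= C] = (@trmx R 1 n.+1) @` K'.
  apply/seteqP; split=> [x [hx xC]|_ [v [v1 v2 v3] <-]].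
    exists x^T; last by rewrite trmxK.
    by split; rewrite ?trmxK ?mxE //; [case: hx|exact: hyp_ht_ge1].
  by split; [split=> //; rewrite mxE; apply: lt_le_trans v2|rewrite mxE].
apply: continuous_compact; first by apply: continuous_subspaceT; exact: trmx_continuous.
apply: bounded_closed_compact.
  exists (2 * C); split; first exact: num_real.
  move=> M CM v [v1 v2 v3]; have C1 : 1 <= C by exact: le_trans v3.
  rewrite /= /Num.norm /= mx_normrE; apply: bigmax_le.
    by apply: le_trans (ltW CM); lra.
  move=> [i j] _ /=; rewrite ord1; apply: le_trans (ltW CM).
  have := nrm2_coord v^T j; rewrite nrm2E v1 !mxE => h.
  have : `|v 0 j| ^+ 2 <= (2 * C) ^+ 2.
    by rewrite real_normK ?num_real //; apply: le_trans h _; rewrite !expr2; nra.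
  by rewrite ler_pXn2r ?nnegrE //; lra.
have cl : continuous (fun v : 'rV[R]_n.+1 => lorentz v^T v^T).
  have -> : (fun v : 'rV[R]_n.+1 => lorentz v^T v^T) = (fun v => (\sum_(i < n) v 0 (widen_ord (leqnSn n) i) * v 0 (widen_ord (leqnSn n) i)) - v 0 ord_max * v 0 ord_max).
    by apply/funext => v; rewrite lorentzE !mxE; congr (_ - _); apply: eq_bigr => i _; rewrite !mxE.
  have cM (i : 'I_n.+1) : continuous (fun v : 'rV[R]_n.+1 => v 0 i * v 0 i).
    by move=> v; exact: (cvgM (cE i v) (cE i v)).
  have cS : continuous (fun v : 'rV[R]_n.+1 => \sum_(i < n) v 0 (widen_ord (leqnSn n) i) * v 0 (widen_ord (leqnSn n) i)).
    by apply: continuous_big => [|i _]; [exact: add_continuous|exact: cM].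
  by move=> v; exact: (cvgB (cS v) (cM ord_max v)).
have -> : K' = ((fun v : 'rV[R]_n.+1 => lorentz v^T v^T) @^-1` [set x | x = -1]) `&`
  ((fun v : 'rV[R]_n.+1 => v 0 ord_max) @^-1` [set x | 1 <= x]) `&` ((fun v : 'rV[R]_n.+1 => v 0 ord_max) @^-1` [set x | x <= C]).
  by apply/seteqP; split=> [v [? ? ?]|v [[? ?] ?]].
apply: closedI; first apply: closedI.
- by apply: preimage_closed (@closed_eq R _); move=> v _; exact: cl.
- by apply: preimage_closed (@closed_ge R _); move=> v _; exact: cE.
- by apply: preimage_closed (@closed_le R _); move=> v _; exact: cE.
Qed.

(** If no lattice vector is null, then N |<y, y>| >= 1 on nonzero ones, every point of H^n is thick
    for the constant 1 / N, and Mahler's criterion makes G cocompact. *)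
Lemma isotropic_exists : odd n -> ~ cocompact G -> exists e, [/\ Lat P e, e != 0 & lorentz e e = 0].
Proof.
move=> odn nc; have [//|ne] := pselect (exists e, [/\ Lat P e, e != 0 & lorentz e e = 0]).
exfalso; apply: nc.
have N0 := N_gt0 ar.
have e0 : 0 < N%:R^-1 :> R by rewrite invr_gt0.
have [C [C0 hC]] := thick_cocompact ar odn e0.
  exists [set x : 'cV[R]_n.+1 | hyp_space x /\ 'ht x <= C]; split; first exact: ht_ball_compact.
    by move=> x [].
  move=> x hx; have [|h Gh hle] := hC x hx.
    move=> y Ly y0; have yy : lorentz y y != 0 by apply/eqP => yy; apply: ne; exists y.
    have a1 : 1 <= N%:R * `|lorentz y y|.
      rewrite leNgt; apply/negP => h; have := int_small (ar_form ar Ly Ly).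
      rewrite normrM (ger0_norm (ltW N0)) => /(_ h) /eqP; rewrite mulf_eq0 (negbTE yy) orbF.
      by rewrite gt_eqF.
    have q0 : 0 <= qx x y by exact: qx_ge0.
    have := lorentz_le_qx y y hx; rewrite -real_normK ?num_real // -expr2 ler_pXn2r ?nnegrE // => h.
    by rewrite -(ler_pM2l N0) divff ?gt_eqF //; apply: le_trans a1 _; rewrite ler_pM2l.
  have hh := proj2 (ar_isom ar Gh) _ hx.
  exists (invmx h); first exact: (ar_inv ar).
  exists (h *m x); last by rewrite mulKmx // (ar_u ar).
  by split=> //; apply: le_trans hle; rewrite lorentz_origin opprK.
Qed.

Definition trace_sum (S : seq 'M[R]_n.+1) A := \sum_(h <- S) `|\tr (A *m h)|.

Lemma trace_sum_ge0 S A : 0 <= trace_sum S A.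
Proof. by apply: sumr_ge0 => h _; exact: normr_ge0. Qed.

(** The finite set S and the constant do not depend on A. By [tracebound_comb] the property is
    compatible with linear combinations in x and in y, so it spreads from isotropic rational vectors
    to all of space. *)
Definition tracebound x y := exists S (C : R), [/\ forall h, h \in S -> G h, 0 <= C &
  forall A, G A -> `|lorentz (A *m x) y| <= C * trace_sum S A].

Lemma traceboundP x y (S : seq 'M[R]_n.+1) (C : R) : (forall h, h \in S -> G h) -> 0 <= C ->
  (forall A, G A -> `|lorentz (A *m x) y| <= C * trace_sum S A) -> tracebound x y.
Proof. by move=> *; exists S, C. Qed.

Lemma tracebound_comb x x' y y' x'' y'' (b c : R) : tracebound x y -> tracebound x' y' ->
  (forall A, lorentz (A *m x'') y'' = b * lorentz (A *m x) y + c * lorentz (A *m x') y') ->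
  tracebound x'' y''.
Proof.
move=> [S [C [SG C0 h]]] [S' [C' [SG' C0' h']]] e.
exists (S ++ S'), (`|b| * C + `|c| * C'); split.
- by move=> g; rewrite mem_cat => /orP [/SG|/SG'].
- by rewrite addr_ge0 // mulr_ge0.
move=> A GA; rewrite e; apply: le_trans (ler_normD _ _) _; rewrite !normrM mulrDl.
have := trace_sum_ge0 S A; have := trace_sum_ge0 S' A; rewrite /trace_sum big_cat /= -!/(trace_sum _ A) => t' t.
apply: lerD; rewrite -mulrA ler_wpM2l //.
  by apply: le_trans (h A GA) _; rewrite ler_wpM2l // lerDl.
by apply: le_trans (h' A GA) _; rewrite ler_wpM2l // lerDr.
Qed.

Lemma tracebound0 x y : (forall A, lorentz (A *m x) y = 0) -> tracebound x y.
Proof. by move=> h; exists [::], 0; split=> // A _; rewrite h normr0 mul0r. Qed.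

Lemma norm_comb9 (t1 t2 t3 t4 t5 t6 t7 t8 t9 : R) :
  `|t1 - 2 * t2 + t3 - 2 * t4 + 4 * t5 - 2 * t6 + t7 - 2 * t8 + t9| <=
  4 * (`|t1| + (`|t2| + (`|t3| + (`|t4| + (`|t5| + (`|t6| + (`|t7| + (`|t8| + `|t9|)))))))).
Proof.
rewrite ler_norml.
have b (t : R) : - `|t| <= t <= `|t| by rewrite -ler_norml.
move: (b t1) (b t2) (b t3) (b t4) (b t5) (b t6) (b t7) (b t8) (b t9).
move=> /andP[? ?] /andP[? ?] /andP[? ?] /andP[? ?] /andP[? ?] /andP[? ?] /andP[? ?] /andP[? ?] /andP[? ?].
by apply/andP; split; lra.
Qed.

(** Second differences of unipotents in G are multiples of the rank one maps of e and of f. Their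
    product is a multiple of <e, f> [rk1] e f, and its trace against A is a multiple of <A e, f>;
    expanding the product gives nine traces tr (A h) with h in G. If <e, f> = 0, then f is a
    multiple of e and one second difference is enough. *)
Lemma tracebound_isotropic e f : (1 < n)%N -> ratvec e -> ratvec f -> lorentz e e = 0 -> lorentz f f = 0 ->
  tracebound e f.
Proof.
move=> n1 re rf ee ff.
have [->|e0] := eqVneq e 0; first by apply: tracebound0 => A; rewrite mulmx0 lorentz0l.
have [->|f0] := eqVneq f 0; first by apply: tracebound0 => A; rewrite lorentz0r.
have [E [ka [GE GE2 ka0 hE]]] := eichler_in_group re ee e0 n1.
have [F [kb [GF GF2 kb0 hF]]] := eichler_in_group rf ff f0 n1.
have G1 := ar_1 ar; have GM := ar_mul ar.
have [ef|ef] := eqVneq (lorentz e f) 0.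
  have par := isotropic_orth ee ff ef.
  have he : 'ht e != 0 by apply: contra e0 => /eqP h; apply/eqP; exact: isotropic_ht0.
  have fE : f = ('ht f / 'ht e) *: e by rewrite mulrC -scalerA par scalerA mulVf ?scale1r.
  pose S := [:: E *m E; E; 1%:M].
  apply: (@traceboundP _ _ S (2 * `|'ht f / 'ht e / ka|)).
  - by move=> h; rewrite !inE => /or3P [] /eqP ->.
  - by rewrite mulr_ge0.
  move=> A GA.
  have -> : lorentz (A *m e) f = ('ht f / 'ht e / ka) * \tr (A *m (ka *: rk1 e e)).
    by rewrite -scalemxAr mxtraceZ tr_mul_rk1 {1}fE lorentzZr lorentzC; field; rewrite ka0 he.
  rewrite normrM mulrAC [2 * _]mulrC -mulrA mulrAC -mulrA ler_wpM2l // -hE.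
  rewrite mulmxDr mulmxBr -scalemxAr mxtraceD linearB /= mxtraceZ.
  rewrite /trace_sum /S !big_cons big_nil addr0.
  set p := \tr _; set q := \tr _; set r := \tr _.
  apply: le_trans (ler_normD _ _) _; apply: le_trans (lerD (ler_normB _ _) (lexx _)) _.
  rewrite normrM (ger0_norm (_ : 0 <= 2)) //; have := normr_ge0 p; have := normr_ge0 r; lra.
pose S := [:: E *m E *m (F *m F); E *m E *m F; E *m E; E *m (F *m F); E *m F; E; F *m F; F; 1%:M].
apply: (@traceboundP _ _ S (4 * `|(ka * kb * lorentz e f)^-1|)).
- have GEF h : h \in S -> exists a b, [/\ a \in [:: 1%:M; E; E *m E], b \in [:: 1%:M; F; F *m F] & h = a *m b].
    move=> hS; have : h \in [seq a *m b | a <- [:: E *m E; E; 1%:M], b <- [:: F *m F; F; 1%:M]].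
      by rewrite /= !mulmx1 !mul1mx.
    case/allpairsP => -[a b] /= [ha hb ->]; exists a, b; split=> //.
      by move: ha; rewrite !inE => /or3P [] ->; rewrite ?orbT.
    by move: hb; rewrite !inE => /or3P [] ->; rewrite ?orbT.
  move=> h /GEF [a [b [+ + ->]]]; rewrite !inE => ha hb; apply: GM.
    by case/or3P: ha => /eqP ->.
  by case/or3P: hb => /eqP ->.
- by rewrite mulr_ge0.
move=> A GA.
have -> : lorentz (A *m e) f = (ka * kb * lorentz e f)^-1 * \tr (A *m ((ka *: rk1 e e) *m (kb *: rk1 f f))).
  rewrite -!scalemxAl -!scalemxAr rk1M -!scalemxAr !mxtraceZ tr_mul_rk1 lorentzC; field.
  by rewrite ef ka0 kb0.
rewrite normrM [X in _ <= X * _]mulrC -[X in _ <= X]mulrA ler_wpM2l // -hE -hF trace_second //.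
rewrite /trace_sum /S !big_cons big_nil addr0 !mulmxA.
set t1 := \tr _; set t2 := \tr _; set t3 := \tr _; set t4 := \tr _; set t5 := \tr _.
set t6 := \tr _; set t7 := \tr _; set t8 := \tr _; set t9 := \tr _.
move: t1 t2 t3 t4 t5 t6 t7 t8 t9 => t1 t2 t3 t4 t5 t6 t7 t8 t9; clear.
exact: norm_comb9.
Qed.

(** Rational isotropic vectors span: if <e, w> is not 0, moving w along e gives the isotropic vector
    [phi] w; otherwise w is the difference of w + w0 and w0, to which this applies. *)
Lemma tracebound_rat e w1 w2 : (1 < n)%N -> ratvec e -> e != 0 -> lorentz e e = 0 -> ratvec w1 -> ratvec w2 ->
  tracebound w1 w2.
Proof.
move=> n1 re e0 ee.
have he : 'ht e != 0 by apply: contra e0 => /eqP h; apply/eqP; exact: isotropic_ht0.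
pose phi w := w - (lorentz w w / (2 * lorentz e w)) *: e.
have phi_iso w : lorentz e w != 0 -> lorentz (phi w) (phi w) = 0.
  by move=> ew; rewrite /phi !lorentz_lin ee (lorentzC w e); field.
have phi_rat w : ratvec w -> lorentz e w != 0 -> ratvec (phi w).
  move=> rw ew; apply: ratvecD => //; rewrite -scaleNr; apply: ratvecZ => //; apply: ratnum_opp; apply: ratfrac.
  - by rewrite mulf_neq0.
  - exact: ratvec_lorentz.
  - have [d d0 [hd hdl]] := ratvec_lorentz re rw; exists d => //; split=> //.
    by rewrite mulrCA rpredM ?natr_int.
have [w0 rw0 ew0] : exists2 w0, ratvec w0 & lorentz e w0 != 0 by exact: ratvec_dual.
have dec w : ratvec w -> exists u v (c : R), [/\ ratvec u, ratvec v, lorentz u u = 0, lorentz v v = 0 & w = u - v + c *: e].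
  move=> rw; have [ew|ew] := eqVneq (lorentz e w) 0; last first.
    exists (phi w), 0, (lorentz w w / (2 * lorentz e w)); split=> //.
    - exact: phi_rat.
    - by rewrite -(scale0r e); apply: ratvecZ => //; exists 1; [exact: oner_neq0|rewrite mulr0 rpred0 rpred1].
    - exact: phi_iso.
    - by rewrite lorentz0l.
    - by rewrite subr0 /phi subrK.
  have eww : lorentz e (w + w0) != 0 by rewrite lorentzDr ew add0r.
  exists (phi (w + w0)), (phi w0), (lorentz (w + w0) (w + w0) / (2 * lorentz e (w + w0)) - lorentz w0 w0 / (2 * lorentz e w0)); split.
  - by apply: phi_rat => //; exact: ratvecD.
  - exact: phi_rat.
  - exact: phi_iso.
  - exact: phi_iso.
  - by rewrite /phi; apply/matrixP => i j; rewrite !mxE; ring.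
move=> rw rw'.
have B1 f x : ratvec f -> lorentz f f = 0 -> ratvec x -> tracebound f x.
  move=> rf ff rx; have [u [v [c [ru rv uu vv ->]]]] := dec x rx.
  apply: (@tracebound_comb f f (u - v) e _ _ 1 c).
  - apply: (@tracebound_comb f f u v _ _ 1 (-1)); [exact: tracebound_isotropic|exact: tracebound_isotropic|].
    by move=> A; rewrite !lorentz_lin; ring.
  - exact: tracebound_isotropic.
  - by move=> A; rewrite lorentzDr lorentzZr; ring.
have [u [v [c [ru rv uu vv ->]]]] := dec w1 rw.
apply: (@tracebound_comb (u - v) e w2 w2 _ _ 1 c).
- apply: (@tracebound_comb u v w2 w2 _ _ 1 (-1)); [exact: B1|exact: B1|].
  by move=> A; rewrite mulmxBr !lorentz_lin; ring.
- exact: B1.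
- by move=> A; rewrite mulmxDr -scalemxAr lorentzDl lorentzZl; ring.
Qed.

(* The traces of finitely many translates control the size of A: the cusp of a
   non-cocompact lattice supplies unipotents, whose rank one second
   differences detect all matrix coefficients. *)
Lemma trace_norm : odd n -> (1 < n)%N -> ~ cocompact G -> exists (S : seq 'M[R]_n.+1) (C : R), [/\ 0 < C, forall h, h \in S -> G h &
  forall A, G A -> exists2 h, h \in S & A ord_max ord_max <= C * `|\tr (A *m h)|].
Proof.
move=> odn n1 nc; have [e [Le e0 ee]] := isotropic_exists odn nc.
have re := ratvec_Lat Le.
pose f j : 'cV[R]_n.+1 := invmx P *m delta_mx j 0.
have B i j : tracebound (f i) (f j) by apply: (tracebound_rat n1 re) => //; exact: ratvec_basis.
have Bo : tracebound o o.
  have oE : o = \sum_j (P *m o) j 0 *: f j.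
    rewrite -[LHS](mulKmx Pu) {1}(matrix_sum_delta (P *m o)) mulmx_sumr; apply: eq_bigr => j _.
    by rewrite big_ord1 -scalemxAr.
  have B1 i : tracebound (f i) o.
    rewrite oE; elim/big_rec: _ => [|j y _ By]; first by apply: tracebound0 => A; rewrite lorentz0r.
    apply: (@tracebound_comb (f i) (f i) (f j) y _ _ ((P *m o) j 0) 1) => // A.
    by rewrite lorentzDr lorentzZr mul1r.
  rewrite {1}oE; elim/big_rec: _ => [|j y _ By]; first by apply: tracebound0 => A; rewrite mulmx0 lorentz0l.
  apply: (@tracebound_comb (f j) y o o _ _ ((P *m o) j 0) 1) => // A.
  by rewrite mulmxDr -scalemxAr lorentzDl lorentzZl mul1r.
have [S [C [SG C0 h]]] := Bo.
(* The added ones keep the constant positive and make the averaging argument strict even when C = 0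
   or S is empty. *)
exists S, ((C + 1) * ((size S).+1)%:R); split=> //.
  by rewrite mulr_gt0 // ltr_wpDl.
move=> A GA; have hn := h A GA.
have A1 : 1 <= A ord_max ord_max by rewrite -ht_mul_origin; apply: hyp_ht_ge1; apply: (proj2 (ar_isom ar GA)); exact: origin_hyp.
have {}hn : A ord_max ord_max <= C * trace_sum S A.
  apply: le_trans hn; rewrite lorentzC lorentz_origin ht_mul_origin normrN ger0_norm //; lra.
have [[g gS hg]|ng] := pselect (exists2 h, h \in S & A ord_max ord_max <= ((C + 1) * ((size S).+1)%:R) * `|\tr (A *m h)|).
  by exists g.
exfalso.
have : trace_sum S A <= \sum_(h <- S) (A ord_max ord_max / ((C + 1) * ((size S).+1)%:R)).
  rewrite /trace_sum big_seq [X in _ <= X]big_seq; apply: ler_sum => g gS.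
  rewrite ler_pdivlMr ?mulr_gt0 // ?ltr_wpDl // mulrC leNgt; apply/negP => l; apply: ng; exists g => //; exact: ltW.
rewrite big_const_seq count_predT iter_addr_0 -[_ *+ size S]mulr_natl => h2.
have : C * trace_sum S A <= C * ((size S)%:R * (A ord_max ord_max / ((C + 1) * ((size S).+1)%:R))) by rewrite ler_wpM2l.
have -> : C * ((size S)%:R * (A ord_max ord_max / ((C + 1) * ((size S).+1)%:R))) = A ord_max ord_max * ((C / (C + 1)) * ((size S)%:R / ((size S).+1)%:R)).
  have C1 : C + 1 != 0 by rewrite gt_eqF // ltr_wpDl.
  by field; rewrite C1 andbT nat1r pnatr_eq0.
move=> h3; have : A ord_max ord_max < A ord_max ord_max; last by rewrite ltxx.
apply: le_lt_trans hn (le_lt_trans h3 _).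
rewrite -[X in _ < X]mulr1 ltr_pM2l; last by lra.
have c1 : C / (C + 1) < 1 by rewrite ltr_pdivrMr ?mul1r ?ltrDl // ltr_wpDl.
have s1 : (size S)%:R / ((size S).+1)%:R <= 1 :> R by rewrite ler_pdivrMr // mul1r ler_nat.
have c0 : 0 <= C / (C + 1) by rewrite divr_ge0 // addr_ge0.
apply: le_lt_trans c1; rewrite -[X in _ <= X]mulr1; exact: ler_wpM2l.
Qed.

End TraceNorm.

(** * Counting elements in conjugacy classes *)

Section NearAxis.
Context {R : realType} {n : nat}.
Local Notation o := (@origin R n).
Implicit Types (u w x y z : 'cV[R]_n.+1) (A B : 'M[R]_n.+1).

Lemma ch_le_exp (r : R) : ch r <= expR `|r|.
Proof. by rewrite -ch_norm; exact: ch_le_expR. Qed.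

Lemma axis0 u w : axis u w 0 = u + w.
Proof. by rewrite /axis oppr0 expR0 !scale1r. Qed.

(* With z the component of o orthogonal to the axis, <z, z - B z> >= 0. *)
Lemma hyperbolic_displacement B l u w : hyp_isom B -> hyperbolic B l u w ->
  4 * ('ht u * 'ht w) * (ch l - 1) <= B ord_max ord_max - 1.
Proof.
move=> hB h; have L := hyp_isom_Lor hB.
have [l0 Bu Bw uu ww uw u0 w0] := h.
(* The projection of o to the plane of the axis is subtracted; its coefficients follow from <o, u> =
   - u_n, <o, w> = - w_n and <u, w> = -1/2. *)
have [z zE] : exists z, z = o - ((2 * 'ht w) *: u + (2 * 'ht u) *: w) by exists (o - ((2 * 'ht w) *: u + (2 * 'ht u) *: w)).
have ou : lorentz o u = - 'ht u by rewrite lorentz_origin.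
have ow : lorentz o w = - 'ht w by rewrite lorentz_origin.
have oo : lorentz o o = -1 by case: (@origin_hyp R n).
have wu : lorentz w u = - 2^-1 by rewrite lorentzC.
have zu : lorentz z u = 0 by rewrite zE !lorentz_lin ou uu wu; field.
have zw : lorentz z w = 0 by rewrite zE !lorentz_lin ow ww uw; field.
have Bzu : lorentz (B *m z) u = 0.
  have -> : u = expR (- l) *: (B *m u) by rewrite Bu scalerA mulrC expRVN scale1r.
  by rewrite lorentzZr Lor_lorentz // zu mulr0.
have Bzw : lorentz (B *m z) w = 0.
  have -> : w = expR l *: (B *m w) by rewrite Bw scalerA expRVN scale1r.
  by rewrite lorentzZr Lor_lorentz // zw mulr0.
have zz : lorentz z z = 4 * ('ht u * 'ht w) - 1.
  have zo : lorentz z o = -1 + 4 * ('ht u * 'ht w).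
    by rewrite lorentzC zE !(lorentzDr, lorentzNr, lorentzZr) oo ou ow; ring.
  by rewrite {2}zE !(lorentzDr, lorentzNr, lorentzZr) zu zw zo; ring.
have a0 := hyperbolic_axis 0 h.
have pos : 0 <= lorentz (z - B *m z) (z - B *m z).
  have := qx_ge0 (axis u w 0) (z - B *m z).
  rewrite qxE // axis0 !lorentz_lin !(lorentzC u) !(lorentzC w) zu zw Bzu Bzw.
  by rewrite !(subr0, addr0) expr0n /= mulr0 addr0.
have le : lorentz z (B *m z) <= lorentz z z.
  move: pos; rewrite !lorentz_lin Lor_lorentz // (lorentzC (B *m z) z); lra.
have oE : o = z + ((2 * 'ht w) *: u + (2 * 'ht u) *: w) by rewrite zE subrK.
have := lorentz_origin (B *m o); rewrite ht_mul_origin => hBo.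
have e : lorentz o (B *m o) = lorentz z (B *m z) - 2 * ('ht u * 'ht w) * (expR l + expR (- l)).
  rewrite {1}oE oE !mulmxDr -!scalemxAr Bu Bw !lorentz_lin zu zw !(lorentzC _ (B *m z)) Bzu Bzw uu ww uw wu.
  by field.
rewrite /ch; move: le; rewrite zz; move: hBo; rewrite e; lra.
Qed.

(** The product of the heights of u and w is independent of their scaling and measures the distance
    of the axis from o. The parameter ln w_n rescales w to height 1. *)
Lemma axis_near_origin u w (p : R) : 0 < 'ht w -> 'ht u * 'ht w <= p ->
  exists t, - lorentz o (axis u w t) <= p + 1.
Proof.
move=> w0 hp; exists (ln ('ht w)); rewrite lorentz_origin opprK /axis !mxE expRN lnK ?posrE //.
by rewrite mulVf ?gt_eqF // [X in X + _]mulrC lerD2r.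
Qed.

Lemma hyp_lorentz_near x y : hyp_space x -> hyp_space y ->
  - lorentz x y <= 1 + sdot (x - y) (x - y) / 2.
Proof.
move=> hx hy.
have sx := hyp_sdot hx; have sy := hyp_sdot hy.
have -> : sdot (x - y) (x - y) = sdot x x - 2 * sdot x y + sdot y y.
  rewrite /sdot mulr_sumr -sumrB -big_split /=; apply: eq_bigr => i _; rewrite !mxE; ring.
rewrite lorentzE sx sy; have := sqr_ge0 ('ht x - 'ht y); rewrite !expr2; lra.
Qed.

End NearAxis.

(** * Elements of large trace *)

Section Good.
Context {R : realType} {k : nat}.
Local Notation n := k.+1.
Local Notation o := (@origin R n).
Implicit Types (u w x y z : 'cV[R]_n.+1) (A B : 'M[R]_n.+1).

(** By [hyperbolic_trace], e^l is at least de B_nn up to an additive constant, and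
    [hyperbolic_displacement] compares it with B_nn from above. This bounds u_n w_n by 2 / de, so
    the axis is near o. The threshold Y0 makes the additive errors negligible. *)
Lemma large_trace_axis (de : R) : 0 < de -> exists Y0 R0 : R, [/\ 0 < R0 &
  forall B, hyp_isom B -> Y0 <= B ord_max ord_max -> de * B ord_max ord_max <= `|\tr B| ->
  exists l u w, [/\ hyperbolic B l u w, expR l <= 4 * n.+1%:R * B ord_max ord_max &
    exists t, - lorentz o (axis u w t) <= R0]].
Proof.
move=> de0; exists ((2 * n%:R + 8) / de), (2 / de + 1); split.
  by rewrite addr_gt0 // divr_gt0.
move=> B hB hY htr; set b := B ord_max ord_max in hY htr *.
have hb : 2 * n%:R + 8 <= de * b by move: hY; rewrite ler_pdivrMr // [b * _]mulrC.
have n1 : (n.+1)%:R = n%:R + 1 :> R by rewrite natr1.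
have n0 : 0 <= n%:R :> R by rewrite ler0n.
have b1 : 1 <= b by exact: hyp_isom_nn.
have [l [u [w h]]] : exists l u w, hyperbolic B l u w.
  by apply: trace_hyperbolic => //; rewrite n1; lra.
have L := hyp_isom_Lor hB.
have := hyperbolic_trace L h => ht.
have trb : `|\tr B| <= n.+1%:R * (2 * b).
  rewrite /mxtrace; apply: le_trans (ler_norm_sum _ _ _) _.
  have -> : n.+1%:R * (2 * b) = \sum_(i < n.+1) (2 * b) by rewrite sumr_const card_ord mulr_natl.
  by apply: ler_sum => i _; exact: isom_entry.
have e1 : `|\tr B| - n%:R <= expR l.
  have := ler_normB (\tr B) (\tr B - expR l); rewrite subKr => h1.
  have := ler_normD (expR l) (\tr B - expR l); rewrite addrC subrK (ger0_norm (expR_ge0 l)) => h2; lra.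
have e2 : expR l <= `|\tr B| + n%:R.
  have := ler_normB (\tr B) (\tr B - expR l); rewrite subKr (ger0_norm (expR_ge0 l)) => h1; lra.
exists l, u, w; split=> //; first by rewrite n1 in trb *; nra.
have [_ _ _ uu ww uw u0 w0] := h.
apply: axis_near_origin => //.
have hd := hyperbolic_displacement hB h; rewrite -/b in hd.
have chl : de * b / 8 <= ch l - 1 by rewrite /ch; have := expR_ge0 (- l); lra.
have p0 : 0 <= 'ht u * 'ht w by rewrite mulr_ge0 // ltW.
have h1 : 4 * ('ht u * 'ht w) * (de * b / 8) <= b.
  apply: le_trans (_ : 4 * ('ht u * 'ht w) * (ch l - 1) <= _); last by lra.
  by rewrite ler_wpM2l // mulr_ge0.
rewrite ler_pdivlMr // -(@ler_pM2r _ b); last by lra.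
move: h1; lra.
Qed.

End Good.

(** * Group elements with axis near the base point, by conjugacy class *)

Section Classes.
Context {R : realType} {n : nat}.
Implicit Types (A B g : 'M[R]_n.+1).
Local Notation o := (@origin R n).
Context {G : set 'M[R]_n.+1} {P : 'M[R]_n.+1} {D N : nat} {rs : seq 'M[R]_n.+1}.
Hypothesis ar : arith G P D N rs.

Lemma axis_translate B l u w (j : int) : G B -> hyperbolic B l u w ->
  exists2 E, G E & E *m B = B *m E /\ forall t, E *m axis u w t = axis u w (t + j%:~R * l).
Proof.
move=> GB h; have uB := ar_u ar GB.
have inv t : invmx B *m axis u w t = axis u w (t - l).
  by rewrite -{1}(subrK l t) -(axis_shift (t - l) h) mulKmx.
case: j => a.
  elim: a => [|a [E GE [EB hE]]].
    by exists 1%:M; [exact: ar_1 ar|split=> [|t]; rewrite ?mul1mx ?mulmx1 // mul0r addr0].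
  exists (B *m E); first exact: (ar_mul ar).
  split=> [|t]; first by rewrite -mulmxA EB.
  by rewrite -mulmxA hE (axis_shift _ h) -addrA; congr axis; rewrite -!pmulrn -natr1; ring.
elim: a => [|a [E GE [EB hE]]].
  exists (invmx B); first exact: (ar_inv ar).
  by split=> [|t]; rewrite ?mulVmx ?mulmxV // inv NegzE mulN1r.
exists (invmx B *m E); first by apply: (ar_mul ar) => //; exact: (ar_inv ar).
split=> [|t]; first by rewrite -mulmxA EB !mulmxA mulVmx // mulmxV.
by rewrite -mulmxA hE inv -addrA; congr axis; rewrite !NegzE !mulrNz -!pmulrn -[a.+2%:R]natr1; ring.
Qed.

(** The bound is uniform in x: if D1 is one such element, then D' D1^-1 moves o by a bounded amount
    wherever x is. *)
Lemma near_point_finite (R1 : R) : exists m, forall x, hyp_space x ->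
  at_most [set D' | G D' /\ - lorentz o (D' *m x) <= R1] m.
Proof.
have [m hm] := ball_finite ar (2 * R1 ^+ 2); exists m => x hx.
have [[D1 [GD1 h1]]|ne] := pselect (exists D1, G D1 /\ - lorentz o (D1 *m x) <= R1); last first.
  by apply: at_most_le (leq0n _) (at_most_sub _ at_most0) => D' h; apply: ne; exists D'.
have u1 := ar_u ar GD1.
apply: (@at_most_inj _ _ (fun D' => D' *m invmx D1) _ _ _ _ _ hm) => [D' [GD' h']|D' D'' _ _ e]; last first.
  by rewrite -(mulmxKV u1 D') e mulmxKV.
split; first by apply: (ar_mul ar) => //; exact: (ar_inv ar).
have i1 := ar_isom ar GD1; have i' := ar_isom ar GD'.
have L1 := hyp_isom_Lor i1; have L' := hyp_isom_Lor i'.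
have := hyp_triangle origin_hyp (proj2 i' _ hx) (proj2 i' _ (proj2 (hyp_isom_inv i1) _ origin_hyp)).
rewrite (Lor_lorentz _ _ L') -(Lor_adj _ _ L1) (lorentzC (D1 *m x)) mulmxA lorentz_origin opprK ht_mul_origin.
have := hyp_lorentz_le origin_hyp (proj2 i' _ hx); have := hyp_lorentz_le origin_hyp (proj2 i1 _ hx).
move: h1 h'; set p := lorentz o (D' *m x); set q := lorentz o _ => h1 h' q1 p1 h2.
apply: le_trans h2 _; rewrite expr2; nra.
Qed.

(** Fix B0 in the class and write B = D0 B0 D0^-1. The point of the axis of B near o is the image
    under D0 of a point of the axis of B0. Changing D0 by a power of B0 does not change B and brings
    the parameter of that point into [0, l). Rounding it to an integer i <= T costs a distance of at
    most 1, and for each i only boundedly many conjugators remain. *)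
Lemma class_fiber (R0 : R) : 0 < R0 -> exists m, forall (T : R) c, 0 <= T ->
  at_most [set B | G B /\ homotopy_class G B = c /\ exists l u w t,
     [/\ hyperbolic B l u w, l <= T & - lorentz o (axis u w t) <= R0]] ((Num.truncn T).+1 * m).
Proof.
move=> R00; have [m hm] := near_point_finite (2 * R0 * expR 1); exists m => T c T0.
set S := [set B | _].
have [[B0 [GB0 [cB0 [l [u [w [t0 [h0 lT _]]]]]]]]|ne] := pselect (exists B0, S B0); last first.
  by apply: at_most_le (leq0n _) (at_most_sub _ at_most0) => B h; apply: ne; exists B.
have l0 := hyperb_gt0 h0.
have := at_most_bigcup (s := iota 0 (Num.truncn T).+1) (m := fun=> m)
   (F := fun i : nat => (fun D' => D' *m B0 *m invmx D') @` [set D' | G D' /\ - lorentz o (D' *m axis u w i%:R) <= 2 * R0 * expR 1]).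
rewrite big_const_seq count_predT size_iota iter_addn_0 mulnC => key.
apply: at_most_sub (key _) => [B [GB [cB [l' [u' [w' [t [h' lT' near]]]]]]]|i _]; last first.
  by apply: at_most_image; apply: hm; exact: (hyperbolic_axis _ h0).
have : homotopy_class G B0 B by rewrite cB0 -cB; exact: (homotopy_class_self ar).
move=> [D0 GD0 DB]; have iD := ar_isom ar GD0.
have h1 := hyperbolic_conj iD h0; rewrite DB in h1.
have LB := hyp_isom_Lor (ar_isom ar GB).
have [s hs] := hyperbolic_axis_unique LB h1 h'.
have conj_axis r : axis (D0 *m u) (D0 *m w) r = D0 *m axis u w r.
  by rewrite /axis mulmxDr -!scalemxAr.
rewrite hs conj_axis in near.
set r := t + s in near.
pose j := Num.floor (r / l).
have /andP [j1 j2] := floor_itv (r / l).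
rewrite -/j ler_pdivlMr // in j1; rewrite -/j ltr_pdivrMr // intrD in j2.
have [E GE [EB hE]] := axis_translate j GB0 h0.
pose r0 := r - j%:~R * l.
have r00 : 0 <= r0 by rewrite /r0; lra.
have r0l : r0 < l by rewrite /r0; lra.
pose i := Num.truncn r0.
have iT : (i < (Num.truncn T).+1)%N by rewrite ltnS; apply: le_truncn; lra.
exists i; first by rewrite mem_iota add0n.
have uE := ar_u ar GE; have uD0 := ar_u ar GD0.
exists (D0 *m E); last first.
  rewrite invmx_mulE // -DB !mulmxA; congr (_ *m _).
  by rewrite -(mulmxA D0 E B0) EB !mulmxA mulmxK.
have GDE : G (D0 *m E) by exact: (ar_mul ar).
split=> //.
have hr : - lorentz o (D0 *m E *m axis u w r0) <= R0.
  by rewrite -mulmxA hE /r0 subrK.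
have iDE := ar_isom ar GDE.
have hax s' := hyperbolic_axis s' h0.
have := hyp_triangle origin_hyp (proj2 iDE _ (hax r0)) (proj2 iDE _ (hax i%:R)).
rewrite (Lor_lorentz _ _ (hyp_isom_Lor iDE)) (lorentz_axis _ _ h0).
have b1 : ch (r0 - i%:R) <= expR 1.
  apply: le_trans (ch_le_exp _) _; rewrite ler_expR.
  have /andP[t1 t2] := truncn_itv r00; rewrite -/i -natr1 in t1 t2.
  by rewrite ger0_norm; lra.
have := ch_ge1 (r0 - i%:R); move: hr b1.
set p := lorentz o _; set q := ch _; set e1 := expR 1 => hr b1 q1 tr.
apply: le_trans tr _.
have := hyp_lorentz_le origin_hyp (proj2 iDE _ (hax r0)); rewrite -/p => p1.
nra.
Qed.

(** Round the spatial coordinates of A o; elements with equal rounding differ by an element of a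
    fixed ball. The exponent n exceeds the true order n - 1, but the bound is applied only at radius
    e^(T/2), where the loss is absorbed. *)
Lemma ball_upper : exists m, forall Z : nat,
  at_most [set A | G A /\ A ord_max ord_max <= Z%:R] ((Z.*2.+3) ^ n * m).
Proof.
have [m hm] := ball_finite ar (1 + n%:R / 2); exists m => Z.
pose f A := fun i : 'I_n => (Num.floor ((A *m o) (widen_ord (leqnSn n) i) 0))%:~R : R.
have := @at_most_int_fun R 'I_n Z.+1; rewrite card_ord doubleS => hI.
apply: (@at_most_fibers _ _ f _ _ _ _ _ hI) => [A [GA AZ] i|g _].
  split; first by rewrite intr_int.
  have hA := proj2 (ar_isom ar GA) _ (@origin_hyp R n).
  have c1 : (A *m o) (widen_ord (leqnSn n) i) 0 ^+ 2 <= sdot (A *m o) (A *m o).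
    by rewrite expr2 /sdot (bigD1 i) //= lerDl sumr_ge0 // => j _; rewrite -expr2 sqr_ge0.
  rewrite hyp_sdot // ht_mul_origin in c1.
  set x := (A *m o) _ _ in c1 *; rewrite /f -/x.
  have A1 := hyp_isom_nn (ar_isom ar GA).
  have xZ : `|x| <= Z%:R.
    rewrite -(@ler_pXn2r _ 2) ?nnegrE ?ler0n // real_normK ?num_real //.
    have : x ^+ 2 <= A ord_max ord_max ^+ 2 by lra.
    by move=> h; apply: le_trans h _; rewrite lerXn2r ?nnegrE ?ler0n //; lra.
  have /andP [f1 f2] := floor_itv x; rewrite intrD in f2.
  move: xZ; rewrite !ler_norml -natr1 => /andP [z1 z2].
  by apply/andP; split; lra.
have [[A1 [[GA1 _] fA1]]|ne] := pselect (exists A1, (G A1 /\ A1 ord_max ord_max <= Z%:R) /\ f A1 = g); last first.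
  by apply: at_most_le (leq0n _) (at_most_sub _ at_most0) => A h; apply: ne; exists A.
have u1 := ar_u ar GA1.
apply: (@at_most_inj _ _ (fun A => invmx A1 *m A) _ _ _ _ _ hm) => [A [[GA _] fA]|A A' _ _ e]; last first.
  by rewrite -(mulKVmx u1 A) e mulKVmx.
have GI := ar_inv ar GA1.
split; first exact: (ar_mul ar).
have i1 := ar_isom ar GA1; have iA := ar_isom ar GA.
have hA := proj2 iA _ (@origin_hyp R n); have hA1 := proj2 i1 _ (@origin_hyp R n).
have := hyp_lorentz_near hA1 hA.
rewrite (Lor_adj _ _ (hyp_isom_Lor i1)) mulmxA lorentz_origin opprK ht_mul_origin => h.
apply: le_trans h _; rewrite lerD2l ler_pM2r ?invr_gt0 //.
have -> : n%:R = \sum_(i < n) (1 : R) by rewrite sumr_const card_ord.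
apply: ler_sum => i _; have := congr1 (fun h => h i) (etrans fA1 (esym fA)).
rewrite /f => e.
have := floor_itv ((A1 *m o) (widen_ord (leqnSn n) i) 0); have := floor_itv ((A *m o) (widen_ord (leqnSn n) i) 0).
have xE : (A1 *m o - A *m o) (widen_ord (leqnSn n) i) 0 = (A1 *m o) (widen_ord (leqnSn n) i) 0 - (A *m o) (widen_ord (leqnSn n) i) 0.
  by rewrite mxE [X in _ + X]mxE.
rewrite !intrD -e xE; set p := (A1 *m o) _ _; set q := (A *m o) _ _; set r := _%:~R => /andP[? ?] /andP[? ?].
nra.
Qed.

(** A proper power is B'^i with i >= 2, where B' translates the same axis by l / i <= T / 2. So B'
    lies in a ball of radius of order e^(T/2), and the minimal length leaves O(T) exponents i. *)
Lemma nonprimitive_count (R0 : R) : odd n -> 0 < R0 -> exists (C : R) m, [/\ 0 < C &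
  forall (T : R) (Z : nat), 0 <= T -> C * expR (T / 2) <= Z%:R ->
  at_most [set B | G B /\ exists l u w t,
     [/\ hyperbolic B l u w, l <= T, - lorentz o (axis u w t) <= R0 &
        ~ primitive_closed_geodesic G (axis u w) B l]]
    ((Num.truncn (C * T)).+1 * (Z.*2.+3 ^ n * m))].
Proof.
move=> odn R00; have [m hm] := ball_upper; have [lm [lm0 hl]] := min_length ar odn.
pose C := 4 * R0 ^+ 2 + lm^-1; have i0 : 0 < lm^-1 by rewrite invr_gt0.
have r0 : 0 < R0 ^+ 2 by rewrite exprn_gt0.
exists C, m; split; first by rewrite /C; lra.
move=> T Z T0 hZ.
have := at_most_bigcup (s := iota 0 (Num.truncn (C * T)).+1) (m := fun=> (Z.*2.+3 ^ n * m)%N)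
   (F := fun i : nat => (fun B => B ^+ i) @` [set B | G B /\ B ord_max ord_max <= Z%:R]).
rewrite big_const_seq count_predT size_iota iter_addn_0 (mulnC (_ * m)%N) => key.
apply: at_most_sub (key _) => [B [GB [l [u [w [t [h lT near np]]]]]]|i _]; last first.
  by apply: at_most_image; exact: hm.
have cg := hyperbolic_closed GB h.
have [k [B' [k2 cg' BE]]] : exists k B', [/\ (2 <= k)%N, closed_geodesic G (axis u w) B' (l / k%:R) & B = B' ^+ k].
  by apply: contrapT => h'; apply: np; split.
have [_ GB' lk0 hB'] := cg'.
have k0 : 0 < k%:R :> R by rewrite ltr0n; apply: leq_trans k2.
have kT : (k <= Num.truncn (C * T))%N.
  have [u' [w' [h' _]]] := closed_geodesic_hyperbolic (ar_isom ar GB') cg'.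
  have := hl _ _ _ _ GB' h'; rewrite ler_pdivlMr // => lk.
  rewrite truncn_ge_nat; last by rewrite mulr_ge0 // /C; lra.
  apply: le_trans (_ : lm^-1 * T <= _).
    by rewrite -(@ler_pM2l _ lm) // mulrA divff ?gt_eqF // mul1r (le_trans lk).
  by rewrite ler_wpM2r // /C; lra.
exists k; first by rewrite mem_iota add0n ltnS.
exists B' => //; split=> //; apply: le_trans hZ.
have iB := ar_isom ar GB'; have LB := hyp_isom_Lor iB.
have ho := @origin_hyp R n.
have hax s := hyperbolic_axis s h.
have t1 := hyp_triangle ho (hax t) (proj2 iB _ ho).
have t2 := hyp_triangle (hax t) (proj2 iB _ (hax t)) (proj2 iB _ ho).
rewrite lorentz_origin opprK ht_mul_origin in t1.
rewrite (Lor_lorentz _ _ LB) {1}hB' (lorentz_axis _ _ h) (lorentzC _ o) in t2.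
have c2 : ch (t - (t + l / k%:R)) <= expR (T / 2).
  apply: le_trans (ch_le_exp _) _; rewrite ler_expR opprD addrA subrr sub0r normrN gtr0_norm //.
  apply: ler_pM; [by rewrite ltW ?(hyperb_gt0 h)|by rewrite invr_ge0 ltW|exact: lT|].
  by rewrite lef_pV2 ?posrE // ler_nat.
have c1 := ch_ge1 (t - (t + l / k%:R)).
have := hyp_lorentz_le ho (hax t).
have := hyp_lorentz_le (hax t) (proj2 iB _ ho).
move: near t1 t2 c2 c1.
set p := lorentz o (axis _ _ _); set q := lorentz (axis _ _ _) _; set c := ch _; set b := B' _ _; set e := expR _.
move=> near t1 t2 c2 c1 q1 p1.
have e1 : - q <= 2 * R0 * e by nra.
have e2 : b <= 4 * R0 ^+ 2 * e.
  apply: le_trans t1 _; rewrite expr2; nra.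
apply: le_trans e2 _; apply: ler_wpM2r; [by lra|by rewrite /C; lra].
Qed.

Lemma spectrum_finite (T : R) : odd n -> 0 <= T -> finite_set (spectrum_upto G T).
Proof.
move=> odn T0; have [m hm] := lengths_finite ar odn T0.
suff /at_most_finite [] : at_most (spectrum_upto G T) m by [].
apply: at_most_sub hm => l [[c [A [cg _]]] lT]; split=> //.
have [_ GA _ _] := cg.
have [u [w [h _]]] := closed_geodesic_hyperbolic (ar_isom ar GA) cg.
by exists A, u, w.
Qed.

(** Here the convention of value 0 for infinite sets is shown to be harmless: spectrum and classes
    are finite, so [geodesic_count] is a true cardinality. *)
Lemma classes_at_most (T : R) : odd n -> 0 <= T -> exists2 M : nat, M%:R = geodesic_count G T &
  at_most [set c | exists2 l, l <= T & primitive_classes G l c] M.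
Proof.
move=> odn T0; have fs := spectrum_finite odn T0.
exists (\sum_(l <- fset_set (spectrum_upto G T)) multiplicity G l)%N.
  by rewrite /geodesic_count fsbig_finite //= natr_sum.
apply: at_most_sub (at_most_bigcup (F := fun l => primitive_classes G l) _) => [c [l lT pc]|l _].
  exists l => //; rewrite in_fset_set // inE; split=> //.
  by case: pc => A [c' pg] _; exists c', A.
have [m hm] := classes_finite ar odn (normr_ge0 l).
apply: finite_at_most; apply: (proj1 (at_most_finite (m := m) _)).
apply: at_most_sub hm => c [A [c' [cg _]] <-]; exists A => //.
have [_ GA _ _] := cg; split=> //.
have [u [w [h _]]] := closed_geodesic_hyperbolic (ar_isom ar GA) cg.
by exists l, u, w; split=> //; exact: ler_norm.
Qed.

Lemma primitive_count (R0 : R) : odd n -> 0 < R0 -> exists m, forall (T : R), 0 <= T -> exists2 M : nat, M%:R = geodesic_count G T &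
  at_most [set B | G B /\ exists l u w t,
     [/\ hyperbolic B l u w, l <= T, - lorentz o (axis u w t) <= R0 &
        primitive_closed_geodesic G (axis u w) B l]]
    (M * ((Num.truncn T).+1 * m)).
Proof.
move=> odn R00; have [m hm] := class_fiber R00; exists m => T T0.
have [M ME hM] := classes_at_most odn T0; exists M => //.
apply: (@at_most_fibers _ _ (homotopy_class G) _ _ _ _ _ hM) => [B [GB [l [u [w [t [h lT near pr]]]]]]|c _].
  by exists l => //; exists B => //; exists (axis u w).
apply: at_most_sub (hm T c T0) => B [[GB [l [u [w [t [h lT near pr]]]]]] cB].
by split=> //; split=> //; exists l, u, w, t.
Qed.

End Classes.

(** * Lower bound for the number of closed geodesics *)

Lemma trunc_count_bound (R : realType) (C x T : R) : 0 <= C -> 0 <= T -> 1 <= x -> T <= 2 * x ->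
  (Num.truncn (C * T)).+1%:R <= (2 * C + 1) * x.
Proof.
move=> C0 T0 x1 Tx; have /truncn_itv/andP[h _] : 0 <= C * T by rewrite mulr_ge0.
rewrite -natr1; have : C * T <= C * (2 * x) by rewrite ler_wpM2l.
lra.
Qed.

(* K is the integer part of e^T / a; the term of size e^((k+2)T/2) is absorbed by
   half of the left hand side, of size e^(kT). *)
Lemma lower_asymptotics (R : realType) (k C0 s m3 m4 m5 K0 : nat) (a C3 : R) (g : R -> R) :
  (4 < k.+1)%N -> 0 < a -> 0 < C3 ->
  (forall T (K : nat), 0 <= T -> (K0 <= K)%N -> a * K%:R <= expR T ->
    exists2 M : nat, M%:R = g T &
    (K ^ k <= C0 * ((m5 + (M * ((Num.truncn T).+1 * m4) +
      (Num.truncn (C3 * T)).+1 * ((Num.truncn (C3 * expR (T / 2))).+1.*2.+3 ^ k.+1 * m3))) * s))%N) ->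
  exists c T0 : R, [/\ 0 < c, 0 < T0 &
    forall T, T0 <= T -> c * (expR (k%:R * T) / T) <= g T].
Proof.
move=> n4 a0 C30 main.
pose q := (2 * a)^-1 ^+ k; have q0 : 0 < q by rewrite exprn_gt0 // invr_gt0 mulr_gt0.
pose b : R := C0%:R * s%:R.
have b0 : 0 <= b by rewrite mulr_ge0.
pose C6 := b * (m5%:R + (2 * C3 + 1) * ((2 * C3 + 5) ^+ k.+1 * m3%:R)).
have C60 : 0 <= C6.
  by rewrite mulr_ge0 // addr_ge0 // mulr_ge0 ?addr_ge0 ?mulr_ge0 ?exprn_ge0 ?addr_ge0 ?mulr_ge0 // ltW.
pose B := 2 * b * m4%:R + 1.
have B0 : 0 < B by rewrite ltr_wpDl // !mulr_ge0.
(* Once x = e^(T/2) exceeds X, half of the main term dominates the error C6 x^(k+2), and K is at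
   least K0 and at least e^T / (2 a). *)
pose X := 1 + 2 * C6 / q + 2 * a + a * (K0%:R + 1).
have X1 : 1 <= X.
  have : 0 <= C6 / q by rewrite divr_ge0 // ltW.
  have : 0 <= a * (K0%:R + 1) by rewrite mulr_ge0 ?addr_ge0 // ltW.
  by rewrite /X; lra.
exists (q / 2 / B), (2 * X + 1); split; [by rewrite !divr_gt0|lra|].
move=> T T0; have T1 : 1 <= T by lra.
have T00 : 0 <= T := le_trans ler01 T1.
pose x := expR (T / 2).
have xT : T / 2 + 1 <= x by have := expR_ge1Dx (T / 2); rewrite -/x; lra.
have xX : X <= x by lra.
have x1 : 1 <= x by lra.
have xE : x ^+ 2 = expR T by rewrite /x -expRM_natl; congr expR; field.
pose K := Num.truncn (expR T / a).
have E0 : 0 <= expR T / a by rewrite divr_ge0 ?expR_ge0 // ltW.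
have /andP [K1 K2] := truncn_itv E0; rewrite -/K -natr1 in K1 K2.
have Ea : 2 * a <= expR T /\ a * (K0%:R + 1) <= expR T.
  have h1 : X <= expR T by rewrite -xE expr2; nra.
  have : 0 <= C6 / q by rewrite divr_ge0 // ltW.
  have : 0 <= a * (K0%:R + 1) by rewrite mulr_ge0 ?addr_ge0 // ltW.
  by move: h1; rewrite /X; clear -a0; move=> *; split; lra.
have KE : expR T / (2 * a) <= K%:R.
  have : 1 <= expR T / (2 * a) by rewrite ler_pdivlMr ?mul1r ?mulr_gt0 //; case: Ea.
  have -> : expR T / (2 * a) = expR T / a / 2 by field; rewrite gt_eqF.
  lra.
have K0K : (K0 <= K)%N.
  rewrite -(ler_nat R); have : K0%:R + 1 <= expR T / a by rewrite ler_pdivlMr // mulrC; case: Ea.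
  lra.
have aK : a * K%:R <= expR T by rewrite mulrC -ler_pdivlMr.
have [M ME hM] := main T K (le_trans ler01 T1) K0K aK.
rewrite -ME.
pose t1 : R := (Num.truncn T).+1%:R; pose t2 : R := (Num.truncn (C3 * T)).+1%:R.
pose t3 : R := 2 * (Num.truncn (C3 * x)).+1%:R + 3.
have hM' : K%:R ^+ k <= b * (m5%:R + (M%:R * (t1 * m4%:R) + t2 * (t3 ^+ k.+1 * m3%:R))).
  have -> : b * (m5%:R + (M%:R * (t1 * m4%:R) + t2 * (t3 ^+ k.+1 * m3%:R))) =
     C0%:R * ((m5%:R + (M%:R * (t1 * m4%:R) + t2 * (t3 ^+ k.+1 * m3%:R))) * s%:R).
    by rewrite /b; ring.
  have -> : t3 = ((Num.truncn (C3 * x)).+1.*2.+3)%:R by rewrite /t3 -[_.*2.+3]addn3 natrD -mul2n natrM.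
  by rewrite /t1 /t2 -!(natrM, natrD, natrX) ler_nat.
have ht1 : t1 <= 2 * T.
  have /truncn_itv/andP[h _] := T00.
  by rewrite /t1 -natr1; lra.
have ht2 : t2 <= (2 * C3 + 1) * x by apply: trunc_count_bound => //; [exact: ltW|lra].
have ht3 : t3 <= (2 * C3 + 5) * x.
  rewrite /t3 -natr1; have /truncn_itv/andP[h _] : 0 <= C3 * x by rewrite mulr_ge0 // ltW // (lt_le_trans ltr01).
  by lra.
have t20 : 0 <= t2 by rewrite ler0n.
have t30 : 0 <= t3 by rewrite addr_ge0 // mulr_ge0.
have up : K%:R ^+ k <= B * T * M%:R + C6 * x ^+ k.+2.
  apply: le_trans hM' _.
  have h1 : M%:R * (t1 * m4%:R) <= M%:R * (2 * T * m4%:R) by rewrite ler_wpM2l // ler_wpM2r.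
  have h2 : t2 * (t3 ^+ k.+1 * m3%:R) <= (2 * C3 + 1) * x * (((2 * C3 + 5) * x) ^+ k.+1 * m3%:R).
    apply: ler_pM => //; first by rewrite mulr_ge0 // exprn_ge0.
    by rewrite ler_wpM2r // lerXn2r // nnegrE mulr_ge0 //; lra.
  have h3 : m5%:R <= m5%:R * x ^+ k.+2.
    by rewrite -[X in X <= _]mulr1 ler_wpM2l // exprn_ege1.
  have e : B * T * M%:R + C6 * x ^+ k.+2 = T * M%:R + b * (m5%:R * x ^+ k.+2 + (M%:R * (2 * T * m4%:R) +
    (2 * C3 + 1) * x * (((2 * C3 + 5) * x) ^+ k.+1 * m3%:R))).
    by rewrite /B /C6 exprMn [x ^+ k.+2]exprS; ring.
  rewrite e; apply: (@ler_wpDl _ _ (T * M%:R)); first by rewrite mulr_ge0 //; lra.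
  by rewrite ler_wpM2l // lerD // lerD.
have low : q * x ^+ (2 * k) <= K%:R ^+ k.
  have -> : q * x ^+ (2 * k) = (expR T / (2 * a)) ^+ k.
    by rewrite exprM xE /q mulrC -exprMn.
  by rewrite lerXn2r // nnegrE // divr_ge0 ?expR_ge0 // mulr_ge0 // ltW.
have mid : C6 * x ^+ k.+2 <= q / 2 * x ^+ (2 * k).
  have h1 : C6 <= q / 2 * x.
    have : 2 * C6 / q <= x.
      have : 0 <= a * (K0%:R + 1) by rewrite mulr_ge0 ?addr_ge0 // ltW.
      by move: xX; rewrite /X; lra.
    by rewrite ler_pdivrMr //; lra.
  apply: le_trans (_ : q / 2 * x * x ^+ k.+2 <= _); first by rewrite ler_wpM2r // exprn_ge0 //; lra.
  rewrite -mulrA -exprS ler_wpM2l //; first by rewrite divr_ge0 // ltW.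
  (* One factor x has been spent on absorbing the constant C6, so the exponent to compare with 2 k
     is k + 3. *)
  have kk : (k.+3 <= 2 * k)%N by clear -n4; lia.
  by rewrite ler_weXn2l.
have xk : expR (k%:R * T) = x ^+ (2 * k) by rewrite exprM xE -expRM_natl.
rewrite xk mulrAC ler_pdivrMr // mulrA ler_pdivrMr; last by lra.
have -> : q / 2 * x ^+ (2 * k) = q * x ^+ (2 * k) - q / 2 * x ^+ (2 * k) by field.
have -> : M%:R * B * T = B * T * M%:R by ring.
lra.
Qed.

Section LowerBound.
Context {R : realType} {k : nat}.
Local Notation n := k.+1.
Local Notation o := (@origin R n).
Implicit Types (A B g : 'M[R]_n.+1).
Context {G : set 'M[R]_n.+1} {P : 'M[R]_n.+1} {D N : nat} {rs : seq 'M[R]_n.+1}.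
Hypothesis ar : arith G P D N rs.

Lemma isom_mul_nn A B : hyp_isom A -> hyp_isom B ->
  (A *m B) ord_max ord_max <= 2 * A ord_max ord_max * B ord_max ord_max.
Proof.
move=> hA hB; have ho := @origin_hyp R n.
have := hyp_triangle ho (proj2 hA _ ho) (proj2 hA _ (proj2 hB _ ho)).
rewrite (Lor_lorentz _ _ (hyp_isom_Lor hA)) mulmxA !lorentz_origin !ht_mul_origin opprK; lra.
Qed.

(** Each A is replaced by A h, with h in S making the trace large. This is at most |S| to one, and h
    changes the size by a factor of at most 2 H. *)
Lemma ball_split (S : seq 'M[R]_n.+1) (C1 H Y : R) m :
  0 < C1 -> (forall h, h \in S -> G h /\ h ord_max ord_max <= H) ->
  (forall A, G A -> exists2 h, h \in S & A ord_max ord_max <= C1 * `|\tr (A *m h)|) ->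
  at_most [set B | G B /\ B ord_max ord_max <= 2 * H * Y /\
     B ord_max ord_max <= 2 * H * C1 * `|\tr B|] m ->
  at_most [set A | G A /\ A ord_max ord_max <= Y] (m * size S).
Proof.
move=> C10 hS htr hm.
have /choice[h hh] : forall A, exists h, G A -> h \in S /\ A ord_max ord_max <= C1 * `|\tr (A *m h)|.
  move=> A; have [GA|nG] := pselect (G A); last by exists 1%:M.
  by have [h hS' h1] := htr A GA; exists h.
apply: (@at_most_fibers _ _ (fun A => A *m h A) _ _ _ _ _ hm) => [A [GA AY]|B _].
  have [hS' h1] := hh A GA; have [Gh hH] := hS _ hS'.
  have iA := ar_isom ar GA; have ih := ar_isom ar Gh.
  have A1 := hyp_isom_nn iA; have H1 := hyp_isom_nn ih.
  have le : (A *m h A) ord_max ord_max <= 2 * H * A ord_max ord_max.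
    by apply: le_trans (isom_mul_nn iA ih) _; rewrite mulrAC ler_wpM2r ?ler_wpM2l //; lra.
  split; first exact: (ar_mul ar).
  split; apply: le_trans le _; first by rewrite ler_wpM2l //; lra.
  by rewrite -[X in _ <= X]mulrA ler_wpM2l //; lra.
apply: (@at_most_inj _ _ h _ _ _ _ _ (at_most_seq S)) => [A [[GA _] _]|A A' [[GA _] eA] [[GA' _] eA'] e].
  by have [] := hh A GA.
have [hS' _] := hh A GA; have [Gh _] := hS _ hS'; have uh := ar_u ar Gh.
by rewrite -(mulmxK uh A) eA -eA' -e mulmxK.
Qed.

Lemma geodesic_lower : odd n -> (4 < n)%N -> ~ cocompact G -> exists c T0 : R, [/\ 0 < c, 0 < T0 &
  forall T, T0 <= T -> c * (expR (k%:R * T) / T) <= geodesic_count G T].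
Proof.
move=> odn n4 nc.
have [S [C1 [C10 SG htr]]] := trace_norm ar odn (leq_trans (isT : 2 <= 5)%N n4) nc.
have [H [H0 hH]] := at_most_bounded (fun h : 'M[R]_n.+1 => h ord_max ord_max) (at_most_seq S).
have hS h : h \in S -> G h /\ h ord_max ord_max <= H by move=> hs; split; [exact: SG|exact: hH].
pose de := (2 * H * C1)^-1; have de0 : 0 < de by rewrite invr_gt0 !mulr_gt0.
have [Y0 [R0 [R00 haxis]]] := large_trace_axis (k := k) de0.
have [C2 [C0 [K0 [C20 C00 hball]]]] := ball_lower ar (ltn_trans (isT : 0 < 3)%N n4) odn.
have [C3 [m3 [C30 hnon]]] := nonprimitive_count ar odn R00.
have [m4 hprim] := primitive_count ar odn R00.
have [m5 h5] := ball_finite ar Y0.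
(* For a K <= e^T, the products B with B_nn <= 2 H C2 K satisfy e^l <= 4 (n + 1) B_nn <= e^T. *)
pose a := 8 * n.+1%:R * H * C2.
have a0 : 0 < a by rewrite /a !mulr_gt0.
have main T (K : nat) : 0 <= T -> (K0 <= K)%N -> a * K%:R <= expR T ->
  exists2 M : nat, M%:R = geodesic_count G T &
  (K ^ k <= C0 * ((m5 + (M * ((Num.truncn T).+1 * m4) +
    (Num.truncn (C3 * T)).+1 * ((Num.truncn (C3 * expR (T / 2))).+1.*2.+3 ^ n * m3))) * size S))%N.
  move=> T0 K0K aK; have [M ME hM] := hprim T T0; exists M => //.
  apply: hball => //.
  apply: (@ball_split S C1 H _ _ C10 hS htr).
  have hN := hnon T (Num.truncn (C3 * expR (T / 2))).+1 T0 (ltW (truncnS_gt _)).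
  apply: at_most_sub (at_mostU h5 (at_mostU hM hN)) => B [GB [BY Btr]].
  have [le|gt] := lerP (B ord_max ord_max) Y0; first by left.
  have [|l [u [w [hB el [t ht]]]]] := haxis B (ar_isom ar GB) (ltW gt).
    by rewrite /de ler_pdivrMl // !mulr_gt0.
  have lT : l <= T.
    rewrite -ler_expR; apply: le_trans el _; apply: le_trans aK.
    apply: le_trans (_ : 4 * n.+1%:R * (2 * H * (C2 * K%:R)) <= _); last by rewrite /a; lra.
    by rewrite ler_wpM2l // mulr_ge0.
  by right; have [pr|npr] := pselect (primitive_closed_geodesic G (axis u w) B l);
    [left|right]; split=> //; exists l, u, w, t.
exact: (lower_asymptotics n4 a0 C30 main).
Qed.

End LowerBound.

(** * Determinants of skew-symmetric matrices *)

Section SkewDeterminant.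
Context {F : fieldType}.

Lemma det_schur (p q : nat) (E : 'M[F]_p) X Z (Y : 'M[F]_q) : E \in unitmx ->
  \det (block_mx E X Z Y) = \det E * \det (Y - Z *m invmx E *m X).
Proof.
move=> uE.
have -> : block_mx E X Z Y = block_mx 1%:M 0 (Z *m invmx E) 1%:M *m block_mx E X 0 (Y - Z *m invmx E *m X).
  by rewrite mulmx_block !mul1mx !mul0mx !addr0 mulmxKV // addrC subrK.
by rewrite det_mulmx det_lblock det_ublock !det1 !mul1r.
Qed.

Lemma skew_diag (d : nat) (S : 'M[F]_d) i : 2 != 0 :> F -> S^T = - S -> S i i = 0.
Proof.
move=> c2 /matrixP /(_ i i); rewrite !mxE => e; apply/eqP.
by rewrite -(mulIr_eq0 _ (mulIf c2)) mulr2n mulrDr !mulr1 {1}e addNr.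
Qed.

(* r is, up to sign, the Pfaffian of S. *)
Lemma skew_det_square (d : nat) (S : 'M[F]_d) : 2 != 0 :> F -> S^T = - S ->
  exists r, \det S = r ^+ 2.
Proof.
move=> c2; have [m] := ubnP d; elim: m => // m IH in d S *.
case: d S => [|[|d]] S; rewrite ?ltnS => dm skS.
- by exists 1; rewrite det_mx00 expr1n.
- by exists 0; rewrite det_mx11 (skew_diag _ c2 skS) expr0n.
have [/existsP [j Sj]|] := boolP [exists j, S ord0 j != 0]; last first.
  rewrite negb_exists => /forallP h; exists 0; rewrite (expand_det_row _ ord0) big1 ?expr0n // => j _.
  by have := h j; rewrite negbK => /eqP ->; rewrite mul0r.
have j0 : j != ord0 by apply: contraNneq Sj => ->; rewrite (skew_diag _ c2 skS).
(* A transposition of rows and columns brings a nonzero entry of the first row to position (0, 1).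
   The leading block of size 2 is then invertible with square determinant, and its Schur complement
   is skew-symmetric of size d. *)
pose i1 : 'I_d.+2 := lift ord0 ord0.
pose s := tperm i1 j.
have ss : (s * s = 1)%g by exact: tperm2.
pose T := perm_mx s *m S *m perm_mx s.
have dT : \det T = \det S.
  rewrite !det_mulmx mulrC mulrA -det_mulmx -perm_mxM ss perm_mx1 det1 mul1r //.
have skT : T^T = - T.
  rewrite /T !trmx_mul skS tr_perm_mx tpermV mulNmx mulmxN mulmxA //.
have T01 : T ord0 i1 != 0.
  rewrite /T -row_permE -[s]invgK -col_permE invgK.
  by rewrite !mxE /s tpermV tpermL tpermD // eq_sym.
clearbody T; rewrite -dT => {S skS s ss dT Sj j j0}.
have := congr1 (fun M : 'M[F]_(2 + d) => M) (submxK (T : 'M[F]_(2 + d))).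
set E := ulsubmx _; set X := ursubmx _; set Z := dlsubmx _; set Y := drsubmx _ => TE.
have /matrixP skTE := skT.
have EE (i j : 'I_2) : E i j = T (lshift d i) (lshift d j) by rewrite /E !mxE.
have dE : \det E = T ord0 i1 ^+ 2.
  have -> : \det E = E 0 0 * E 1 1 - E 0 1 * E 1 0.
    rewrite (expand_det_row _ 0) !big_ord_recl big_ord0 /cofactor !det_mx11 !mxE.
    have -> : lift 0 0 = 1 :> 'I_2 by apply: val_inj.
    have -> : lift 1 0 = 0 :> 'I_2 by apply: val_inj.
    by rewrite /= !expr0 expr1 !mul1r addr0 mulN1r mulrN.
  rewrite !EE.
  have -> : lshift d 0 = ord0 :> 'I_(2 + d) by apply: val_inj.
  have -> : lshift d 1 = i1 :> 'I_(2 + d) by apply: val_inj.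
  rewrite !(skew_diag _ c2 skT) mulr0 sub0r.
  have := skTE i1 ord0; rewrite !mxE => e.
  by rewrite expr2 {3}e mulrN.
have uE : E \in unitmx by rewrite unitmxE dE unitfE expf_neq0.
have [skE skX skY] : [/\ E^T = - E, Z = - X^T & Y^T = - Y].
  split; apply/matrixP => a b; rewrite !mxE.
  - by have := skTE (lshift d a) (lshift d b); rewrite !mxE.
  - by have := skTE (rshift 2 a) (lshift d b); rewrite !mxE => ->; rewrite opprK.
  - by have := skTE (rshift 2 a) (rshift 2 b); rewrite !mxE.
have skS : (Y - Z *m invmx E *m X)^T = - (Y - Z *m invmx E *m X).
  rewrite linearB /= !trmx_mul trmx_inv skE skY skX linearN /= trmxK.
  have -> : invmx (- E) = - invmx E.
    have uN : - E \in unitmx by rewrite -skE unitmx_tr.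
    by apply: (can_inj (mulKmx uN)); rewrite mulmxV // mulNmx mulmxN opprK mulmxV.
  by rewrite !(mulNmx, mulmxN) !opprK opprD mulmxA.
have [r hr] := IH d _ (ltn_trans (ltnSn d) dm) skS.
exists (T ord0 i1 * r).
transitivity (\det (block_mx E X Z Y)); first exact: (congr1 determinant (esym TE)).
by rewrite det_schur // dE hr exprMn.
Qed.

End SkewDeterminant.

(** * Values and scaling of characteristic polynomials *)

Section CharPoly.

Lemma horner_char_poly (F : comNzRingType) (d : nat) (M : 'M[F]_d) x :
  (char_poly M).[x] = \det (x%:M - M).
Proof.
rewrite /char_poly -horner_evalE -det_map_mx; congr determinant; apply/matrixP => i j.
by rewrite !mxE /= horner_evalE hornerD hornerN hornerC hornerMn hornerX.
Qed.

(* (1 + B^T) Q (B - 1) = Q B - B^T Q is skew-symmetric. *)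
Lemma isometry_disc_square (F : fieldType) (d : nat) (Q B : 'M[F]_d) : 2 != 0 :> F -> ~~ odd d ->
  Q^T = Q -> B^T *m Q *m B = Q ->
  exists r, \det Q * ((char_poly B).[1] * (char_poly B).[-1]) = r ^+ 2.
Proof.
move=> c2 ed sQ sB.
have sk : (Q *m B - B^T *m Q)^T = - (Q *m B - B^T *m Q).
  by rewrite linearB /= !trmx_mul trmxK sQ opprB.
have [r hr] := skew_det_square c2 sk; exists r; rewrite -hr.
have -> : Q *m B - B^T *m Q = (1%:M + B^T) *m Q *m (B - 1%:M).
  by rewrite mulmxBr mulmx1 !mulmxDl !mul1mx sB opprD addrA addrK.
have neg (M : 'M[F]_d) : \det (- M) = \det M.
  by rewrite -scaleN1r detZ -signr_odd (negbTE ed) expr0 mul1r.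
rewrite !det_mulmx !horner_char_poly -[1%:M + B^T]trmxK det_tr linearD /= trmx1 trmxK.
rewrite -(neg (B - 1%:M)) opprB -(neg (1%:M + B)) opprD.
have -> : (-1)%:M = - 1%:M :> 'M[F]_d by rewrite raddfN.
ring.
Qed.

(** Used to clear denominators: if c M is integral, then c^d times a coefficient of the
    characteristic polynomial of M is integral. *)
Lemma char_polyZ (F : idomainType) (d : nat) (c : F) (M : 'M[F]_d) i :
  c ^+ i * (char_poly (c *: M))`_i = c ^+ d * (char_poly M)`_i.
Proof.
have e : char_poly (c *: M) \Po (c *: 'X) = c ^+ d *: char_poly M.
  rewrite /char_poly -[LHS]/(comp_poly (c *: 'X) _) -det_map_mx -[c ^+ d *: _]mul_polyC polyC_exp -detZ; congr determinant.
  apply/matrixP => a b; rewrite !mxE rmorphB rmorphMn /= comp_polyX comp_polyC mulrBr polyCM.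
  by rewrite -mul_polyC mulrnAr.
rewrite -[RHS]coefZ -e coef_comp_poly.
have [lt|ge] := ltnP i (size (char_poly (c *: M))).
  rewrite (bigD1 (Ordinal lt)) //= big1 ?addr0 => [|j ji].
    by rewrite exprZn coefZ coefXn eqxx mulr1 mulrC.
  have ji' : (i == j) = false by apply/negbTE; rewrite eq_sym; move: ji; rewrite -val_eqE.
  by rewrite exprZn coefZ coefXn ji' !mulr0.
rewrite nth_default // mulr0 big1 // => j _.
by rewrite exprZn coefZ coefXn gtn_eqF ?mulr0 // (leq_trans (ltn_ord j)).
Qed.

End CharPoly.

(** * Pairs of integers with a prescribed square class *)

Section Harmonic.
Context {R : realType}.

Lemma harmonic_le (N : nat) : (0 < N)%N ->
  \sum_(w <- iota 1 N) (w%:R : R)^-1 <= 1 + ln N%:R.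
Proof.
case: N => // N _; elim: N => [|N IH]; first by rewrite big_seq1 invr1 ln1 addr0.
rewrite -[N.+2]addn1 iotaD big_cat /= big_seq1 add1n.
apply: le_trans (lerD IH (lexx _)) _; rewrite -addrA lerD2l addn1.
have n1 : (N.+2)%:R = N.+1%:R + 1 :> R by rewrite natr1.
have n0 : 0 < N.+1%:R :> R by rewrite ltr0n.
have h : ln (N.+1%:R / N.+2%:R) <= N.+1%:R / N.+2%:R - 1 :> R.
  have := @le_ln1Dx R (N.+1%:R / N.+2%:R - 1); rewrite [1 + _]addrC subrK; apply.
  by rewrite ltrBrDl subrr divr_gt0.
rewrite ln_div ?posrE // in h.
have e : N.+1%:R / N.+2%:R - 1 = - (N.+2%:R)^-1 :> R
  by apply: (@mulIf _ N.+2%:R); rewrite ?pnatr_eq0 // mulrBl divfK ?pnatr_eq0 // mul1r mulNr mulVf ?pnatr_eq0 // n1; ring.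
by rewrite -lerBrDr -lerBlDl -e.
Qed.

(** Divide a and c by their gcd: the cofactors u and v are coprime and u b = v^2 gcd(a, c), so u
    divides the gcd, and g is the quotient. *)
Lemma sqpair_param (a b c : nat) : (0 < a)%N -> (a * b = c ^ 2)%N ->
  exists g u v, (a = g * u ^ 2 /\ b = g * v ^ 2)%N.
Proof.
move=> a0 e; pose g0 := gcdn a c.
have g00 : (0 < g0)%N by rewrite gcdn_gt0 a0.
have [u au] : exists u, a = (u * g0)%N by apply/dvdnP; exact: dvdn_gcdl.
have [v cv] : exists v, c = (v * g0)%N by apply/dvdnP; exact: dvdn_gcdr.
have cop : coprime u v.
  rewrite /coprime -(eqn_pmul2r g00) mul1n muln_gcdl -au -cv //.
have ub : (u * b = v ^ 2 * g0)%N.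
  apply/eqP; rewrite -(eqn_pmul2r g00); apply/eqP.
  by rewrite mulnAC -au e cv expnMn -mulnA.
have ug : (u %| g0)%N.
  by rewrite -(Gauss_dvdr _ (_ : coprime u (v ^ 2))) ?coprimeXr // -ub dvdn_mulr.
have [g gE] := dvdnP ug.
have u0 : (0 < u)%N by move: a0; rewrite au muln_gt0 => /andP[].
exists g, u, v; split; first by rewrite {1}au gE mulnCA mulnn.
by apply/eqP; rewrite -(eqn_pmul2l u0) ub gE; apply/eqP; ring.
Qed.

Definition sqpairs (N : nat) := [set p : nat * nat |
  [/\ (0 < p.1 <= N)%N, (0 < p.2 <= N)%N & exists c, (p.1 * p.2 = c ^ 2)%N]].

(** Write the pair as (g u^2, g v^2) and let w be the larger of u and v. There are at most N / w^2
    values of g and w values of the smaller one, in either order; summing 2 N / w gives the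
    logarithm, which becomes the factor T in the number of lengths. *)
Lemma sqpairs_count (N : nat) : (0 < N)%N ->
  exists2 m, m%:R <= 2 * N%:R * (1 + ln N%:R) :> R & at_most (sqpairs N) m.
Proof.
move=> N0; pose W (w : nat) : set (nat * nat) :=
   ((fun p : 'I_(N %/ w ^ 2) * 'I_w => (p.1.+1 * w ^ 2, p.1.+1 * p.2.+1 ^ 2)%N) @` setT) `|`
   ((fun p : 'I_(N %/ w ^ 2) * 'I_w => (p.1.+1 * p.2.+1 ^ 2, p.1.+1 * w ^ 2)%N) @` setT).
pose mu w := (N %/ w ^ 2 * w + N %/ w ^ 2 * w)%N.
exists (\sum_(w <- iota 1 N) mu w)%N.
  rewrite natr_sum; apply: le_trans (_ : \sum_(w <- iota 1 N) 2 * N%:R * (w%:R : R)^-1 <= _); last first.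
    by rewrite -mulr_sumr ler_wpM2l ?mulr_ge0 // harmonic_le.
  rewrite big_seq [X in _ <= X]big_seq; apply: ler_sum => w; rewrite mem_iota => /andP [w1 _].
  have w0 : 0 < w%:R :> R by rewrite ltr0n.
  rewrite ler_pdivlMr // -[2]/(2%:R) -!natrM ler_nat /mu.
  have := leq_trunc_div N (w ^ 2); rewrite expnS expn1; nia.
apply: at_most_sub (at_most_bigcup (F := W) _) => [[a b] [/= /andP [a0 aN] /andP [b0 bN] [c abc]]|w _]; last first.
  by apply: at_mostU; apply: at_most_image; have := @at_most_finType ('I_(N %/ w ^ 2) * 'I_w)%type setT;
    rewrite card_prod !card_ord.
have [g [u [v [au bv]]]] := sqpair_param a0 abc.
have g0 : (0 < g)%N by move: a0; rewrite au muln_gt0 => /andP[].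
have u0 : (0 < u)%N by move: a0; rewrite au muln_gt0 expn_gt0 orbF => /andP[].
have v0 : (0 < v)%N by move: b0; rewrite bv muln_gt0 expn_gt0 orbF => /andP[].
have key w : (0 < w)%N -> (g * w ^ 2 <= N)%N -> w \in iota 1 N /\ (g.-1 < N %/ w ^ 2)%N.
  move=> w0 gw; rewrite mem_iota w0 add1n ltnS; split.
    apply: leq_trans gw; rewrite expnS expn1 mulnA -{1}(mul1n w) leq_pmul2r // muln_gt0 g0 //.
  by rewrite prednK // leq_divRL // expn_gt0 w0.
have [vu|uv] := leqP v u.
  have [|mu' gu] := key u u0; first by rewrite -au.
  have vu' : (v.-1 < u)%N by rewrite prednK.
  exists u => //; left; exists (Ordinal gu, Ordinal vu') => //=.
  by rewrite !prednK // au bv.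
have [|mv gv] := key v v0; first by rewrite -bv.
have uv' : (u.-1 < v)%N by rewrite prednK // ltnW.
exists v => //; right; exists (Ordinal gv, Ordinal uv') => //=.
by rewrite !prednK // au bv.
Qed.

Lemma nat_rat_square (K : nat) (s : rat) : K%:R = s ^+ 2 -> exists c, (K = c ^ 2)%N.
Proof.
move=> e; pose x := `|numq s|%N; pose y := `|denq s|%N.
have y0 : (0 < y)%N by rewrite absz_gt0 denq_neq0.
have xy : (K * y ^ 2 = x ^ 2)%N.
  have h : (K%:Z * denq s ^+ 2)%R = (numq s ^+ 2)%R.
    by apply: (@intr_inj rat); rewrite intrM !rmorphXn /= numqE exprMn -e.
  by have := congr1 absz h; rewrite abszM !abszX.
have : (y ^ 2 %| x ^ 2)%N by rewrite -xy dvdn_mull.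
rewrite dvdn_pexp2r // => /dvdnP [c xc].
exists c; apply/eqP; rewrite -(@eqn_pmul2r (y ^ 2)) ?expn_gt0 ?y0 // -expnMn -xc xy //.
Qed.

(** For ka = p / q, multiplication by q^2 shows that |p q a| |b| is a rational square, hence an
    integral one, so (|p q a|, |b|) is counted by [sqpairs]. Signs cost a factor 4, and pairs with a
    zero entry are counted apart. *)
Lemma square_int_pairs (ka : rat) : ka != 0 -> exists2 C : R, 0 < C &
  forall N : nat, (0 < N)%N -> exists2 m, m%:R <= C * (N%:R * (1 + ln N%:R)) &
   at_most [set p : R * R | [/\ p.1 \is a Num.int /\ `|p.1| <= N%:R, p.2 \is a Num.int /\ `|p.2| <= N%:R &
     exists r : rat, ratr ka * (p.1 * p.2) = ratr r ^+ 2]] m.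
Proof.
move=> ka0; pose M := `|(numq ka * denq ka)%R|%N.
have M0 : (0 < M)%N by rewrite absz_gt0 mulf_neq0 ?numq_eq0 ?denq_neq0.
have M1 : 1 <= M%:R :> R by rewrite ler1n.
have lM : 0 <= ln M%:R :> R by rewrite ln_ge0.
exists (4 * (2 * M%:R * (1 + ln M%:R)) + 6).
  by rewrite addr_gt0 // !mulr_gt0 //; lra.
move=> N N0; have N1 : 1 <= N%:R :> R by rewrite ler1n.
have lN : 0 <= ln N%:R :> R by rewrite ln_ge0.
have [|m hm sm] := @sqpairs_count (M * N); first by rewrite muln_gt0 M0.
exists (((N.*2.+1) ^ 1 + (N.*2.+1) ^ 1) + m * 4)%N.
  rewrite !natrD natrM !expn1 -addn1 natrD -mul2n natrM.
  rewrite natrM lnM ?posrE ?ltr0n // in hm.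
  have h1 : M%:R * N%:R * (1 + (ln M%:R + ln N%:R)) <= M%:R * (1 + ln M%:R) * (N%:R * (1 + ln N%:R)) :> R.
    rewrite -!mulrA ler_wpM2l // mulrCA ler_wpM2l //; nra.
  have h2 : N%:R <= N%:R * (1 + ln N%:R) :> R by rewrite -{1}[N%:R]mulr1 ler_wpM2l // lerDl.
  have -> : (4 * (2 * M%:R * (1 + ln M%:R)) + 6) * (N%:R * (1 + ln N%:R)) =
     8 * (M%:R * (1 + ln M%:R) * (N%:R * (1 + ln N%:R))) + 6 * (N%:R * (1 + ln N%:R)) :> R by ring.
  move: hm h1 h2; rewrite -!mulrA; set X := N%:R * (1 + ln N%:R); set Y := M%:R * _; set Z := M%:R * _ => *; lra.
pose Z1 := [set p : R * R | p.1 = 0 /\ (p.2 \is a Num.int /\ `|p.2| <= N%:R)].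
pose Z2 := [set p : R * R | p.2 = 0 /\ (p.1 \is a Num.int /\ `|p.1| <= N%:R)].
have I1 := @at_most_int_fun R 'I_1 N; rewrite card_ord in I1.
have hZ1 : at_most Z1 (N.*2.+1 ^ 1).
  apply: (@at_most_inj _ _ (fun p (_ : 'I_1) => p.2) _ _ _ _ _ I1) => [p [_ h] _ //|[a b] [a' b'] [/= -> _] [/= -> _] e].
  by have /= -> := congr1 (fun h => h ord0) e.
have hZ2 : at_most Z2 (N.*2.+1 ^ 1).
  apply: (@at_most_inj _ _ (fun p (_ : 'I_1) => p.1) _ _ _ _ _ I1) => [p [_ h] _ //|[a b] [a' b'] [/= -> _] [/= -> _] e].
  by have /= -> := congr1 (fun h => h ord0) e.
pose NZ := [set p : R * R | [/\ p.1 != 0, p.2 != 0, p.1 \is a Num.int /\ `|p.1| <= N%:R, p.2 \is a Num.int /\ `|p.2| <= N%:R &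
     exists r : rat, ratr ka * (p.1 * p.2) = ratr r ^+ 2]].
suff hNZ : at_most NZ (m * 4).
  apply: at_most_sub (at_mostU (at_mostU hZ1 hZ2) hNZ) => -[a b] [/= h1 h2 h3].
  have [a0|a0] := eqVneq a 0; first by left; left; split.
  have [b0|b0] := eqVneq b 0; first by left; right; split.
  by right; split.
pose tr (x : R) := Num.truncn `|x|.
have trE x : x \is a Num.int -> `|x| = (tr x)%:R.
  by move=> /intrP [z ->]; rewrite /tr -intr_norm -natr_absz natrK.
apply: (@at_most_fibers _ _ (fun p => (M * tr p.1, tr p.2)%N) _ _ _ _ _ sm) => [[a b] [/= a0 b0 [ai aN] [bi bN] [r hr]]|q _].
  have ta := trE a ai; have tb := trE b bi.
  have ta0 : (0 < tr a)%N by rewrite -(ltr_nat R) -ta normr_gt0.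
  have tb0 : (0 < tr b)%N by rewrite -(ltr_nat R) -tb normr_gt0.
  split=> /=.
  - by rewrite muln_gt0 M0 ta0 leq_pmul2l // -(ler_nat R) -ta.
  - by rewrite tb0 (leq_trans _ (leq_pmull N M0)) // -(ler_nat R) -tb.
  apply: (@nat_rat_square _ (r * (denq ka)%:~R)).
  suff h : ratr ((M * tr a * tr b)%:R) = ratr ((r * (denq ka)%:~R) ^+ 2) :> R by exact: (fmorph_inj _ h).
  have rM : ratr (r * (denq ka)%:~R) = ratr r * (denq ka)%:~R :> R by rewrite rmorphM /= ratr_int.
  rewrite ratr_nat rmorphXn /= rM.
  have kaE : ratr ka = (numq ka)%:~R / (denq ka)%:~R :> R by rewrite -[in LHS](divq_num_den ka) rmorph_div /= ?ratr_int ?unitfE ?intr_eq0 ?denq_neq0.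
  have d0 : (denq ka)%:~R != 0 :> R by rewrite intr_eq0 denq_neq0.
  have pos : 0 <= (numq ka * denq ka)%:~R * (a * b).
    have -> : (numq ka * denq ka)%:~R * (a * b) = (ratr r * (denq ka)%:~R) ^+ 2.
      by rewrite exprMn -hr kaE intrM; field.
    exact: sqr_ge0.
  rewrite !natrM -ta -tb natr_absz intr_norm -!normrM -mulrA ger0_norm //.
  by rewrite exprMn -hr kaE intrM; field.
have := @at_most_finType (bool * bool)%type setT; rewrite card_prod card_bool.
apply: (@at_most_inj _ _ (fun p : R * R => (0 < p.1, 0 < p.2))) => // -[a b] [a' b'] [[/= a0 b0 [ai aN] [bi bN] _] e] [[/= a0' b0' [ai' aN'] [bi' bN'] _] e'] [s1 s2].
have /= [e1 e2] : (M * tr a = M * tr a')%N /\ tr b = tr b' by move: e'; rewrite -e => -[].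
have {}e1 : tr a = tr a' by apply/eqP; rewrite -(eqn_pmul2l M0) e1.
have sgn x y : x \is a Num.int -> y \is a Num.int -> (0 < x) = (0 < y) -> tr x = tr y -> x = y.
  move=> xi yi s t; have : `|x| = `|y| by rewrite !trE // t.
  move/eqP; rewrite eqr_norm2 => /orP [/eqP //|/eqP xy].
  by move: s; rewrite xy oppr_gt0; case: ltrgtP => // ->; rewrite oppr0.
by rewrite (sgn a a') // (sgn b b').
Qed.

End Harmonic.

(** * Reciprocal polynomials with bounded coefficients *)

Section Majorant.
Context {R : realType}.
Implicit Types p q : {poly R}.

Definition majorized p q := forall i, `|p`_i| <= q`_i.

Lemma majorizedM p q p' q' : majorized p p' -> majorized q q' -> majorized (p * q) (p' * q').
Proof.
move=> h h' i; rewrite !coefM; apply: le_trans (ler_norm_sum _ _ _) _.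
by apply: ler_sum => a _; rewrite normrM ler_pM.
Qed.

Lemma majorizedD p q p' q' : majorized p p' -> majorized q q' -> majorized (p + q) (p' + q').
Proof. by move=> h h' i; rewrite !coefD; apply: le_trans (ler_normD _ _) _; exact: lerD. Qed.

(** Every entry of X - Q is majorized coefficientwise by X + 1, so the Leibniz expansion is
    majorized by a polynomial that does not depend on Q. *)
Lemma char_poly_bounded (k : nat) : exists2 C : R, 0 < C &
  forall Q : 'M[R]_k, (forall i j, `|Q i j| <= 1) -> forall i, `|(char_poly Q)`_i| <= C.
Proof.
pose H : {poly R} := \sum_(s : 'S_k) \prod_(i < k) ('X + 1).
have X1 i : 0 <= ('X + 1 : {poly R})`_i.
  by rewrite coefD coefX coef1; case: (i == 1%N); case: (i == 0%N); rewrite ?addr0 ?add0r //=; lra.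
have majH (Q : 'M[R]_k) : (forall i j, `|Q i j| <= 1) -> majorized (char_poly Q) H.
  move=> hQ; rewrite /char_poly /determinant /H.
  elim/big_rec2: _ => [|s p q _ pq]; first by move=> i; rewrite coef0 normr0.
  apply: majorizedD => //; rewrite -[X in majorized _ X]mul1r; apply: majorizedM.
    by move=> i; rewrite -polyC1 -polyCN -polyC_exp !coefC; case: (i == 0%N); rewrite ?normr0 // normrX normrN1 expr1n.
  elim/big_rec2: _ => [|i p' q' _ pq']; first by move=> i; rewrite coef1; case: (i == 0%N); rewrite ?normr0 ?normr1.
  apply: majorizedM => // a; rewrite !mxE coefB coefMn coefX coefC coefD coefX coef1.
  have := hQ i (s i); case: (i == s i); rewrite ?mulr1n ?mulr0n; case: a => [|[|a]] /= h;
    rewrite ?(subr0, sub0r, add0r, addr0, normrN, normr1, normr0) //; lra.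
have H0 i : 0 <= H`_i by apply: le_trans (majH 0 _ i) => // a b; rewrite mxE normr0.
exists (1 + \sum_(i < size H) H`_i); first by rewrite ltr_wpDr // sumr_ge0.
move=> Q hQ i; apply: le_trans (majH Q hQ i) _.
have [lt|ge] := ltnP i (size H); last by rewrite nth_default // addr_ge0 // sumr_ge0.
rewrite (bigD1 (Ordinal lt)) //= addrCA lerDl addr_ge0 // sumr_ge0 //.
Qed.

Lemma zero_poly_of_values p : (forall x, x != 0 -> p.[x] = 0) -> p = 0.
Proof.
move=> h; apply/eqP; apply: contraT => p0.
have := max_poly_roots p0 (rs := [seq (i.+1)%:R : R | i <- iota 0 (size p)]).
rewrite size_map size_iota ltnn => -> //.
  by apply/allP => _ /mapP[i _ ->]; apply/rootP/h; rewrite pnatr_eq0.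
by rewrite map_inj_uniq ?iota_uniq // => i i' /eqP; rewrite eqr_nat => /eqP [].
Qed.

(** Only the three middle coefficients of the difference h can survive, and the outer two agree. The
    values at 1 and -1 give 2 h_j + h_(j+1) = 0 and 2 h_j - h_(j+1) = 0. So the two values replace
    the coefficients of degree j and j + 1. *)
Lemma palindromic_inj (j : nat) p q : (0 < j)%N ->
  (size p <= j.*2.+3)%N -> (size q <= j.*2.+3)%N -> p`_j.*2.+2 = q`_j.*2.+2 ->
  (forall i, (i <= j.*2.+2)%N -> p`_i = p`_(j.*2.+2 - i)) ->
  (forall i, (i <= j.*2.+2)%N -> q`_i = q`_(j.*2.+2 - i)) ->
  (forall i, (0 < i < j)%N -> p`_i = q`_i) -> p.[1] = q.[1] -> p.[-1] = q.[-1] -> p = q.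
Proof.
move=> j0 sp sq lpq pp pq low v1 v2; apply/eqP; rewrite -subr_eq0; apply/eqP.
have sh i : (j.*2.+3 <= i)%N -> (p - q)`_i = 0.
  by move=> l; rewrite coefB !nth_default ?subr0 //; [exact: leq_trans l|exact: leq_trans l].
have ph i : (i <= j.*2.+2)%N -> (p - q)`_i = (p - q)`_(j.*2.+2 - i).
  by move=> l; rewrite !coefB pp // pq.
have h0 : (p - q)`_0 = 0 by rewrite ph // subn0 coefB lpq subrr.
have hl i : (i < j)%N -> (p - q)`_i = 0.
  by case: i => // i ij; rewrite coefB low ?subrr.
have h1 : (p - q).[1] = 0 by rewrite hornerD hornerN v1 subrr.
have h2 : (p - q).[-1] = 0 by rewrite hornerD hornerN v2 subrr.
have [h hdef] : exists h : {poly R}, p - q = h by exists (p - q).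
rewrite hdef in sh ph h0 hl h1 h2 *.
have hE : h = h`_j *: 'X^j + h`_j.+1 *: 'X^(j.+1) + h`_j *: 'X^(j.+2).
  apply/polyP => i; rewrite !coefD !coefZ !coefXn.
  have [->|n1] := eqVneq i j; first by rewrite (ltn_eqF (ltnSn j)) (@ltn_eqF j) // !mulr0 !addr0 mulr1.
  have [->|n2] := eqVneq i j.+1; first by rewrite (ltn_eqF (ltnSn _)) /= mulr0n mulr1n !mulr0 add0r addr0 mulr1.
  have [->|n3] := eqVneq i j.+2.
    rewrite /= ?mulr0n mulr1n !mulr0 !add0r mulr1 ph; last by lia.
    by congr (_`_ _); lia.
  rewrite /= !mulr0n !mulr0 !addr0; have [ij|ij] := ltnP i j; first exact: hl.
  have [ij2|ij2] := leqP i j.*2.+2; last exact: sh.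
  by rewrite ph // hl //; lia.
have e1 : 2 * h`_j + h`_j.+1 = 0.
  by move: h1; rewrite {1}hE !hornerD !hornerZ !hornerXn !expr1n; lra.
have e2 : 2 * h`_j - h`_j.+1 = 0.
  move: h2; rewrite {1}hE !hornerD !hornerZ !hornerXn !exprS.
  have -> : h`_j * (-1) ^+ j + h`_j.+1 * (-1 * (-1) ^+ j) + h`_j * (-1 * (-1 * (-1) ^+ j)) =
    (-1) ^+ j * (2 * h`_j - h`_j.+1) by ring.
  by move/eqP; rewrite mulf_eq0 signr_eq0 => /eqP.
have f1 : h`_j = 0 by lra.
have f2 : h`_j.+1 = 0 by lra.
by rewrite hE f1 f2 !scale0r !addr0.
Qed.

Lemma hyperbolic_coef_bounded (k : nat) : exists2 C : R, 0 < C &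
  forall (A : 'M[R]_k.+2) l u w, Lor A -> hyperbolic A l u w -> forall i, `|(char_poly A)`_i| <= C * expR l.
Proof.
have [C C0 hC] := char_poly_bounded k; exists (4 * C); first by rewrite mulr_gt0.
move=> A l u w LA h i; have [Q [QQ -> _]] := hyperbolic_char_poly LA h.
have l0 := hyperb_gt0 h.
have {}hC := hC Q (fun a b => orthogonal_entry a b QQ).
have -> : ('X - (expR l)%:P) * ('X - (expR (- l))%:P) * char_poly Q =
  char_poly Q * 'X * 'X - (expR l + expR (- l)) *: (char_poly Q * 'X) + char_poly Q.
  have e : (expR l)%:P * (expR (- l))%:P = 1 :> {poly R} by rewrite -polyCM expRVN.
  rewrite -mul_polyC polyCD -[X in _ = _ + X]mul1r -e; ring.
rewrite coefD coefB coefZ !coefMX.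
have e1 : 1 <= expR l by rewrite -expR0 ler_expR ltW.
have e2 : expR (- l) <= expR l by rewrite ler_expR; lra.
have e3 := expR_gt0 (- l).
have b0 : `|(if (i == 0)%N then 0 else if (i.-1 == 0)%N then 0 else (char_poly Q)`_i.-2)| <= C.
  by case: ifP => _; [|case: ifP => _]; rewrite ?normr0 //; exact: ltW.
have b1 : `|if (i == 0)%N then 0 else (char_poly Q)`_i.-1| <= C.
  by case: ifP => _; rewrite ?normr0 //; exact: ltW.
apply: le_trans (ler_normD _ _) _; apply: le_trans (lerD (ler_normB _ _) (hC i)) _.
rewrite normrM (ger0_norm (_ : 0 <= expR l + expR (- l))); last by lra.
have h2 : (expR l + expR (- l)) * `|if (i == 0)%N then 0 else (char_poly Q)`_i.-1| <= (2 * expR l) * C.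
  by apply: ler_pM => //; lra.
have h3 : C <= C * expR l by rewrite -[X in X <= _]mulr1 ler_wpM2l // ltW.
lra.
Qed.

(** The transpose of A is conjugate to its inverse by the Lorentz matrix, so det A = 1 and the even
    size give f(x) = x^(n+1) f(1/x) for x != 0, and a polynomial is determined by these values. *)
Lemma Lor_char_poly_palindromic (n : nat) (A : 'M[R]_n.+1) : odd n -> Lor A -> \det A = 1 ->
  forall i, (i <= n.+1)%N -> (char_poly A)`_i = (char_poly A)`_(n.+1 - i).
Proof.
move=> odn LA dA.
have ev : ~~ odd n.+1 by rewrite /= odn.
have neg (M : 'M[R]_n.+1) : \det (- M) = \det M.
  by rewrite -scaleN1r detZ -signr_odd (negbTE ev) expr0 mul1r.
have uA := Lor_unit LA.
have val x : x != 0 -> (char_poly A).[x] = x ^+ n.+1 * (char_poly A).[x^-1].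
  move=> x0; rewrite !horner_char_poly.
  have AT : A^T = lorentz_mx *m invmx A *m lorentz_mx.
    by rewrite (Lor_inv LA) !mulmxA lorentz_mx_sq mul1mx -mulmxA lorentz_mx_sq mulmx1.
  rewrite -det_tr linearB /= tr_scalar_mx AT.
  have -> : x%:M - lorentz_mx *m invmx A *m lorentz_mx = lorentz_mx *m (x%:M - invmx A) *m lorentz_mx.
    by rewrite mulmxBr mulmxBl mul_mx_scalar -scalemxAl lorentz_mx_sq scalemx1.
  rewrite !det_mulmx mulrAC -det_mulmx lorentz_mx_sq det1 mul1r.
  have -> : \det (x%:M - invmx A) = \det A * \det (x%:M - invmx A) by rewrite dA mul1r.
  rewrite -det_mulmx mulmxBr mulmxV // mul_mx_scalar -detZ scalerBr scale_scalar_mx divff //.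
  by rewrite -neg opprB.
pose r := \poly_(i < n.+2) (char_poly A)`_(n.+1 - i).
have sz := size_char_poly A.
have e : char_poly A - r = 0.
  apply: zero_poly_of_values => x x0; rewrite hornerD hornerN val // /r horner_poly.
  rewrite (@horner_coef_wide _ n.+2) ?sz // mulr_sumr [X in X - _](reindex_inj rev_ord_inj) /=.
  apply/eqP; rewrite subr_eq0; apply/eqP; apply: eq_bigr => i _.
  rewrite subSS mulrCA; congr (_ * _).
  have -> : x ^+ n.+1 = x ^+ i * x ^+ (n.+1 - i) by rewrite -exprD subnKC // -ltnS.
  by rewrite exprVn mulfK // expf_neq0.
move=> i le; have : (char_poly A - r)`_i = 0 by rewrite e coef0.
by rewrite coefB /r coef_poly ltnS le => /eqP; rewrite subr_eq0 => /eqP.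
Qed.

End Majorant.

(** * Upper bound for the number of lengths *)

Section LengthUpper.
Context {R : realType} {j : nat}.
Local Notation n := (j.*2.+1).
Local Notation o := (@origin R n).
Implicit Types (A g : 'M[R]_n.+1).
Context {G : set 'M[R]_n.+1} {P : 'M[R]_n.+1} {D N : nat} {rs : seq 'M[R]_n.+1} {Q : 'M[rat]_n.+1}.
Hypothesis ar : arith G P D N rs.
Hypothesis sQ : Q^T = Q.
Hypothesis frame : lorentz_frame Q P.
Hypothesis Grat : G `<=` isom_of_rat P (SO_rat Q).

(** The factor D^(n+1) makes the coefficients integral on G and multiplies the product of two values
    by a square. *)
Definition scoef A (i : nat) : R := D%:R ^+ n.+1 * (char_poly A)`_i.
Definition sval A (x : R) : R := D%:R ^+ n.+1 * (char_poly A).[x].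

Lemma char_poly_frame A : char_poly A = char_poly (P *m A *m invmx P).
Proof.
have Pu := ar_unit ar.
by apply: (@char_poly_conj _ _ _ _ (invmx P)); rewrite ?unitmx_inv // !mulmxA mulVmx // mul1mx.
Qed.

Lemma int_char_poly (m : nat) (M : 'M[R]_m) : intmx M -> forall i, (char_poly M)`_i \is a Num.int.
Proof.
move=> hM i; pose Z := \matrix_(a, b) Num.floor (M a b).
have -> : M = map_mx intr Z by apply/matrixP => a b; rewrite !mxE floorK.
by rewrite -map_char_poly coef_map /= intr_int.
Qed.

Lemma scoef_int A i : G A -> scoef A i \is a Num.int.
Proof.
move=> GA; rewrite /scoef char_poly_frame -char_polyZ rpredM ?rpredX ?natr_int //.
by apply: int_char_poly; exact: (ar_int ar).
Qed.

Lemma svalE A x : sval A x = \sum_(i < n.+2) scoef A i * x ^+ i.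
Proof.
rewrite /sval (@horner_coef_wide _ n.+2) ?size_char_poly // mulr_sumr.
by apply: eq_bigr => i _; rewrite mulrA.
Qed.

Lemma G_det A : G A -> \det A = 1.
Proof.
move=> /Grat [_ [B [_ dB] hB]]; have Pu := ar_unit ar.
by rewrite -(det_conj A Pu) -hB det_map_mx dB rmorph1.
Qed.

Lemma sval_square A : G A -> exists r : rat, ratr (\det Q) * (sval A 1 * sval A (-1)) = ratr r ^+ 2.
Proof.
move=> /Grat [_ [B [BQ dB] hB]].
have c2 : 2 != 0 :> rat by [].
have [|r hr] := isometry_disc_square c2 (_ : ~~ odd n.+1) sQ BQ; first by rewrite /= odd_double.
exists (D%:R ^+ n.+1 * r).
have hv (x : rat) : (char_poly A).[ratr x] = ratr (char_poly B).[x].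
  by rewrite char_poly_frame -hB -map_char_poly horner_map.
have v1 := hv 1; have v2 := hv (-1); rewrite ?(rmorph1, rmorphN) /= in v1 v2.
have rr : ratr (D%:R ^+ n.+1 * r) = D%:R ^+ n.+1 * ratr r :> R by rewrite rmorphM rmorphXn /= ratr_nat.
have := congr1 (@ratr R) hr; rewrite rmorphM /= rmorphM rmorphXn /= -v1 -v2 => h.
rewrite rr exprMn -h /sval; ring.
Qed.

Lemma detQ_neq0 : \det Q != 0.
Proof.
have [Pu PQ] := frame; apply/eqP => q0.
have := congr1 determinant PQ; rewrite !det_mulmx det_map_mx q0 rmorph0 mulr0 mul0r => h.
have : \det (lorentz_mx : 'M[R]_n.+1) * \det (lorentz_mx : 'M[R]_n.+1) = 1 by rewrite -det_mulmx lorentz_mx_sq det1.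
by rewrite -h mul0r => /esym/eqP; rewrite oner_eq0.
Qed.

Lemma coefs_determine_length A B l l' u w u' w' : (0 < j)%N -> G A -> G B ->
  hyperbolic A l u w -> hyperbolic B l' u' w' ->
  (forall i, (0 < i < j)%N -> scoef A i = scoef B i) -> sval A 1 = sval B 1 -> sval A (-1) = sval B (-1) -> l = l'.
Proof.
move=> j0 GA GB hA hB hc h1 h2.
have LA := hyp_isom_Lor (ar_isom ar GA); have LB := hyp_isom_Lor (ar_isom ar GB).
have D0 : D%:R ^+ n.+1 != 0 :> R by rewrite expf_neq0 // gt_eqF // (D_gt0 ar).
have odn : odd n by rewrite /= odd_double.
apply: (hyperbolic_char_poly_inj LA LB hA hB).
apply: (@palindromic_inj _ j); first exact: j0.
- by rewrite size_char_poly.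
- by rewrite size_char_poly.
- have lead (M : 'M[R]_n.+1) : (char_poly M)`_j.*2.+2 = 1.
    by have := char_poly_monic M; rewrite monicE lead_coefE size_char_poly => /eqP.
  by rewrite !lead.
- by apply: Lor_char_poly_palindromic => //; exact: G_det.
- by apply: Lor_char_poly_palindromic => //; exact: G_det.
- by move=> i ij; apply: (mulfI D0); exact: hc.
- exact: (mulfI D0 h1).
- exact: (mulfI D0 h2).
Qed.

Lemma length_count_le (T : R) m : at_most (spectrum_upto G T) m -> length_count G T <= m%:R.
Proof.
move=> /at_most_finite [fs cs].
rewrite /length_count fsbig_finite //= big_const_seq count_predT iter_addr_0 ler_nat.
exact: cs.
Qed.

Lemma length_upper : (0 < j)%N -> exists2 C : R, 0 < C &
  forall T, 1 <= T -> length_count G T <= C * (T * expR (j%:R * T)).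
Proof.
move=> j0; have [C1 C10 hC1] := @hyperbolic_coef_bounded R j.*2.
have [C2 C20 hC2] := @square_int_pairs R _ detQ_neq0.
(* The values at 1 and -1 are signed sums of n + 2 coefficients; hence the last factor. *)
pose C3 := D%:R ^+ n.+1 * C1 * n.+2%:R.
have D0 : 0 < D%:R ^+ n.+1 :> R by rewrite exprn_gt0 // (D_gt0 ar).
have C30 : 0 < C3 by apply: mulr_gt0; [exact: mulr_gt0|rewrite ltr0n].
pose C4 := C3 + 1.
pose C5 := (2 * C4 + 1) ^+ j.-1 * (C2 * (C4 * (2 + ln C4))).
have C41 : 1 <= C4 by rewrite /C4; lra.
have lC4 : 0 <= ln C4 by rewrite ln_ge0.
exists C5; first by rewrite /C5 !mulr_gt0 ?exprn_gt0 //; lra.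
move=> T T1; have T0 : 0 <= T by lra.
pose E := expR T; have E1 : 1 <= E by rewrite -expR0 ler_expR.
pose N' := (Num.truncn (C3 * E)).+1.
have N1 : C3 * E <= N'%:R by apply: ltW; exact: truncnS_gt.
have N2 : N'%:R <= C4 * E.
  have /truncn_itv/andP[h _] : 0 <= C3 * E by rewrite mulr_ge0; lra.
  by rewrite /N' -natr1 /C4; lra.
have [m hm sm] := hC2 N' isT.
have /choice[f hf] : forall l : R, exists A, spectrum_upto G T l -> G A /\ exists u w, hyperbolic A l u w.
  move=> l; have [[[c [A [cg _]]] _]|ns] := pselect (spectrum_upto G T l); last by exists 1%:M.
  exists A => _; have [_ GA _ _] := cg; split=> //.
  by have [u [w [h _]]] := closed_geodesic_hyperbolic (ar_isom ar GA) cg; exists u, w.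
have cb l i : spectrum_upto G T l -> `|scoef (f l) i| <= D%:R ^+ n.+1 * C1 * E.
  move=> sl; have [GA [u [w h]]] := hf l sl.
  rewrite /scoef normrM (ger0_norm (ltW D0)) -[X in _ <= X]mulrA; apply: ler_wpM2l; first exact: ltW.
  apply: le_trans (hC1 _ _ _ _ (hyp_isom_Lor (ar_isom ar GA)) h i) _.
  by rewrite ler_wpM2l ?(ltW C10) // ler_expR; case: sl.
have DE : 0 <= D%:R ^+ n.+1 * C1 * E by apply: mulr_ge0; [apply: mulr_ge0; exact: ltW|exact: le_trans E1].
have cbN l i : spectrum_upto G T l -> `|scoef (f l) i| <= N'%:R.
  move=> sl; apply: le_trans (cb l i sl) _; apply: le_trans N1.
  by rewrite /C3 [X in _ <= X]mulrAC ler_peMr // ler1n.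
have vb l x : spectrum_upto G T l -> `|x| = 1 -> `|sval (f l) x| <= N'%:R.
  move=> sl x1; apply: le_trans N1; rewrite svalE; apply: le_trans (ler_norm_sum _ _ _) _.
  have -> : C3 * E = \sum_(i < n.+2) D%:R ^+ n.+1 * C1 * E.
    by rewrite sumr_const card_ord -[_ *+ _]mulr_natr /C3; ring.
  by apply: ler_sum => i _; rewrite normrM normrX x1 expr1n mulr1; exact: cb.
have vi l (x : R) : spectrum_upto G T l -> x \is a Num.int -> sval (f l) x \is a Num.int.
  move=> sl xi; rewrite svalE rpred_sum // => i _; rewrite rpredM ?rpredX //.
  by apply: scoef_int; have [] := hf l sl.
have I1 := @at_most_int_fun R 'I_j.-1 N'; rewrite card_ord in I1.
have hS : at_most (spectrum_upto G T) (N'.*2.+1 ^ j.-1 * m).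
  apply: (@at_most_fibers _ _ (fun l (i : 'I_j.-1) => scoef (f l) i.+1) _ _ _ _ _ I1) => [l sl i|g _].
    by split; [apply: scoef_int; have [] := hf l sl|exact: cbN].
  apply: (@at_most_inj _ _ (fun l => (sval (f l) 1, sval (f l) (-1))) _ _ _ _ _ sm) => [l [sl _]|l l' [sl el] [sl' el'] [e1 e2]].
    split=> /=.
    - by split; [exact: vi|apply: vb => //; rewrite normr1].
    - by split; [apply: vi => //; rewrite rpredN rpred1|apply: vb => //; rewrite normrN1].
    - by apply: sval_square; have [] := hf l sl.
  have [GA [u [w h]]] := hf l sl; have [GB [u' [w' h']]] := hf l' sl'.
  apply: (coefs_determine_length j0 GA GB h h') => // -[//|i] /andP [_ ij].
  have ij' : (i < j.-1)%N by rewrite -ltnS prednK.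
  have := congr1 (fun F => F (Ordinal ij')) (etrans el (esym el')) => /=; exact.
apply: le_trans (length_count_le hS) _.
have lN : ln N'%:R <= ln C4 + T.
  apply: le_trans (_ : ln (C4 * E) <= _).
    by rewrite ler_ln ?posrE // mulr_gt0 //; lra.
  by rewrite lnM ?posrE ?expR_gt0 ?expRK //; lra.
have lN0 : 0 <= ln (N'%:R : R) by rewrite ln_ge0 // ler1n.
rewrite natrM natrX -addn1 natrD -mul2n natrM.
have h1 : (2 * N'%:R + 1) ^+ j.-1 <= ((2 * C4 + 1) * E) ^+ j.-1 :> R.
  by rewrite lerXn2r // ?nnegrE; nra.
have h2 : m%:R <= C2 * ((C4 * E) * ((2 + ln C4) * T)).
  apply: le_trans hm _; rewrite ler_wpM2l ?(ltW C20) //; apply: ler_pM => //; first by lra.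
  nra.
apply: le_trans (_ : ((2 * C4 + 1) * E) ^+ j.-1 * (C2 * ((C4 * E) * ((2 + ln C4) * T))) <= _).
  by apply: ler_pM => //; rewrite exprn_ge0 // addr_ge0 // mulr_ge0.
have -> : expR (j%:R * T) = E ^+ j.-1 * E by rewrite expRM_natl -/E -exprSr prednK.
by rewrite exprMn /C5 le_eqVlt; apply/orP; left; apply/eqP; ring.
Qed.

End LengthUpper.

(** The denominator of the average must be positive, since a quotient by 0 would be 0. *)
Lemma length_count_gt0 (R : realType) (n : nat) (G : set 'M[R]_n.+1) (T : R) :
  finite_set (spectrum_upto G T) -> geodesic_count G T != 0 -> 0 < length_count G T.
Proof.
move=> fs; rewrite /geodesic_count /length_count !fsbig_finite //=.
case: (fset_set _ : seq R) => [|l s _]; first by rewrite big_nil eqxx.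
by rewrite big_const_seq count_predT iter_addr_0 ltr0n.
Qed.

Theorem theoremE (R : realType) (n : nat) (G : set 'M[R]_n.+1) :
  odd n -> (4 < n)%N ->
  classical_arithmetic_first_type G ->
  ~ cocompact G ->
  exists c : R, 0 < c /\
    \forall l \near +oo,
      c * (expR ((n%:R - 1) * l / 2) / l ^+ 2) <= multiplicity_average G l.
Proof.
move=> odn n4 cl nc.
have [j nE] : exists j, n = j.*2.+1 by exists n./2; rewrite -[LHS]odd_double_half odn.
subst n.
have j0 : (0 < j)%N by case: j n4 {G cl nc odn}.
have [Q [P [D [N [rs [ar sQ frame Grat]]]]]] := arith_of_first_type cl.
have [c [T0 [c0 T00 hlow]]] := geodesic_lower ar odn n4 nc.
have [C C0 hup] := length_upper ar sQ frame Grat j0.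
(* With n - 1 = 2 j, at least c e^(2 j l) / l classes share at most C l e^(j l) lengths. *)
exists (c / C); split; first exact: divr_gt0.
near=> l.
have l0 : T0 <= l by near: l; exact: (nbhs_pinfty_ge (num_real _)).
have l1 : 1 <= l by near: l; exact: (nbhs_pinfty_ge (num_real _)).
have lpos : 0 < l by exact: lt_le_trans l1.
have low := hlow l l0; have up := hup l l1.
pose E := expR (j%:R * l); have E0 : 0 < E by exact: expR_gt0.
have kE : expR (j.*2%:R * l) = E ^+ 2 by rewrite /E -expRM_natl -mul2n natrM mulrA.
rewrite kE in low; rewrite -/E in up.
have -> : (j.*2.+1%:R - 1) * l / 2 = j%:R * l by rewrite -natr1 -mul2n natrM; field.
rewrite -/E.
have g0 : 0 < geodesic_count G l.
  by apply: lt_le_trans low; rewrite mulr_gt0 // divr_gt0 // exprn_gt0.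
have L0 : 0 < length_count G l.
  apply: length_count_gt0; last by rewrite gt_eqF.
  by apply: (spectrum_finite ar odn); exact: ltW.
rewrite /multiplicity_average ler_pdivlMr //.
apply: le_trans low; apply: le_trans (_ : c / C * (E / l ^+ 2) * (C * (l * E)) <= _).
  by rewrite ler_wpM2l // mulr_ge0 ?divr_ge0 ?ltW // exprn_gt0.
rewrite le_eqVlt; apply/orP; left; apply/eqP; field.
by rewrite !gt_eqF.
Unshelve. all: by end_near.
Qed.
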